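(* There exists a planar hypotraceable graph on $154$ vertices, and for every integer $n \geq 156$ there exists a planar hypotraceable graph on $n$ vertices.
   Context: Graphs are finite and simple. A graph $G$ is hypotraceable if it has no Hamiltonian path, but $G-v$ has a Hamiltonian path for every vertex $v$ of $G$. *)

(* Defs.v *)
From HB Require Import structures.
From mathcomp Require Import all_boot all_order all_algebra.
From mathcomp Require Import all_classical all_reals all_analysis.
Import Order.TTheory GRing.Theory Num.Theory.
Import numFieldNormedType.Exports.

Set Implicit Arguments.
Unset Strict Implicit.
Unset Printing Implicit Defensive.

Local Open Scope ring_scope.
Local Open Scope classical_set_scope.

Record sgraph := SGraph {
  vertex :> finType;
  adj : rel vertex;
  adj_sym : symmetric adj;
  adj_irrefl : irreflexive adj }.

Definition edges (G : sgraph) : {set {set G}} :=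
  [set e : {set G} | [exists x, exists y, adj x y && (e == [set x; y])]]%SET.

Section DeleteVertex.
Variables (G : sgraph) (v : G).

Definition del_adj : rel {x : G | x != v} := fun x y => adj (val x) (val y).

Lemma del_adj_sym : symmetric del_adj.
Proof. by move=> x y; rewrite /del_adj adj_sym. Qed.

Lemma del_adj_irrefl : irreflexive del_adj.
Proof. by move=> x; rewrite /del_adj adj_irrefl. Qed.

Definition del_vertex : sgraph := SGraph del_adj_sym del_adj_irrefl.

End DeleteVertex.

Definition hamiltonian_path (G : sgraph) (s : seq G) : Prop :=
  [/\ sorted (@adj G) s, uniq s & forall x : G, x \in s].

Definition traceable (G : sgraph) : Prop :=
  exists s : seq G, hamiltonian_path s.

Definition hypotraceable (G : sgraph) : Prop :=
  ~ traceable G /\ forall v : G, traceable (del_vertex v).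

Definition is_arc (R : realType) (p q : R * R) (A : set (R * R)) : Prop :=
  exists f : R -> R * R,
    [/\ {within `[0, 1], continuous f},
        {in `[0, 1] &, injective f},
        f 0 = p, f 1 = q & A = f @` `[0, 1]].

(* An edge is drawn as an arc between the positions of its ends, and its
   interior (the arc without these two points) meets neither a vertex nor
   another edge; [arc e] is irrelevant when [e] is not an edge. *)
Definition plane_drawing (R : realType) (G : sgraph)
    (pos : G -> R * R) (arc : {set G} -> set (R * R)) : Prop :=
  let interior (e : {set G}) := arc e `\` pos @` [set` e] in
  [/\ injective pos,
      forall x y : G, adj x y -> is_arc (pos x) (pos y) (arc [set x; y]%SET),
      forall e : {set G}, e \in edges G -> interior e `&` range pos = set0
    & forall e e' : {set G}, e \in edges G -> e' \in edges G -> e != e' ->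
        interior e `&` arc e' = set0].

Definition planar (R : realType) (G : sgraph) : Prop :=
  exists (pos : G -> R * R) (arc : {set G} -> set (R * R)),
    plane_drawing pos arc.

(* Main.v *)
(** A cell is a graph with three ports a, b, c such that no Hamiltonian path
    joins two ports, although after the deletion of any vertex some
    Hamiltonian path does.  Four cells H1, ..., H4 are arranged in a ring: H1
    and H2 share their port a, so do H3 and H4, and edges b1b3, c1c3, b2b4,
    c2c4 are added (Thomassen's construction).  A Hamiltonian path with both
    ends outside a cell must cross that cell, its port a excepted, in one run
    from b to c or from c to b, and these four requirements are incompatible;
    the deletion of any vertex makes one cell traversable and then all of them.

    The cells are G - z, with the neighbours of the cubic vertex z as ports,
    for planar graphs G on 36 and 39 vertices that have no Hamiltonian cycle
    by Grinberg's criterion (one quadrilateral, one octagon in the second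
    graph, and otherwise pentagons); here a search verifies this.  A quadrilateral
    with cubic vertices can be enlarged: delete two opposite sides and put a
    new quadrilateral around it, joined by four spokes.  This adds four vertices,
    keeps the cell property, and preserves planarity when the quadrilateral
    bounds the outer face.  With cells of 39 vertices (obtained from the
    first graph by one enlargement) and 38 vertices the rings have 151, 152,
    153 and 154 vertices, hence all orders from 151 on are reached. *)
Require Import Defs.
From Stdlib Require Import ZArith Lia.
From mathcomp Require Import all_boot.
Set Implicit Arguments.
Unset Strict Implicit.
Unset Printing Implicit Defensive.

(** * Cells and rings of four cells *)

(** The incompatibility is one of order along the path. A cell that is crossed between [b] and [c]
    lies, its port [a] excepted, strictly between the two outside vertices attached to [b] and [c].
    The cells [H2] and [H4] are attached to each other, so each would lie between two vertices of
    the other. An end inside [H4] destroys this argument; the predecessor of the shared port [w']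
    then takes its place. Enlargement is asymmetric. Absence of Hamiltonian paths passes to the
    enlarged cell for any quadrilateral, since detours through the new vertices shrink to old sides.
    Existence passes only for a path that uses a side, and this is where cubic corners enter. The
    quadrilateral 0, 1, 2, 3 of the 36-vertex graph has corners of degree four and contains a port,
    so the first enlargement is beyond the lemma: its result is verified by search, and only its new
    quadrilateral starts the induction. Arcs are always straight segments. The cubic quadrilateral
    of the first cell is drawn as the bounding square, so that each enlargement is a concentric
    square of twice the size. Each step adds four vertices; hence four consecutive base orders. *)

Section HamPath.
Variables (T : finType) (e : rel T).
Hypothesis e_sym : symmetric e.
Implicit Types (A B H K : {set T}) (s t : seq T).

Definition hampath (A : {set T}) (x y : T) : Prop :=
  exists s : seq T, [/\ path e x s, last x s = y, uniq (x :: s) & x :: s =i A].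

Lemma hampath1 x : hampath [set x] x x.
Proof. by exists [::]; split=> // y; rewrite !inE. Qed.

Lemma hampath_rev A x y : hampath A x y -> hampath A y x.
Proof.
case=> s [ps <- us sA].
have E : last x s :: rev (belast x s) = rev (x :: s) by rewrite [x :: s]lastI rev_rcons.
exists (rev (belast x s)); split.
- rewrite rev_path; apply: sub_path ps => u v; by rewrite /= e_sym.
- by case: s {ps us sA E} => //= a s; rewrite rev_cons last_rcons.
- by rewrite E rev_uniq.
- by move=> z; rewrite E mem_rev sA.
Qed.

Lemma hampath_ends A x y : hampath A x y -> x \in A /\ y \in A.
Proof.
by case=> s [_ <- _ sA]; rewrite -!sA mem_last mem_head.
Qed.

Lemma hampath_eq A B x y : A = B -> hampath A x y -> hampath B x y.
Proof. by move->. Qed.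

Lemma hampath_cat A B x y u v :
  [disjoint A & B] -> e y u ->
  hampath A x y -> hampath B u v -> hampath (A :|: B) x v.
Proof.
move=> dAB eyu [s [ps ls us sA]] [t [pt lt ut tB]].
exists (s ++ u :: t); split.
- by rewrite cat_path ps /= ls eyu.
- by rewrite last_cat.
- rewrite -cat_cons cat_uniq us ut andbT andTb.
  apply/hasPn => z; rewrite tB => zB; apply/negP; rewrite sA => zA.
  by move: dAB => /pred0P /(_ z) /=; rewrite zA zB.
- by move=> z; rewrite -cat_cons mem_cat sA tB inE.
Qed.

Lemma hampath_glue A B x w v :
  A :&: B = [set w] ->
  hampath A x w -> hampath B w v -> hampath (A :|: B) x v.
Proof.
move=> AB hA [[|u t] [/= pt lt ut tB]].
  rewrite -lt; apply: hampath_eq hA; apply/setP => z; rewrite inE -tB !inE.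
  case: eqVneq => [->|]; rewrite ?orbF // orbT.
  by have /setP/(_ w) := AB; rewrite !inE eqxx => /andP[].
case/andP: pt => ewu pt.
have -> : A :|: B = A :|: (B :\ w).
  apply/setP => z; rewrite !inE; case: eqVneq => [->|] //=.
  by have /setP/(_ w) := AB; rewrite !inE eqxx => /andP[-> _].
apply: (hampath_cat _ ewu hA).
  apply/pred0P => z /=; rewrite !inE; apply/negP => /and3P[zA zw zB].
  by have /setP/(_ z) := AB; rewrite !inE zA zB (negbTE zw).
exists t; split=> //; first by case/andP: ut.
move=> z; rewrite !inE -tB !inE; case: (eqVneq z w) => [->|] //=.
by case/andP: ut; rewrite inE => /negbTE->.
Qed.

(** The last two fields, spanning paths with one free end, serve a single purpose: they provide the
    final stretch of a path in a ring when the damaged cell joins [a] to [b] or to [c]. *)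
Record cell (H : {set T}) (a b c : T) : Prop := Cell {
  cell_a : a \in H; cell_b : b \in H; cell_c : c \in H;
  cell_uniq : uniq [:: a; b; c];
  cell_Nab : ~ hampath H a b;
  cell_Nac : ~ hampath H a c;
  cell_Nbc : ~ hampath H b c;
  cell_del : forall v, v \in H ->
    [\/ hampath (H :\ v) a b, hampath (H :\ v) a c | hampath (H :\ v) b c];
  cell_Sb : exists y, hampath H b y;
  cell_Sc : exists y, hampath H c y }.

Lemma cell_swap H a b c : cell H a b c -> cell H a c b.
Proof.
case=> aH bH cH u nab nac nbc del sb sc; split=> //.
- by move: u; rewrite /= !inE !andbT !negb_or [c == b]eq_sym => /andP[/andP[-> ->] ->].
- by move=> /hampath_rev.
- move=> v /del[h|h|h]; [exact: Or32|exact: Or31|apply: Or33; exact: hampath_rev].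
Qed.

(** When the deleted vertex is itself a port, only the pair of the other two ports can be joined. So
    an intact cell can join any two ports at the price of omitting the third. *)
Lemma cell_del_b H a b c : cell H a b c -> hampath (H :\ b) a c.
Proof.
case=> aH bH cH u nab nac nbc /(_ b bH)[] // /hampath_ends[];
by rewrite !inE eqxx ?andbF.
Qed.

Lemma cell_del_c H a b c : cell H a b c -> hampath (H :\ c) a b.
Proof. by move/cell_swap/cell_del_b. Qed.

Lemma cell_del_a H a b c : cell H a b c -> hampath (H :\ a) b c.
Proof.
case=> aH bH cH u nab nac nbc /(_ a aH)[] // /hampath_ends[];
by rewrite !inE eqxx ?andbF.
Qed.

Lemma cell_N H a b c x y : cell H a b c ->
  x \in [:: a; b; c] -> y \in [:: a; b; c] -> x != y -> ~ hampath H x y.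
Proof.
case=> aH bH cH u nab nac nbc _ _ _; rewrite !inE.
by move=> /or3P[]/eqP-> /or3P[]/eqP->; rewrite ?eqxx // => _ // /hampath_rev.
Qed.

(** * Rings and their symmetries *)

Definition ports_out (H K : {set T}) (a b c b' c' : T) : Prop :=
  forall x y, x \in H -> y \notin H -> e x y ->
    [\/ x = b /\ y = b', x = c /\ y = c' | x = a /\ y \in K].

Record ring (H1 H2 H3 H4 : {set T}) (w w' b1 c1 b2 c2 b3 c3 b4 c4 : T) : Prop := Ring {
  ring1 : cell H1 w b1 c1; ring2 : cell H2 w b2 c2;
  ring3 : cell H3 w' b3 c3; ring4 : cell H4 w' b4 c4;
  ring12 : H1 :&: H2 = [set w]; ring34 : H3 :&: H4 = [set w'];
  ring_dis : [disjoint H1 :|: H2 & H3 :|: H4];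
  ring_cover : forall x, x \in (H1 :|: H2) :|: (H3 :|: H4);
  ring_b13 : e b1 b3; ring_c13 : e c1 c3; ring_b24 : e b2 b4; ring_c24 : e c2 c4;
  ring_out1 : ports_out H1 H2 w b1 c1 b3 c3;
  ring_out2 : ports_out H2 H1 w b2 c2 b4 c4;
  ring_out3 : ports_out H3 H4 w' b3 c3 b1 c1;
  ring_out4 : ports_out H4 H3 w' b4 c4 b2 c2 }.

Lemma ports_out_swap H K a b c b' c' :
  ports_out H K a b c b' c' -> ports_out H K a c b c' b'.
Proof.
by move=> out x y xH yH /(out _ _ xH yH)[]; [apply: Or32|apply: Or31|apply: Or33].
Qed.

(** This and the next two symmetries move any cell to the first place and exchange the roles of [b]
    and [c], so later arguments fix the damaged cell, or the cell of the starting vertex, to be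
    [H1]. *)
Lemma ring_swap_bc H1 H2 H3 H4 w w' b1 c1 b2 c2 b3 c3 b4 c4 :
  ring H1 H2 H3 H4 w w' b1 c1 b2 c2 b3 c3 b4 c4 ->
  ring H1 H2 H3 H4 w w' c1 b1 c2 b2 c3 b3 c4 b4.
Proof. by case=> *; split=> //; exact: cell_swap || exact: ports_out_swap. Qed.

Lemma ring_swap_12 H1 H2 H3 H4 w w' b1 c1 b2 c2 b3 c3 b4 c4 :
  ring H1 H2 H3 H4 w w' b1 c1 b2 c2 b3 c3 b4 c4 ->
  ring H2 H1 H4 H3 w w' b2 c2 b1 c1 b4 c4 b3 c3.
Proof.
case=> *; split=> //; rewrite 1?setIC //.
- by rewrite setUC [H4 :|: _]setUC.
- by move=> x; rewrite [H2 :|: _]setUC [H4 :|: _]setUC.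
Qed.

Lemma ring_swap_13 H1 H2 H3 H4 w w' b1 c1 b2 c2 b3 c3 b4 c4 :
  ring H1 H2 H3 H4 w w' b1 c1 b2 c2 b3 c3 b4 c4 ->
  ring H3 H4 H1 H2 w' w b3 c3 b4 c4 b1 c1 b2 c2.
Proof.
case=> *; split=> //; rewrite 1?e_sym 1?disjoint_sym //.
by move=> x; rewrite setUC.
Qed.

(** The set relations of a ring in pointwise boolean form; with them every disjointness and covering
    goal below becomes a propositional tautology in the memberships of one vertex. *)
Lemma ring_mem H1 H2 H3 H4 w w' b1 c1 b2 c2 b3 c3 b4 c4 :
  ring H1 H2 H3 H4 w w' b1 c1 b2 c2 b3 c3 b4 c4 -> forall z,
  [&& (z == w) == (z \in H1) && (z \in H2), (z == w') == (z \in H3) && (z \in H4),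
    ~~ (((z \in H1) || (z \in H2)) && ((z \in H3) || (z \in H4))) &
    [|| z \in H1, z \in H2, z \in H3 | z \in H4]].
Proof.
move=> R z.
have /setP/(_ z) := ring12 R; rewrite !inE => ->.
have /setP/(_ z) := ring34 R; rewrite !inE => ->.
have /pred0P/(_ z) := ring_dis R; rewrite /= !inE => ->.
by have := ring_cover R z; rewrite !inE -!orbA => ->; rewrite !eqxx.
Qed.

Lemma cell_mem H a b c : cell H a b c -> forall z,
  [&& (z == b) ==> (z \in H), (z == c) ==> (z \in H),
    ~~ ((z == a) && (z == b)) & ~~ ((z == a) && (z == c))].
Proof.
move=> C z; apply/and4P; split.
- by apply/implyP => /eqP->; exact: cell_b C.
- by apply/implyP => /eqP->; exact: cell_c C.
- have /= := cell_uniq C; rewrite !inE !negb_or => /andP[/andP[+ _] _].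
  by apply: contra => /andP[/eqP<- /eqP<-].
- have /= := cell_uniq C; rewrite !inE !negb_or => /andP[/andP[_ +] _].
  by apply: contra => /andP[/eqP<- /eqP<-].
Qed.

(** * Hamiltonian paths of a ring after the deletion of a vertex *)

Ltac mem_cases z := repeat
  (match goal with
   | |- context [z \in ?S] => case: (z \in S)
   | |- context [z == ?y] => case: (z == y)
   end; rewrite ?andbF ?orbT //=).
Ltac set_tauto facts :=
  (apply/pred0P || apply/setP); let z := fresh "z" in (move=> z; rewrite /= !inE; move: (facts z); mem_cases z).

(** The route is [b3], [b1] to [c1] through the damaged cell, [c3] to [w'] to [b4] through [H3]
    without [b3] and [H4] without [c4], [b2] to [c2] through [H2] without [w], and finally [c4]. The
    ports omitted in [H3] and [H4] become the two ends. *)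
Lemma ring_del1_bc H1 H2 H3 H4 w w' b1 c1 b2 c2 b3 c3 b4 c4 v :
  ring H1 H2 H3 H4 w w' b1 c1 b2 c2 b3 c3 b4 c4 -> v \in H1 ->
  hampath (H1 :\ v) b1 c1 -> exists x y, hampath [set~ v] x y.
Proof.
move=> R vH1 h1; exists b3, c4.
have facts z : [&& (z == v) ==> (z \in H1), (z == w) == (z \in H1) && (z \in H2),
    (z == w') == (z \in H3) && (z \in H4),
    ~~ (((z \in H1) || (z \in H2)) && ((z \in H3) || (z \in H4))),
    [|| z \in H1, z \in H2, z \in H3 | z \in H4],
    (z == b3) ==> (z \in H3), ~~ ((z == w') && (z == b3)),
    (z == c4) ==> (z \in H4) & ~~ ((z == w') && (z == c4))].
  have /implyP zv : (z == v) ==> (z \in H1) by apply/implyP => /eqP->.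
  have /and4P[-> -> -> ->] := ring_mem R z; have /and4P[-> _ -> _] := cell_mem (ring3 R) z.
  by have /and4P[_ -> _ ->] := cell_mem (ring4 R) z; rewrite !andbT; apply/implyP.
have h3 := hampath_rev (cell_del_b (ring3 R)).
have h4 := cell_del_c (ring4 R); have h2 := cell_del_a (ring2 R).
have h34 : hampath (H3 :\ b3 :|: H4 :\ c4) c3 b4.
  by apply: hampath_glue h3 h4; set_tauto facts.
have e42 : e b4 b2 by rewrite e_sym (ring_b24 R).
have e31 : e b3 b1 by rewrite e_sym (ring_b13 R).
have h := hampath_cat _ e31 (hampath1 b3) h1.
have {h34} := hampath_cat _ e42 h34 h2.
have {}h := hampath_cat _ (ring_c13 R) (h _).
move=> h'; apply: hampath_eq (hampath_cat _ (ring_c24 R) (h _ _ _ _ (h' _)) (hampath1 c4)).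
all: set_tauto facts.
Qed.

(** The route starts somewhere in [H3], spans it up to [b3], crosses the damaged cell from [b1] to
    [w], goes on to [b2] through [H2] without [c2], from [b4] to [c4] through [H4] without [w'], and
    ends in the omitted [c2]. Since [H3] is used whole, [w'] is already visited there. *)
Lemma ring_del1_wb H1 H2 H3 H4 w w' b1 c1 b2 c2 b3 c3 b4 c4 v :
  ring H1 H2 H3 H4 w w' b1 c1 b2 c2 b3 c3 b4 c4 -> v \in H1 ->
  hampath (H1 :\ v) w b1 -> exists x y, hampath [set~ v] x y.
Proof.
move=> R vH1 h1; have [y h3] := cell_Sb (ring3 R); exists y, c2.
have facts z : [&& (z == v) ==> (z \in H1), (z == w) == (z \in H1) && (z \in H2),
    (z == w') == (z \in H3) && (z \in H4),
    ~~ (((z \in H1) || (z \in H2)) && ((z \in H3) || (z \in H4))),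
    [|| z \in H1, z \in H2, z \in H3 | z \in H4],
    (z == c2) ==> (z \in H2), ~~ ((z == w) && (z == c2)) & ~~ ((z == w) && (z == v))].
  have /implyP zv : (z == v) ==> (z \in H1) by apply/implyP => /eqP->.
  have /and4P[-> -> -> ->] := ring_mem R z; have /and4P[_ -> _ ->] := cell_mem (ring2 R) z.
  rewrite /=; apply/andP; split; first exact/implyP.
  by have [+ _] := hampath_ends h1; rewrite !inE => /andP[wv _]; apply: contra wv => /andP[/eqP-> /eqP->].
have h2 := cell_del_c (ring2 R); have h4 := cell_del_a (ring4 R).
have h12 := hampath_glue _ (hampath_rev h1) h2.
have e31 : e b3 b1 by rewrite e_sym (ring_b13 R).
have e42 : e c4 c2 by rewrite e_sym (ring_c24 R).
have {h3} := hampath_cat _ e31 (hampath_rev h3) (h12 _).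
move=> h; have {}h := hampath_cat _ (ring_b24 R) (h _ _) h4.
apply: hampath_eq (hampath_cat _ e42 (h _ _ _) (hampath1 c2)).
all: set_tauto facts.
Qed.

Lemma ring_del1 H1 H2 H3 H4 w w' b1 c1 b2 c2 b3 c3 b4 c4 v :
  ring H1 H2 H3 H4 w w' b1 c1 b2 c2 b3 c3 b4 c4 -> v \in H1 ->
  exists x y, hampath [set~ v] x y.
Proof.
move=> R vH1; have [] := cell_del (ring1 R) vH1.
- exact: ring_del1_wb R vH1.
- exact: ring_del1_wb (ring_swap_bc R) vH1.
- exact: ring_del1_bc R vH1.
Qed.

Lemma ring_del H1 H2 H3 H4 w w' b1 c1 b2 c2 b3 c3 b4 c4 v :
  ring H1 H2 H3 H4 w w' b1 c1 b2 c2 b3 c3 b4 c4 ->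
  exists x y, hampath [set~ v] x y.
Proof.
move=> R; have := ring_cover R v; rewrite !inE => /orP[]/orP[] vH.
- exact: ring_del1 R vH.
- exact: ring_del1 (ring_swap_12 R) vH.
- exact: ring_del1 (ring_swap_13 R) vH.
- exact: ring_del1 (ring_swap_12 (ring_swap_13 R)) vH.
Qed.

(** * Runs of a Hamiltonian path inside a cell *)

Lemma index_cat_lt (s1 s2 : seq T) x y :
  uniq (s1 ++ s2) -> x \in s1 -> y \in s2 -> index x (s1 ++ s2) < index y (s1 ++ s2).
Proof.
rewrite cat_uniq => /and3P[_ /hasPn ns _] xs ys.
rewrite !index_cat xs (negbTE (ns y ys)).
by apply: (@leq_trans (size s1)); rewrite ?index_mem // leq_addr.
Qed.

Lemma uniq_pred l1 l2 m1 m2 (x y a : T) :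
  uniq (l1 ++ x :: a :: l2) -> l1 ++ x :: a :: l2 = m1 ++ y :: a :: m2 -> x = y.
Proof.
move=> u E; have sz : size l1 = size m1.
  have ix l z r : uniq (l ++ z :: a :: r) -> index a (l ++ z :: a :: r) = (size l).+1.
    rewrite -cat_rcons cat_uniq => /and3P[_ /= + _]; rewrite negb_or => /andP[na _].
    by rewrite index_cat (negbTE na) /= eqxx addn0 size_rcons.
  by have /eqP := ix _ _ _ u; rewrite E ix -?E // eqSS => /eqP.
by move/eqP: E; rewrite eqseq_cat // => /andP[_ /eqP[]].
Qed.

Lemma has_split (P : pred T) s :
  has P s -> exists s1 x s2, [/\ s = s1 ++ x :: s2, P x & ~~ has P s1].
Proof.
elim: s => //= x s IH; have [Px _|nPx /IH [s1 [y [s2 [-> Py hs]]]]] := boolP (P x).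
  by exists [::], x, s.
by exists (x :: s1), y, s2; rewrite /= (negbTE nPx).
Qed.

(** Cuts out the first maximal run inside [P], with its entering edge and its leaving edge. Since
    [z] is again outside of [P], the lemma can be applied anew to the rest [s2] to find further
    runs. *)
Lemma first_block (P : pred T) p s :
  ~~ P p -> ~~ P (last p s) -> has P s -> path e p s ->
  exists s1 u m z s2,
    [/\ s = s1 ++ (u :: m) ++ z :: s2, ~~ has P (p :: s1), all P (u :: m) /\ ~~ P z,
        e (last p s1) u /\ path e u m & e (last u m) z /\ path e z s2].
Proof.
move=> Pp Pl /has_split [s1 [u [r [E Pu hs1]]]]; rewrite {s}E last_cat /= in Pl * => ps.
have /has_split [m [z [s2 [E Pz /hasPn hm]]]] : has (predC P) r.
  rewrite has_predC; apply: contra Pl => /allP Pr.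
  by have := mem_last u r; rewrite inE => /predU1P[->|/Pr].
rewrite {r}E in Pl ps *; exists s1, u, m, z, s2; rewrite /= negb_or Pp hs1.
move: ps; rewrite cat_path /= cat_path /= => /and3P[_ -> /and3P[-> -> ->]].
split=> //; split=> //; rewrite Pu; apply/allP => x /hm /=; by rewrite negbK.
Qed.

(* The path [p :: t] meets [H :\ a] in one block, entered from [b'] and left to
   [c'] or conversely, and its visit to [a] stays outside of [H]. *)
Lemma cell_block H K a b c b' c' p t :
  cell H a b c -> ports_out H K a b c b' c' ->
  path e p t -> uniq (p :: t) -> (forall x, x \in p :: t) ->
  p \notin H -> last p t \notin H ->
  let i := index^~ (p :: t) in
  ((forall x, x \in H -> x != a -> i b' < i x < i c') \/
   (forall x, x \in H -> x != a -> i c' < i x < i b')) /\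
  (forall s1 y s2, p :: t = s1 ++ y :: a :: s2 -> y \notin H).
Proof.
move=> C out pt ut all_t pH qH i.
have /= /and3P[+ + _] := cell_uniq C; rewrite !inE negb_or => /andP[ab ac] bc.
have PT x y : x \in H -> y \notin H -> e x y -> [\/ x = b /\ y = b', x = c /\ y = c' | x = a].
  by move=> xH yH /(out _ _ xH yH) [?|?|[? _]]; [apply: Or31|apply: Or32|apply: Or33].
have ht : has (mem H) t.
  apply/hasP; exists a => /=; last exact: cell_a C.
  have := all_t a; rewrite inE => /predU1P[ap|//].
  by rewrite -ap (cell_a C) in pH.
have [s1 [u [m [z [s2 [tE hs1 [am zH] [yu pm] [vz pz]]]]]]] := first_block pH qH ht pt.
set y := last p s1 in yu; set v := last u m in vz.
have yH : y \notin H by apply: contra hs1 => yH; apply/hasP; exists y => //; exact: mem_last.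
have uH : u \in H by case/andP: am.
have vH : v \in H by apply: (allP am); exact: mem_last.
have stE : p :: t = (p :: s1) ++ (u :: m) ++ z :: s2 by rewrite tE.
have pu : [\/ u = b /\ y = b', u = c /\ y = c' | u = a] by apply: PT; rewrite // e_sym.
have pv : [\/ v = b /\ z = b', v = c /\ z = c' | v = a] by apply: PT.
have single (x : T) l : uniq (x :: l) -> x = last x l -> l = [::].
  by case/lastP: l => // l z0; rewrite last_rcons => /= /andP[+ _] E; rewrite E mem_rcons mem_head.
have uum : uniq (u :: m) by move: ut; rewrite stE !cat_uniq => /and3P[_ _ /and3P[]].
(* The path must return to [H]: a single run would be a Hamiltonian path of the cell between two
   ports, or, if it were one vertex, would force [a] and [b] to coincide. *)
have hs2 : has (mem H) s2.
  apply/negPn/negP => nhs2.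
  have umH : u :: m =i H.
    move=> x; apply/idP/idP => [/(allP am)//|xH].
    have := all_t x; rewrite stE !mem_cat => /orP[xs|/orP[//|]].
      by case/negP: hs1; apply/hasP; exists x.
    rewrite inE => /predU1P[xz|xs]; first by case/negP: zH; rewrite -xz.
    by case/negP: nhs2; apply/hasP; exists x.
  have h : hampath H u v by exists m.
  have mab x0 y0 : [\/ x0 = b /\ y0 = b', x0 = c /\ y0 = c' | x0 = a] -> x0 \in [:: a; b; c].
    by case=> [[->]|[->]|->]; rewrite !inE eqxx ?orbT.
  have [uv|uv] := eqVneq u v; last exact: cell_N C (mab _ _ pu) (mab _ _ pv) uv h.
  have m0 := single _ _ uum uv; rewrite m0 in umH.
  by move: (umH a) (umH b) ab; rewrite (cell_a C) (cell_b C) !inE => /eqP-> /eqP->; rewrite eqxx.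
have zs2 : last z s2 = last p t by rewrite tE !last_cat.
rewrite -zs2 in qH.
have [s3 [u' [m' [z' [s4 [s2E hs3 [am' zH'] [yu' pm'] [vz' pz']]]]]]] := first_block zH qH hs2 pz.
set y' := last z s3 in yu'; set v' := last u' m' in vz'.
have yH' : y' \notin H by apply: contra hs3 => yH'; apply/hasP; exists y' => //; exact: mem_last.
have uH' : u' \in H by case/andP: am'.
have vH' : v' \in H by apply: (allP am'); exact: mem_last.
have stE' : p :: t = (p :: s1) ++ (u :: m) ++ (z :: s3) ++ (u' :: m') ++ z' :: s4 by rewrite stE s2E.
have pu' : [\/ u' = b /\ y' = b', u' = c /\ y' = c' | u' = a] by apply: PT; rewrite // e_sym.
have pv' : [\/ v' = b /\ z' = b', v' = c /\ z' = c' | v' = a] by apply: PT.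
have uum' : uniq (u' :: m').
  by move: ut; rewrite stE' !cat_uniq => /and3P[_ _ /and3P[_ _ /and3P[_ _ /and3P[]]]].
have dis l1 l2 x x' : p :: t = l1 ++ l2 -> x \in l1 -> x' \in l2 -> x != x'.
  move=> E xl xl'; apply/eqP => xx'; have := index_cat_lt (s1 := l1) (s2 := l2) (x := x) (y := x').
  by rewrite -E ut xl xl' xx' ltnn => /(_ isT isT isT).
have yz : y != z by apply: (dis _ _ _ _ stE); rewrite ?mem_last // mem_cat mem_head orbT.
have yz' : y' != z'.
  by apply: (dis ((p :: s1) ++ (u :: m) ++ (z :: s3)) ((u' :: m') ++ z' :: s4));
    rewrite ?stE' -?catA // !mem_cat ?mem_last ?mem_head ?orbT.
have dm x x' : x \in u :: m -> x' \in u' :: m' -> x != x'.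
  by move=> xm xm'; apply: (dis ((p :: s1) ++ (u :: m)) ((z :: s3) ++ (u' :: m') ++ z' :: s4));
    rewrite ?stE' -?catA // !mem_cat ?xm ?xm' ?orbT.
have [hu hv hu' hv'] : [/\ u \in u :: m, v \in u :: m, u' \in u' :: m' & v' \in u' :: m'].
  by rewrite !mem_head !mem_last.
(* A third run would need a port of its own. Hence, once the first two runs contain all three ports,
   they cover [H]; this is [cover]. *)
have h4 : has (mem H) s4 -> exists x, [&& x \in [:: a; b; c], x \notin u :: m & x \notin u' :: m'].
  move=> hs4; have zs4 : last z' s4 = last z s2 by rewrite s2E !last_cat.
  rewrite -zs4 in qH.
  have [s5 [x [m5 [z5 [s6 [s4E hs5 [am5 zH5] [yu5 _] _]]]]]] := first_block zH' qH hs4 pz'.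
  have xs4 : x \in s4 by rewrite s4E !mem_cat mem_head orbT.
  have stE5 : p :: t = ((p :: s1) ++ (u :: m) ++ (z :: s3) ++ (u' :: m') ++ [:: z']) ++ s4.
    by rewrite stE' -!catA.
  exists x; apply/and3P; split.
  - have : [\/ x = b /\ last z' s5 = b', x = c /\ last z' s5 = c' | x = a].
      apply: PT; first by case/andP: am5.
        by apply: contra hs5 => h; apply/hasP; exists (last z' s5) => //; exact: mem_last.
      by rewrite e_sym.
    by case=> [[->]|[->]|->]; rewrite !inE eqxx ?orbT.
  - apply/negP => xm; suff : x != x by rewrite eqxx.
    by apply: (dis _ _ _ _ stE5) => //; rewrite mem_cat mem_cat xm orbT.
  - apply/negP => xm; suff : x != x by rewrite eqxx.
    by apply: (dis _ _ _ _ stE5) => //; rewrite !mem_cat xm !orbT.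
have cover x : {subset [:: a; b; c] <= (u :: m) ++ (u' :: m')} -> x \in H -> x \in (u :: m) ++ (u' :: m').
  move=> sub xH; have := all_t x; rewrite stE' !mem_cat.
  case/orP=> [xs|/orP[->//|/orP[xs|/orP[->|]]]]; rewrite ?orbT //.
  - by case/negP: hs1; apply/hasP; exists x.
  - by case/negP: hs3; apply/hasP; exists x.
  rewrite inE => /predU1P[xz|xs]; first by case/negP: zH'; rewrite -xz.
  have /h4 [x0 /and3P[/sub + n1 n2]] : has (mem H) s4 by apply/hasP; exists x.
  by rewrite mem_cat (negbTE n1) (negbTE n2).
have block s0 y0 u0 m0 z0 s0' : p :: t = (s0 ++ [:: y0]) ++ (u0 :: m0) ++ z0 :: s0' ->
    forall x, x \in u0 :: m0 -> i y0 < i x < i z0.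
  move=> E x xm; apply/andP; split; rewrite /i E.
    by apply: index_cat_lt; rewrite -?E // !mem_cat ?xm ?mem_head ?orbT.
  rewrite catA; apply: index_cat_lt; first by rewrite -catA -E.
    by rewrite mem_cat xm orbT.
  by rewrite mem_head.
have E1 : p :: t = (belast p s1 ++ [:: y]) ++ (u :: m) ++ z :: s2.
  by rewrite stE [p :: s1]lastI cats1.
have E2 : p :: t = (((p :: s1) ++ (u :: m) ++ belast z s3) ++ [:: y']) ++ (u' :: m') ++ z' :: s4.
  by rewrite stE' -!catA [z :: s3]lastI -cats1 -catA.
have sub3 x0 y0 : x0 \in (u :: m) ++ (u' :: m') -> y0 \in (u :: m) ++ (u' :: m') ->
  a \in (u :: m) ++ (u' :: m') -> (x0 = b /\ y0 = c \/ x0 = c /\ y0 = b) ->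
  {subset [:: a; b; c] <= (u :: m) ++ (u' :: m')}.
  by move=> xm ym zm E x; rewrite !inE => /or3P[]/eqP->; case: E => -[F1 F2]; rewrite -?F1 -?F2.
have fin1 : u = a -> v = a -> (u' = b /\ v' = c \/ u' = c /\ v' = b) ->
   (forall x, x \in H -> x != a -> i y' < i x < i z') /\
   (forall s1 y s2, p :: t = s1 ++ y :: a :: s2 -> y \notin H).
  move=> ua va uv'; have m0 := single _ _ uum (etrans ua (esym va)); split.
    move=> x xH xa; apply: (block _ _ _ _ _ _ E2).
    have sub : {subset [:: a; b; c] <= (u :: m) ++ (u' :: m')}.
      by apply: (sub3 u' v') => //; rewrite mem_cat ?hu' ?hv' -?ua ?hu ?orbT.
    by have := cover x sub xH; rewrite mem_cat m0 inE ua (negbTE xa).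
  move=> r1 x r2 Er; suff <- : y = x by [].
  move: E1; rewrite m0 ua -catA /= => E1; apply: (@uniq_pred (belast p s1) (z :: s2) r1 r2 y x a).
    by rewrite -E1.
  by rewrite -E1 Er.
have fin2 : u' = a -> v' = a -> (u = b /\ v = c \/ u = c /\ v = b) ->
   (forall x, x \in H -> x != a -> i y < i x < i z) /\
   (forall s1 y s2, p :: t = s1 ++ y :: a :: s2 -> y \notin H).
  move=> ua va uv'; have m0 := single _ _ uum' (etrans ua (esym va)); split.
    move=> x xH xa; apply: (block _ _ _ _ _ _ E1).
    have sub : {subset [:: a; b; c] <= (u :: m) ++ (u' :: m')}.
      by apply: (sub3 u v) => //; rewrite mem_cat ?hu ?hv -?ua ?hu' ?orbT.
    have := cover x sub xH; rewrite mem_cat => /orP[//|].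
    by rewrite m0 inE ua (negbTE xa).
  move=> r1 x r2 Er; suff <- : y' = x by [].
  move: E2; rewrite m0 ua !catA cats1 -cats1 -!catA /= => E2.
  have E3 : p :: t = (p :: s1 ++ u :: m ++ belast z s3) ++ y' :: a :: z' :: s4.
    by rewrite E2 /= -!catA /= -!catA.
  apply: (@uniq_pred (p :: s1 ++ u :: m ++ belast z s3) (z' :: s4) r1 r2 y' x a).
    by rewrite -E3.
  by rewrite -E3 Er.
have n1 := dm _ _ hu hu'; have n2 := dm _ _ hu hv'; have n3 := dm _ _ hv hu'; have n4 := dm _ _ hv hv'.
have nn (x x' : T) : x != x' -> x = x' -> False by move=> + xx'; rewrite xx' eqxx.
(* The two runs have no port in common, and a run cannot be the single vertex [b] or [c], whose
   outside neighbour would then occur twice. Of the 81 cases four survive: one run is [a] alone, the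
   other joins [b] and [c] in one of the two directions. *)
case: pu => [[ub yb]|[uc yc]|ua]; case: pv => [[vb zb]|[vc zc]|va];
  case: pu' => [[ub' yb']|[uc' yc']|ua']; case: pv' => [[vb' zb']|[vc' zc']|va'];
  try by [case: (nn _ _ yz); congruence | case: (nn _ _ yz'); congruence
     | case: (nn _ _ n1); congruence | case: (nn _ _ n2); congruence
     | case: (nn _ _ n3); congruence | case: (nn _ _ n4); congruence ].
- have [f1 f2] := fin2 ua' va' (or_introl (conj ub vc)); split=> //.
  by left; rewrite -yb -zc.
- have [f1 f2] := fin2 ua' va' (or_intror (conj uc vb)); split=> //.
  by right; rewrite -yc -zb.
- have [f1 f2] := fin1 ua va (or_introl (conj ub' vc')); split=> //.
  by left; rewrite -yb' -zc'.
- have [f1 f2] := fin1 ua va (or_intror (conj uc' vb')); split=> //.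
  by right; rewrite -yc' -zb'.
Qed.

(** If the path ended outside, its first run would leave at [b] or [c]. Without a return this run is
    a forbidden Hamiltonian path of the cell from [a]. After a return, the next run has only one
    port left for both entering and leaving, and so would use the same outside neighbour twice. *)
Lemma cell_end H K a b c b' c' x t :
  cell H a b c -> ports_out H K a b c b' c' ->
  path e a (x :: t) -> uniq (a :: x :: t) -> (forall y, y \in a :: x :: t) ->
  x \in H -> last x t \in H.
Proof.
move=> C out pt ut all_t xH; apply/negPn/negP => qH.
have PT x1 y1 : x1 \in H -> y1 \notin H -> e x1 y1 ->
    [\/ x1 = b /\ y1 = b', x1 = c /\ y1 = c' | x1 = a].
  by move=> x1H yH /(out _ _ x1H yH) [?|?|[? _]]; [apply: Or31|apply: Or32|apply: Or33].
have /has_split [m [z [s2 [E zH /hasPn hm]]]] : has (predC (mem H)) (x :: t).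
  by apply/hasP; exists (last x t); rewrite ?mem_last.
case: m => [|x' m] in E hm *; first by case: E => E; move: zH; rewrite -E /= xH.
case: E => ? E; subst x' t; move: (pt); rewrite /= cat_path /= => /and4P[eax pm evz pz].
set v := last x m in evz.
have vm : v \in x :: m by exact: mem_last.
have mH y : y \in x :: m -> y \in H by move=> /hm /=; rewrite negbK.
have am y : y \in x :: m -> y != a.
  move=> ym; apply: contraTneq ut => <- /=; have : y \in x :: m ++ z :: s2 by rewrite -cat_cons mem_cat ym.
  by move=> ->.
have va := am _ vm.
have pv : v = b /\ z = b' \/ v = c /\ z = c'.
  by have [?|?|/eqP] := PT _ _ (mH _ vm) zH evz; [left|right|rewrite (negbTE va)].
have hs2 : has (mem H) s2.
  apply/negPn/negP => nhs2; suff : hampath H a v.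
    apply: (cell_N C); rewrite ?inE ?eqxx //; last by rewrite eq_sym.
    by case: pv => [[->]|[->]] _; rewrite eqxx ?orbT.
  exists (x :: m); split=> //=; first by rewrite eax pm.
    by move: ut; rewrite -!cat_cons cat_uniq => /and3P[].
  move=> y; apply/idP/idP; first by rewrite inE => /predU1P[->|/mH //]; exact: cell_a C.
  move=> yH; have := all_t y; rewrite -!cat_cons mem_cat => /orP[//|].
  rewrite inE => /predU1P[yz|ys]; first by move: zH; rewrite -yz /= yH.
  by case/negP: nhs2; apply/hasP; exists y.
rewrite /= last_cat /= in qH.
have [s3 [u [m' [z' [s4 [s2E hs3 [am' zH'] [yu pm'] [vz' _]]]]]]] := first_block zH qH hs2 pz.
set y := last z s3 in yu; set v' := last u m' in vz'.
have yH : y \notin H by apply: contra hs3 => yH; apply/hasP; exists y => //; exact: mem_last.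
have uH : u \in H by case/andP: am'.
have vH' : v' \in H by apply: (allP am'); exact: mem_last.
have sE : a :: (x :: m) ++ z :: s2 = (a :: x :: m) ++ (z :: s3) ++ (u :: m') ++ z' :: s4.
  by rewrite s2E.
rewrite -cat_cons sE in ut.
have dis y1 : y1 \in u :: m' -> y1 != a /\ y1 != v.
  move=> y1m; split; apply: contraTneq ut => E; rewrite cat_uniq; apply/negP => /and3P[_ /hasPn /(_ y1) + _];
    by rewrite !mem_cat y1m orbT E => /(_ isT); rewrite /= inE ?eqxx ?vm ?orbT.
have [ua uv] := dis u (mem_head _ _); have [va' vv] := dis v' (mem_last _ _).
have yz' : y != z'.
  apply/eqP => E; have {}ut : uniq (((a :: x :: m) ++ (z :: s3) ++ u :: m') ++ z' :: s4).
    by rewrite -!catA.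
  suff : index y (((a :: x :: m) ++ (z :: s3) ++ u :: m') ++ z' :: s4) <
         index z' (((a :: x :: m) ++ (z :: s3) ++ u :: m') ++ z' :: s4) by rewrite E ltnn.
  by apply: index_cat_lt ut _ _; rewrite ?mem_head // mem_cat mem_cat mem_last orbT.
have euy : e u y by rewrite e_sym.
have nn (x1 x2 : T) : x1 != x2 -> x1 = x2 -> False by move=> + E; rewrite E eqxx.
have [[u1 y1]|[u1 y1]|/nn] := PT _ _ uH yH euy; last exact;
  have [[v1 z1]|[v1 z1]|/nn] := PT _ _ vH' zH' vz'; try exact; case: pv => [[v2 _]|[v2 _]];
  try by [case: (nn _ _ yz'); congruence | case: (nn _ _ uv); congruence | case: (nn _ _ vv); congruence].
Qed.

(** * Absence of Hamiltonian paths in a ring *)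

Lemma mem_pred p t x : path e p t -> x \in t ->
  exists s1 y s2, p :: t = s1 ++ y :: x :: s2 /\ e y x.
Proof.
move=> pt /splitPr xt; case: xt pt => t1 t2; rewrite cat_path /= => /and3P[_ eyx _].
by exists (belast p t1), (last p t1), t2; split=> //; rewrite -[RHS]cat_rcons -lastI.
Qed.

(** The ends lie in different halves and neither is a shared port. Then [H2] is always crossed, and
    so is at least one of [H3] and [H4]. *)
Lemma ring_no_ham_aux H1 H2 H3 H4 w w' b1 c1 b2 c2 b3 c3 b4 c4 p q :
  ring H1 H2 H3 H4 w w' b1 c1 b2 c2 b3 c3 b4 c4 ->
  p \in H1 -> q \in H3 :|: H4 -> p \notin H2 -> (q \notin H4) || (q \notin H3) ->
  ~ hampath setT p q.
Proof.
move=> R pH1 qH34 pH2 qq [t [pt lt ut at_]].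
have all_t x : x \in p :: t by rewrite at_ inE.
have facts := ring_mem R.
have [pH3 pH4] : p \notin H3 /\ p \notin H4.
  by have := facts p; rewrite pH1 /= => /and4P[_ _ + _]; rewrite negb_or => /andP[].
have [qH1 qH2] : q \notin H1 /\ q \notin H2.
  have := facts q; move: qH34; rewrite inE => -> /and4P[_ _ + _].
  by rewrite andbT negb_or => /andP[].
have := cell_block (ring2 R) (ring_out2 R) pt ut all_t pH2; rewrite lt => /(_ qH2).
set i := index^~ _ => -[ord2 _].
have port H a b c : cell H a b c -> [/\ b \in H, c \in H, b != a & c != a].
  by case=> _ bH cH /=; rewrite !inE negb_or ![a == _]eq_sym => /and3P[/andP[-> ->] _ _].
have [b2H c2H b2w c2w] := port _ _ _ _ (ring2 R).
have [b4H c4H b4w c4w] := port _ _ _ _ (ring4 R).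
have {}ord2 : (i b4 < i b2 < i c4 /\ i b4 < i c2 < i c4) \/ (i c4 < i b2 < i b4 /\ i c4 < i c2 < i b4).
  by case: ord2 => o; [left|right]; split; exact: o.
(* If [H4] is crossed as well, [b2] and [c2] lie strictly between [b4] and [c4] on the path, and
   conversely, which is absurd. *)
case/orP: qq => [qH4|qH3].
  have := cell_block (ring4 R) (ring_out4 R) pt ut all_t pH4; rewrite lt => /(_ qH4) [ord4 _].
  have {}ord4 : (i b2 < i b4 < i c2 /\ i b2 < i c4 < i c2) \/ (i c2 < i b4 < i b2 /\ i c2 < i c4 < i b2).
    by case: ord4 => o; [left|right]; split; exact: o.
  case: ord2 => -[/andP[o1 o2] /andP[o3 o4]]; case: ord4 => -[/andP[o5 o6] /andP[o7 o8]].
  - by have := ltn_trans o1 o5; rewrite ltnn.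
  - by have := ltn_trans o3 o5; rewrite ltnn.
  - by have := ltn_trans o4 o6; rewrite ltnn.
  - by have := ltn_trans o2 o6; rewrite ltnn.
(* Now [H3] is crossed and [q] is in [H4]. The first vertex [u] of [H4] on the path cannot be [w'],
   whose predecessor would lie in [H3]. So [H4] is entered from [b2] or [c2], although both of these
   come after one of [b4], [c4]. *)
have := cell_block (ring3 R) (ring_out3 R) pt ut all_t pH3; rewrite lt => /(_ qH3) [_ pred3].
have /has_split [s1 [u [r [tE uH4 hs1]]]] : has (mem H4) t.
  apply/hasP; exists q; last by move: qH34; rewrite inE (negbTE qH3).
  have := all_t q; rewrite inE => /predU1P[E|//]; by rewrite -E (negbTE qH1) in pH1.
have sE : p :: t = (p :: s1) ++ u :: r by rewrite tE.
have first x : x \in H4 -> i u <= i x.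
  move=> xH4; have : x \in u :: r.
    have := all_t x; rewrite sE mem_cat => /orP[|//].
    rewrite inE => /predU1P[E|xs]; first by rewrite -E xH4 in pH4.
    by case/negP: hs1; apply/hasP; exists x.
  rewrite inE => /predU1P[->//|xr]; apply: ltnW; rewrite /i sE -cat_rcons.
  by apply: index_cat_lt; rewrite ?cat_rcons -?sE // mem_rcons mem_head.
have := first _ b4H; have := first _ c4H.
have [s [y [s' [sE' eyu]]]] : exists s1 y s2, p :: t = s1 ++ y :: u :: s2 /\ e y u.
  by apply: mem_pred pt _; rewrite tE mem_cat mem_head orbT.
have iy : i y < i u.
  by rewrite /i sE' -cat_rcons; apply: index_cat_lt; rewrite ?cat_rcons -?sE' ?mem_rcons ?mem_head.
have yH4 : y \notin H4 by apply: contraL iy => /first; rewrite -leqNgt.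
have euy : e u y by rewrite e_sym.
have [[ub yb]|[uc yc]|[uw yH3]] := ring_out4 R uH4 yH4 euy; last first.
- by have := pred3 s y s'; rewrite -uw => /(_ sE'); rewrite yH3.
- rewrite uc yc in iy * => _ cb; case: ord2 => -[/andP[bb bc] /andP[cc _]].
    by rewrite leqNgt (ltn_trans bb bc) in cb.
  by rewrite ltnNge ltnW in iy.
- rewrite ub yb in iy * => bc _; case: ord2 => -[/andP[bb _] /andP[cc cb]].
    by rewrite ltnNge ltnW in iy.
  by rewrite leqNgt (ltn_trans cc cb) in bc.
Qed.

Lemma cell_out_a H K a b c b' c' x :
  cell H a b c -> ports_out H K a b c b' c' -> e a x -> x \in H \/ x \in K.
Proof.
move=> C out eax; have [|xH] := boolP (x \in H); [by left|right].
have /= /andP[+ _] := cell_uniq C; rewrite !inE negb_or => /andP[/eqP ab /eqP ac].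
by have [[]|[]|[]] := out _ _ (cell_a C) xH eax.
Qed.

Lemma ring_no_ham_w H1 H2 H3 H4 w w' b1 c1 b2 c2 b3 c3 b4 c4 q :
  ring H1 H2 H3 H4 w w' b1 c1 b2 c2 b3 c3 b4 c4 ->
  q \notin H1 :|: H2 -> ~ hampath setT w q.
Proof.
move=> R; rewrite inE negb_or => /andP[qH1 qH2] [[|x t] [pt lt ut at_]].
  by move: qH1; rewrite -lt (cell_a (ring1 R)).
have all_t y : y \in w :: x :: t by rewrite at_ inE.
have /= /andP[ewx _] := pt; rewrite /= in lt.
have [xH|xH] := cell_out_a (ring1 R) (ring_out1 R) ewx.
  by have := cell_end (ring1 R) (ring_out1 R) pt ut all_t xH; rewrite lt; apply/negP.
by have := cell_end (ring2 R) (ring_out2 R) pt ut all_t xH; rewrite lt; apply/negP.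
Qed.

(** Otherwise both cells at [w] are crossed, and the predecessor of [w] on the path lies in neither
    of them. But all neighbours of [w] lie in these two cells. *)
Lemma ring_ham_end H1 H2 H3 H4 w w' b1 c1 b2 c2 b3 c3 b4 c4 p q :
  ring H1 H2 H3 H4 w w' b1 c1 b2 c2 b3 c3 b4 c4 ->
  hampath setT p q -> (p \in H1 :|: H2) || (q \in H1 :|: H2).
Proof.
move=> R [t [pt lt ut at_]]; apply/negPn; rewrite !inE !negb_or.
apply/negP => /andP[/andP[pH1 pH2] /andP[qH1 qH2]]; rewrite -lt in qH1 qH2.
have all_t y : y \in p :: t by rewrite at_ inE.
have [_ pr1] := cell_block (ring1 R) (ring_out1 R) pt ut all_t pH1 qH1.
have [_ pr2] := cell_block (ring2 R) (ring_out2 R) pt ut all_t pH2 qH2.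
have wt : w \in t.
  have := all_t w; rewrite inE => /predU1P[wp|//].
  by rewrite -wp (cell_a (ring1 R)) in pH1.
have [s1 [y [s2 [E eyw]]]] := mem_pred pt wt.
rewrite e_sym in eyw; have := cell_out_a (ring1 R) (ring_out1 R) eyw.
by case; apply/negP; [exact: pr1 E|exact: pr2 E].
Qed.

Lemma ring_no_ham12 H1 H2 H3 H4 w w' b1 c1 b2 c2 b3 c3 b4 c4 p q :
  ring H1 H2 H3 H4 w w' b1 c1 b2 c2 b3 c3 b4 c4 ->
  p \in H1 :|: H2 -> q \in H3 :|: H4 -> ~ hampath setT p q.
Proof.
move=> R pA qB h; have R' := ring_swap_13 R.
have notAB x : x \in H1 :|: H2 -> x \in H3 :|: H4 -> False.
  by move=> xA xB; have /pred0P/(_ x) := ring_dis R; rewrite /= xA xB.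
have pw : p != w.
  apply/eqP => pw; rewrite pw in h; apply: ring_no_ham_w R _ h.
  by apply/negP => /notAB; apply.
have qw : q != w'.
  apply/eqP => qw; rewrite qw in h; apply: ring_no_ham_w R' _ (hampath_rev h).
  by apply/negP => /(notAB _ pA).
have qq : (q \notin H4) || (q \notin H3).
  by rewrite -negb_and andbC; have /setP/(_ q) := ring34 R; rewrite !inE => ->.
have pp : ~~ ((p \in H1) && (p \in H2)).
  by have /setP/(_ p) := ring12 R; rewrite !inE => ->.
move: pA; rewrite inE => /orP[pH|pH]; rewrite pH ?andbT /= in pp.
  exact: ring_no_ham_aux R pH qB pp qq h.
rewrite orbC in qq; rewrite setUC in qB.
exact: ring_no_ham_aux (ring_swap_12 R) pH qB pp qq h.
Qed.

Lemma ring_no_ham H1 H2 H3 H4 w w' b1 c1 b2 c2 b3 c3 b4 c4 p q :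
  ring H1 H2 H3 H4 w w' b1 c1 b2 c2 b3 c3 b4 c4 -> ~ hampath setT p q.
Proof.
move=> R h; have R' := ring_swap_13 R; have := ring_ham_end R h; have := ring_ham_end R' h.
have notAB x : x \in H1 :|: H2 -> x \in H3 :|: H4 -> False.
  by move=> xA xB; have /pred0P/(_ x) := ring_dis R; rewrite /= xA xB.
case/orP=> hB /orP[hA|hA]; try by case: (notAB _ hA hB).
  exact: ring_no_ham12 R hA hB (hampath_rev h).
exact: ring_no_ham12 R hA hB h.
Qed.

End HamPath.

(** * Enlarging a cell around a quadrilateral *)

(** The corners of a quadrilateral are indexed by [bool * bool]: [rflip] follows the two sides to be
    removed, [gflip] the two that stay. In the drawings the components of the index are the signs of
    the coordinates, so the removed sides are the horizontal ones. *)
Definition rflip (i : bool * bool) := (~~ i.1, i.2).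
Definition gflip (i : bool * bool) := (i.1, ~~ i.2).

Lemma rflipK : involutive rflip. Proof. by case=> [[] []]. Qed.

Lemma gflipK : involutive gflip. Proof. by case=> [[] []]. Qed.

Section Ladder.
Variables (T : finType) (e : rel T).
Hypothesis e_sym : symmetric e.
Variable v : bool * bool -> T.
Local Notation I := (bool * bool)%type.

Definition rail : rel T := fun x y => [exists i, (x == v i) && (y == v (rflip i))].

(* The edges [v i -- v (rflip i)] are two opposite sides of the quadrilateral [v];
   they are removed, and a new quadrilateral on [bool * bool] is joined to [v]. *)
Definition th_adj : rel (T + I) := fun x y =>
  match x, y with
  | inl x, inl y => e x y && ~~ rail x y
  | inl x, inr i | inr i, inl x => x == v i
  | inr i, inr j => (j == rflip i) || (j == gflip i)
  end.

Lemma railP x y : reflect (exists i, x = v i /\ y = v (rflip i)) (rail x y).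
Proof.
apply: (iffP existsP) => [[i /andP[/eqP-> /eqP->]]|[i [-> ->]]]; exists i => //.
by rewrite !eqxx.
Qed.

Lemma rail_sym : symmetric rail.
Proof.
suff h x y : rail x y -> rail y x by move=> x y; apply/idP/idP => /h.
by case/railP=> i [-> ->]; apply/railP; exists (rflip i); rewrite /rflip /= negbK -surjective_pairing.
Qed.

Lemma th_adj_sym : symmetric th_adj.
Proof.
move=> [x|i] [y|j] //=; first by rewrite e_sym rail_sym.
by case: i j => [[] []] [[] []].
Qed.

Lemma th_adj_irrefl : irreflexive e -> irreflexive th_adj.
Proof. by move=> ir [x|[[] []]] //=; rewrite ir. Qed.

Hypothesis v_inj : injective v.
Hypothesis e_r : forall i, e (v i) (v (rflip i)).
Hypothesis e_g : forall i, e (v i) (v (gflip i)).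

(** * Shrinking Hamiltonian paths of the enlarged graph *)

Definition getl (x : T + I) := if x is inl y then Some y else None.
Definition getr (x : T + I) := if x is inr y then Some y else None.
Definition inl_set (A : {set T}) : {set T + I} :=
  [set x | if x is inl y then y \in A else false].
Definition th_set (A : {set T}) : {set T + I} :=
  [set x | if x is inl y then y \in A else true].

Lemma split_inr t :
  (exists s, t = map inl s) \/ exists s i t', t = map inl s ++ inr i :: t' :> seq (T + I).
Proof.
elim: t => [|[x|i] t IH]; first by left; exists [::].
- case: IH => [[s ->]|[s [i [t' ->]]]]; first by left; exists (x :: s).
  by right; exists (x :: s), i, t'.
- by right; exists [::], i, t.
Qed.

Lemma getl_inl s : pmap getl (map inl s) = s.
Proof. by elim: s => //= x s ->. Qed.

Lemma getr_inl s : pmap getr (map inl s) = [::].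
Proof. by elim: s. Qed.

Lemma path_inl x s : path th_adj (inl x) (map inl s) -> path e x s.
Proof. by elim: s x => //= y s IH x /andP[/andP[-> _] /IH]. Qed.

Definition flip (b : bool) (i : I) := if b then rflip i else gflip i.

Lemma e_flip b i : e (v i) (v (flip b i)).
Proof. by case: b. Qed.

Lemma th_inr b i z : th_adj (inr i) z ->
  [\/ z = inl (v i), z = inr (flip b i) | z = inr (flip (~~ b) i)].
Proof.
case: z => [x /eqP->|j /orP[/eqP->|/eqP->]]; first by apply: Or31.
- by case: b; [apply: Or32|apply: Or33].
- by case: b; [apply: Or33|apply: Or32].
Qed.

Lemma reduce_tail x t : path th_adj (inl x) t -> (forall k, k \notin pmap getr t) ->
  path e x (pmap getl t).
Proof.
move=> pt nk; have [[s E]|[s [i [t' E]]]] := split_inr t.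
  by rewrite E getl_inl; apply: path_inl; rewrite -E.
by have := nk i; rewrite E pmap_cat getr_inl /= mem_head.
Qed.

Lemma last_inl x s : last (inl x) (map inl s) = inl (last x s) :> T + I.
Proof. by rewrite last_map. Qed.

(** Excludes detours through a single new vertex: its only old neighbour would be visited both
    before and after it. *)
Lemma dup_last (x y : T) s l : uniq (x :: s ++ y :: l) -> y = last x s -> False.
Proof.
rewrite -cat_cons cat_uniq => /and3P[_ /hasPn /(_ y (mem_head _ _)) + _] E.
by rewrite /= E mem_last.
Qed.

(** The two pairs are opposite sides of the new quadrilateral and exhaust its corners. *)
Lemma no_fifth b i j l : uniq (i :: flip b i :: j :: flip b j :: l) -> forall k, k \notin l.
Proof.
move=> U [k1 k2]; apply/negP => kl; move: U; rewrite /= !inE !negb_or => /and5P[a1 a2 a3 a4 _].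
move: a1 a2 a3 a4 kl; case: b; case: i => [[] []]; case: j => [[] []]; case: k1; case: k2 => //=;
  rewrite ?andbF ?andbT //= => a1 a2 a3 a4 kl;
  move: a1 a2 a3 a4; rewrite kl ?andbF //.
Qed.

(** The detour has come from [v i] through new vertices [i] and [flip b i]. If it leaves there, the
    side from [v i] to [v (flip b i)] replaces it, and the other two new vertices form a second
    detour along the opposite side. If it goes on, it must take all four, since a lone fourth vertex
    could not be visited. *)
Lemma reduce_aux b i q t :
  path th_adj (inr (flip b i)) t -> last (inr (flip b i)) t = inl q ->
  uniq (i :: flip b i :: pmap getr t) -> (forall k, k \in i :: flip b i :: pmap getr t) ->
  uniq (v i :: pmap getl t) -> path e (v i) (pmap getl t).
Proof.
case: t => [//|z2 t /=] /andP[/(th_inr b) z2E pt] lt.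
have ffi : flip b (flip b i) = i by case: b i {z2E pt lt} => [] [[] []].
rewrite ffi in z2E; case: z2E => E; subst z2 => /=; last 1 first.
- set m := flip _ (flip b i); case: t => [//|z3 t /=] in pt lt *.
  case/andP: pt => /(th_inr b) z3E pt U all_i uT; case: z3E => E; subst z3; rewrite /= in U all_i uT *.
  + have [[s E]|[s [j [t' E]]]] := split_inr t; subst t.
      by move: (all_i (flip (~~ b) i)); rewrite getr_inl /m; case: (b); case: (i) => [[] []].
    move: pt; rewrite cat_path last_inl => /andP[_ /= /andP[/eqP vj pt]].
    case: t' => [|z t'] in pt lt U all_i uT *; first by rewrite last_cat in lt.
    rewrite pmap_cat getr_inl /= in U all_i; rewrite pmap_cat getl_inl /= in uT.
    case/andP: pt => /(th_inr b) zE _; case: zE => E; subst z.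
    * by case/andP: uT => _ /dup_last /(_ (esym vj)).
    * by move: U; rewrite /m; case: (b); case: (i) => [[] []]; case: (j) => [[] []]; rewrite /= ?inE ?andbF.
    * by move: U; rewrite /m; case: (b); case: (i) => [[] []]; case: (j) => [[] []]; rewrite /= ?inE ?andbF.
  + case: t => [//|z t /=] in pt lt U all_i uT *.
    case/andP: pt => /(th_inr b) zE pt; case: zE => E; subst z; rewrite /= in U all_i uT *.
    (* Three sides of a quadrilateral lead to a neighbour of the starting corner, so again one side
       of the old quadrilateral replaces the detour. *)
    * have nE : flip b m = flip (~~ b) i by rewrite /m; case: (b); case: (i) => [[] []].
      rewrite {1}nE e_flip /=; apply: reduce_tail pt _; exact: no_fifth U.
    * by move: U; rewrite /m; case: (b); case: (i) => [[] []]; rewrite /= ?inE ?andbF.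
    * by move: U; rewrite /m; case: (b); case: (i) => [[] []]; rewrite /= ?inE ?andbF.
  + by move: U; rewrite /m; case: (b); case: (i) => [[] []]; rewrite /= ?inE ?andbF.
all: swap 1 2.
- by move=> /andP[]; rewrite !inE eqxx orbT.
move=> U all_i uT; rewrite e_flip /=.
have [[s E]|[s [j [t' E]]]] := split_inr t; subst t.
  by move: (all_i (flip (~~ b) i)); rewrite getr_inl; case: (b); case: (i) => [[] []].
move: pt; rewrite cat_path last_inl => /andP[ps /= /andP[/eqP vj pt]].
case: t' => [|z t'] in pt lt U all_i uT *; first by rewrite last_cat in lt.
rewrite pmap_cat getr_inl /= in U all_i; rewrite pmap_cat getl_inl /= in uT *.
case/andP: pt => /(th_inr b) zE pt; case: zE => E; subst z.
- by case/andP: uT => _ /dup_last /(_ (esym vj)).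
- case: t' => [|z t'] in pt lt U all_i uT *; first by rewrite last_cat in lt.
  case/andP: pt => /(th_inr b) zE pt; case: zE => E; subst z; rewrite /= in U *.
  + rewrite cat_path /= vj e_flip (path_inl ps) /=; apply: reduce_tail pt _; exact: no_fifth U.
  + by move: U; case: (b); case: (i) => [[] []]; case: (j) => [[] []]; rewrite /= ?inE ?andbF.
  + by move: U; case: (b); case: (i) => [[] []]; case: (j) => [[] []]; rewrite /= ?inE ?andbF.
- by move: U; case: (b); case: (i) => [[] []]; case: (j) => [[] []]; rewrite /= ?inE ?andbF.
Qed.

(* A Hamiltonian path of the enlarged graph crosses the new quadrilateral in one or two
   detours, which can be replaced by removed or remaining sides of the old one. *)
Lemma th_reduce H p q :
  hampath th_adj (th_set H) (inl p) (inl q) -> hampath e H p q.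
Proof.
case=> t [pt lt ut tH].
have getlP x l : (x \in pmap getl l) = (inl x \in l) by elim: l => //= -[y|i] l; rewrite !inE => ->.
have getrP x l : (x \in pmap getr l) = (inr x \in l) by elim: l => //= -[y|i] l; rewrite !inE => ->.
have uTl : uniq (p :: pmap getl t).
  rewrite -[p :: _]/(pmap getl (inl p :: t)); elim: (inl p :: t) ut => //= -[y|i] l IH /andP[nl /IH //].
  by rewrite /= getlP nl.
have uTr : uniq (pmap getr t).
  move: ut => /andP[_]; elim: (t) => //= -[y|i] l IH /andP[nl /IH //].
  by rewrite /= getrP nl.
have all_r k : k \in pmap getr t by rewrite getrP; have := tH (inr k); rewrite !inE.
exists (pmap getl t); split=> //; last first.
- by move=> x; have := tH (inl x); rewrite !inE getlP.
- case/lastP: t lt {pt ut tH uTl uTr all_r} => [[]//|t z]; rewrite last_rcons => ->.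
  by rewrite -cats1 pmap_cat cats1 last_rcons.
have [[s E]|[s [i [t' E]]]] := split_inr t; subst t.
  by have := all_r (true, true); rewrite getr_inl.
move: pt; rewrite cat_path last_inl => /andP[ps /= /andP[/eqP vj pt]].
rewrite last_cat /= in lt; rewrite pmap_cat getr_inl /= in uTr all_r; rewrite pmap_cat getl_inl /= in uTl *.
rewrite cat_path (path_inl ps) /= vj.
have uTi : uniq (v i :: pmap getl t').
  have {}uTl : uniq ((p :: s) ++ pmap getl t') by [].
  by move: uTl; rewrite lastI vj cat_rcons cat_uniq => /and3P[].
case: t' => [//|z t'] in pt lt uTr all_r uTl uTi {ut tH} *; case/andP: pt => /(th_inr true) zE pt; case: zE => E; subst z.
- by move: uTi; rewrite /= inE eqxx.
- exact: (@reduce_aux true i q t').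
- exact: (@reduce_aux false i q t').
Qed.

(** * Lifting Hamiltonian paths to the enlarged graph *)

Definition norail : rel T := fun x y => ~~ rail x y.

Lemma inl_path x s : path e x s -> path norail x s -> path th_adj (inl x) (map inl s).
Proof.
by elim: s x => //= y s IH x /andP[-> /IH ps] /andP[nr /ps ->]; rewrite andbT.
Qed.

Lemma norail_path (A : {set T}) x s : (forall i, ~~ ((v i \in A) && (v (rflip i) \in A))) ->
  {subset x :: s <= A} -> path norail x s.
Proof.
move=> nrA; elim: s x => //= y s IH x sub; rewrite IH => [|z zs]; last by rewrite sub // inE zs orbT.
rewrite andbT; apply/railP => -[i [xi yi]]; have := nrA i.
by rewrite -xi -yi !sub // !inE ?eqxx ?orbT.
Qed.

Lemma inl_setP (A : {set T}) (s : seq T) : s =i A -> map inl s =i inl_set A.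
Proof.
move=> sA [x|i]; rewrite inE; first by rewrite mem_map ?sA // => ? ? [].
by apply/mapP => -[].
Qed.

Lemma inl_inj : injective (@inl T I). Proof. by move=> ? ? []. Qed.

Lemma sorted_split (R : rel T) s : ~~ sorted R s ->
  exists s1 x y s2, [/\ s = rcons s1 x ++ y :: s2, ~~ R x y & sorted R (rcons s1 x)].
Proof.
case: s => //= x s; elim: s x => //= y s IH x.
have [Rxy|nR] := boolP (R x y) => /= [/IH|_]; last by exists [::], x, y, s.
case=> [[|z s1] [x' [y' [s2 [[? ?] nR ss]]]]]; subst y s.
  by exists [:: x], x', y', s2; rewrite /= Rxy.
by exists [:: x, z & s1], x', y', s2; rewrite /= Rxy.
Qed.

Definition consec (s : seq T) x y := exists s1 s2, s = rcons s1 x ++ y :: s2.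

Lemma inl_piece l x y : sorted e l -> sorted norail l -> uniq l ->
  ohead l = Some x -> last x l = y ->
  hampath th_adj (inl_set [set z in l]) (inl x) (inl y).
Proof.
case: l => //= x' s ps ns us [<-] ls; exists (map inl s); split.
- exact: inl_path.
- by rewrite last_inl ls.
- by rewrite -[inl x' :: _]/(map inl (x' :: s)) (map_inj_uniq inl_inj).
- by apply: (@inl_setP _ (x' :: s)) => z; rewrite [RHS]inE.
Qed.

Lemma th_adj_v i : th_adj (inl (v i)) (inr i) /\ th_adj (inr i) (inl (v i)).
Proof. by rewrite /= eqxx. Qed.

Definition inr_set (J : {set I}) : {set T + I} :=
  [set x | if x is inr k then k \in J else false].

Lemma new4 b i : hampath th_adj (inr_set setT) (inr i) (inr (flip b i)).
Proof.
exists [:: inr (flip (~~ b) i); inr (flip b (flip (~~ b) i)); inr (flip b i)].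
split=> //.
- by case: b; case: i => [[] []].
- by case: b; case: i => [[] []].
- move=> [z|[k1 k2]]; rewrite !inE //.
  by case: b; case: i => [[] []]; case: k1; case: k2.
Qed.

Lemma new2 b i : hampath th_adj (inr_set [set i; flip b i]) (inr i) (inr (flip b i)).
Proof.
exists [:: inr (flip b i)]; split=> //.
- by case: b; case: i => [[] []].
- by case: b; case: i => [[] []].
- by move=> [z|k]; rewrite !inE.
Qed.

Lemma cat_uniqF (l1 l2 : seq T) x : uniq (l1 ++ l2) -> x \in l1 -> x \in l2 -> False.
Proof. by rewrite cat_uniq => /and3P[_ /hasPn h _] xl /h /=; rewrite xl. Qed.

Lemma sorted_consec (R : rel T) s1 a c s2 : sorted R (rcons s1 a ++ c :: s2) -> R a c.
Proof. by rewrite cat_rcons => /cat_sorted2[_ /= /andP[]]. Qed.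

(** A used side of the quadrilateral, removed or not, is replaced by a detour round all four new
    vertices. It suffices when no other step of the path is a rail. *)
Lemma lift_one s1 i b s2 x : let s := rcons s1 (v i) ++ v (flip b i) :: s2 in
  sorted e s -> uniq s -> ohead s = Some x ->
  sorted norail (rcons s1 (v i)) -> sorted norail (v (flip b i) :: s2) ->
  hampath th_adj (th_set [set z in s]) (inl x) (inl (last x s)).
Proof.
move=> s se us sx n1 n2; have [se1 se2] := cat_sorted2 se.
have := us; rewrite cat_uniq => /and3P[us1 _ us2].
have p1 : hampath th_adj (inl_set [set z in rcons s1 (v i)]) (inl x) (inl (v i)).
  by apply: inl_piece => //; [move: sx; rewrite /s; case: (s1) | rewrite last_rcons].
have p2 : hampath th_adj (inl_set [set z in v (flip b i) :: s2]) (inl (v (flip b i))) (inl (last x s)).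
  by apply: inl_piece => //; rewrite /s last_cat.
have [a1 _] := th_adj_v i; have [_ a2] := th_adj_v (flip b i).
apply: hampath_eq (hampath_cat _ a2 (hampath_cat _ a1 p1 (new4 b i)) p2).
- by apply/setP => -[z|k]; rewrite !inE ?orbF // mem_cat.
- apply/pred0P => -[z|k]; rewrite /= !inE ?orbF //; apply/negP => /andP[z1 z2].
  by apply: (cat_uniqF us z1); rewrite inE.
- by apply/pred0P => -[z|k]; rewrite /= !inE ?andbF.
Qed.

(** Both rails are used. Each is replaced by the parallel new side, and these two sides together
    contain the four new vertices because the rails are disjoint. *)
Lemma lift_two s1 k s3 m s4 x :
  let s := rcons s1 (v k) ++ rcons s3 (v m) ++ v (rflip m) :: s4 in
  sorted e s -> uniq s -> ohead s = Some x -> ohead (rcons s3 (v m)) = Some (v (rflip k)) ->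
  sorted norail (rcons s1 (v k)) -> sorted norail (rcons s3 (v m)) ->
  sorted norail (v (rflip m) :: s4) ->
  hampath th_adj (th_set [set z in s]) (inl x) (inl (last x s)).
Proof.
move=> s se us sx sx3 n1 n3 n4; have [se1 /cat_sorted2[se3 se4]] := cat_sorted2 se.
have := us; rewrite cat_uniq => /and3P[us1 _ us34].
have := us34; rewrite cat_uniq => /and3P[us3 _ us4].
have p1 : hampath th_adj (inl_set [set z in rcons s1 (v k)]) (inl x) (inl (v k)).
  by apply: inl_piece => //; [move: sx; rewrite /s; case: (s1) | rewrite last_rcons].
have p3 : hampath th_adj (inl_set [set z in rcons s3 (v m)]) (inl (v (rflip k))) (inl (v m)).
  by apply: inl_piece => //; rewrite last_rcons.
have p4 : hampath th_adj (inl_set [set z in v (rflip m) :: s4]) (inl (v (rflip m))) (inl (last x s)).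
  by apply: inl_piece => //; rewrite /s !last_cat.
have k3 : v (rflip k) \in rcons s3 (v m) by case: (s3) sx3 => /= [|? ?] [->]; rewrite mem_head.
have mk : (m != k) && (m != rflip k).
  apply/andP; split; apply/eqP => mk; apply: (cat_uniqF us (x := v k)).
  - by rewrite mem_rcons mem_head.
  - by rewrite mem_cat mem_rcons mk mem_head.
  - by rewrite mem_rcons mem_head.
  - rewrite mem_cat mk; rewrite rflipK.
    by rewrite mem_head orbT.
have [a1 _] := th_adj_v k; have [_ a2] := th_adj_v (flip true k).
have [a3 _] := th_adj_v m; have [_ a4] := th_adj_v (flip true m).
have h1 := hampath_cat _ a2 (hampath_cat _ a1 p1 (new2 true k)) p3.
apply: hampath_eq (hampath_cat _ a4 (hampath_cat _ a3 (h1 _ _) (new2 true m)) p4).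
- apply/setP => -[z|j]; rewrite !inE ?orbF; first by rewrite !mem_cat !inE !orbA.
  by move: mk; clear; case: k => [[] []]; case: m => [[] []]; case: j => [[] []].
- apply/pred0P => -[z|j]; rewrite /= !inE ?orbF ?andbF //; apply/negP => /andP[z1 z2].
  case/orP: z1 => z1; last by apply: (cat_uniqF us34 z1); rewrite inE.
  by apply: (cat_uniqF us z1); rewrite mem_cat inE z2 orbT.
- apply/pred0P => -[z|j]; rewrite /= !inE ?orbF ?andbF //.
  by move: mk; clear; case: k => [[] []]; case: m => [[] []]; case: j => [[] []].
- apply/pred0P => -[z|j]; rewrite /= !inE ?orbF ?andbF //; apply/negP => /andP[z1 z2].
  by apply: (cat_uniqF us z1); rewrite mem_cat z2.
- by apply/pred0P => -[z|j]; rewrite /= !inE ?andbF.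
Qed.

(** The assumed step along a side gives a place for the new vertices even when the path uses no
    rail. Otherwise the construction is governed by the number of rails on the path, one or two. *)
Lemma th_lift (A : {set T}) x s i b :
  path e x s -> uniq (x :: s) -> x :: s =i A -> consec (x :: s) (v i) (v (flip b i)) ->
  hampath th_adj (th_set A) (inl x) (inl (last x s)).
Proof.
move=> ps us sA [s1 [s2 E]].
have -> : A = [set z in x :: s] by apply/setP => z; rewrite inE sA.
have se : sorted e (x :: s) by [].
have -> : last x s = last x (x :: s) by [].
have hx : ohead (x :: s) = Some x by [].
have [nr|/sorted_split] := boolP (sorted norail (x :: s)).
  rewrite E in nr *; rewrite E in se us hx; have [n1 n2] := cat_sorted2 nr.
  exact: lift_one.
case=> {s1 s2 E} [s1 [a [c [s2 [E /negPn /railP [k [ak ck]] n1]]]]].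
rewrite {ps sA}E {}ak {}ck in se us hx n1 *.
have [n2|/sorted_split] := boolP (sorted norail (v (rflip k) :: s2)); first exact: (@lift_one s1 k true).
case=> [s3 [a3 [c3 [s4 [E /negPn /railP [m [am cm]] n3]]]]].
rewrite {}am {}cm in E n3; have hx3 : ohead (rcons s3 (v m)) = Some (v (rflip k)).
  by case: (s3) E => /= [|? ?] [->].
have k3 : v (rflip k) \in rcons s3 (v m) by case: (s3) hx3 => /= [|? ?] [->]; rewrite mem_head.
(* A third rail would start at a corner different from the four corners on the first two. *)
rewrite E in se us hx *; apply: lift_two => //; apply/negPn/negP => /sorted_split.
case=> [s5 [a6 [c6 [s6 [E6 /negPn /railP [n [an cn]] _]]]]]; rewrite {}an {}cn in E6.
have us34 : uniq (rcons s3 (v m) ++ v (rflip m) :: s4) by move: us; rewrite cat_uniq => /and3P[].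
have n4 : v n \in v (rflip m) :: s4 by rewrite E6 mem_cat mem_rcons mem_head.
have n4' : v (rflip n) \in v (rflip m) :: s4 by rewrite E6 mem_cat mem_head orbT.
have k1 : v k \in rcons s1 (v k) by rewrite mem_rcons mem_head.
have m3 : v m \in rcons s3 (v m) by rewrite mem_rcons mem_head.
have nk : n != k by apply/eqP => nk; rewrite nk in n4; apply: (cat_uniqF us k1); rewrite mem_cat n4 orbT.
have nrk : n != rflip k by apply/eqP => nk'; rewrite nk' in n4; apply: (cat_uniqF us34 k3).
have nm : n != m by apply/eqP => nm; rewrite nm in n4; apply: (cat_uniqF us34 m3).
have nrm : n != rflip m by apply/eqP => nm'; rewrite nm' rflipK in n4'; apply: (cat_uniqF us34 m3).
have mk : m != k by apply/eqP => mk; apply: (cat_uniqF us k1); rewrite -mk mem_cat m3.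
have mrk : m != rflip k.
  apply/eqP => mk'; apply: (cat_uniqF us k1); rewrite mem_cat mk' rflipK mem_head orbT //.
move: nk nrk nm nrm mk mrk; clear; case: k => [[] []]; case: m => [[] []]; by case: n => [[] []].
Qed.

(** The rail from [v i] to [v (rflip i)] is replaced by a detour that picks up the missing old
    corner [v (gflip i)], descends its spoke and passes the three new vertices other than [i]. Its
    first step is a side that was not removed. *)
Lemma lift_corner (A : {set T}) x s i :
  path e x s -> uniq (x :: s) -> x :: s =i A -> v (gflip i) \notin A ->
  consec (x :: s) (v i) (v (rflip i)) ->
  hampath th_adj (th_set (v (gflip i) |: A) :\ inr i) (inl x) (inl (last x s)).
Proof.
move=> ps us sA gA [s1 [s2 E]].
have {ps} : sorted e (x :: s) by [].
have hx : ohead (x :: s) = Some x by [].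
have -> : last x s = last x (x :: s) by [].
rewrite E in sA us hx * => se; have [se1 se2] := cat_sorted2 se.
have := us; rewrite cat_uniq => /and3P[us1 _ us2].
have i1 : v i \in rcons s1 (v i) by rewrite mem_rcons mem_head.
have i2 : v (rflip i) \in v (rflip i) :: s2 by rewrite mem_head.
(* Without [v (gflip i)] the only possible rail is the one being replaced, and each half of the path
   contains just one of its ends. *)
have nrA (l : seq T) : {subset l <= A} -> ~~ ((v i \in l) && (v (rflip i) \in l)) -> sorted norail l.
  case: l => // y l sub nb; apply: (@norail_path [set z in y :: l]) => [j|z]; rewrite !inE //.
  rewrite -!in_cons; apply: contra nb => /andP[j1 j2].
  have gn k : v k \in y :: l -> k != gflip i.
    by move/sub; apply: contraL => /eqP->.
  have := gn _ j1; have := gn _ j2; move: j1 j2.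
  have [->|ji] := eqVneq j i; first by move=> -> ->.
  have [->|jr] := eqVneq j (rflip i).
    by rewrite rflipK => -> ->.
  by move: ji jr; clear; case: j => [[] []]; case: i => [[] []].
have p1 : hampath th_adj (inl_set [set z in rcons s1 (v i)]) (inl x) (inl (v i)).
  apply: inl_piece => //; [|by move: hx; case: (s1)|by rewrite last_rcons].
  apply: nrA => [z zl|]; first by rewrite -sA mem_cat zl.
  by apply/negP => /andP[_ ir]; apply: (cat_uniqF us ir i2).
have p2 : hampath th_adj (inl_set [set z in v (rflip i) :: s2]) (inl (v (rflip i)))
    (inl (last x (rcons s1 (v i) ++ v (rflip i) :: s2))).
  apply: inl_piece => //; last by rewrite last_cat.
  apply: nrA => [z zl|]; first by rewrite -sA mem_cat zl orbT.
  by apply/negP => /andP[ir _]; apply: (cat_uniqF us i1 ir).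
have pm : hampath th_adj [set inl (v (gflip i)); inr (gflip i); inr (rflip (gflip i)); inr (rflip i)]
    (inl (v (gflip i))) (inr (rflip i)).
  exists [:: inr (gflip i); inr (rflip (gflip i)); inr (rflip i)]; split=> //.
  - by rewrite /= eqxx; case: (i) => [[] []].
  - by case: (i) => [[] []].
  - by move=> z; rewrite !inE !orbA.
have a1 : th_adj (inl (v i)) (inl (v (gflip i))).
  rewrite /= e_g; apply/railP => -[j [/v_inj <- /v_inj]]; by case: (i) => [[] []].
have [_ a2] := th_adj_v (rflip i).
apply: hampath_eq (hampath_cat _ a2 (hampath_cat _ a1 p1 pm) p2).
- apply/setP => -[z|k]; rewrite !inE ?orbF.
    rewrite -[inl z == inl _]/(z == v (gflip i)) -sA mem_cat inE.
    by case: (z \in rcons _ _); case: (z == v (gflip i)); rewrite ?orbT.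
  by case: (i) => [[] []]; case: k => [[] []].
- apply/pred0P => -[z|k]; rewrite /= !inE ?orbF ?andbF //; apply/negP => /andP[z1 z2].
  case/orP: z1 => [z1|/eqP [zg]]; first by apply: (cat_uniqF us z1); rewrite inE.
  by case/negP: gA; rewrite -sA -zg mem_cat inE z2 orbT.
- apply/pred0P => -[z|k]; rewrite /= !inE ?orbF ?andbF //; apply/negP => /andP[z1 /eqP [zg]].
  by case/negP: gA; rewrite -sA -zg mem_cat z1.
Qed.

Lemma consec_interior x s y : y \in x :: s -> y != x -> y != last x s ->
  exists p q, [/\ consec (x :: s) p y, consec (x :: s) y q &
    exists s1 s2, x :: s = rcons s1 p ++ y :: q :: s2].
Proof.
rewrite inE => /predU1P[->|]; first by rewrite eqxx.
move=> /splitPr ys; case: ys => s1 s2 _; case: s2 => [|q s2].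
  by rewrite last_cat /= eqxx.
move=> _; exists (last x s1), q.
have E : x :: s1 ++ y :: q :: s2 = rcons (belast x s1) (last x s1) ++ y :: q :: s2.
  by rewrite -lastI.
split; last by exists (belast x s1), s2.
- by exists (belast x s1), (q :: s2).
- by exists (x :: s1), s2; rewrite cat_rcons.
Qed.

Lemma consec_adj x s y z : path e x s -> consec (x :: s) y z -> e y z.
Proof. by move=> ps [s1 [s2 E]]; apply: (@sorted_consec e s1 y z s2); rewrite -E. Qed.

Variables (H : {set T}) (a b c : T) (xo : bool * bool -> T).
Hypothesis H_cell : cell e H a b c.
Hypothesis v_H : forall i, v i \in H.
Hypothesis v_ports : forall i, v i \notin [:: a; b; c].
Hypothesis v_cubic : forall i y, e (v i) y -> y \in [:: v (rflip i); v (gflip i); xo i].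

Lemma consec_rev s x y : consec s x y -> consec (rev s) y x.
Proof.
case=> s1 [s2 ->]; exists (rev s2), (rev s1).
by rewrite rev_cat rev_cons rev_rcons.
Qed.

(** An interior vertex of the path uses two of its at most three edges, and only one edge at the
    corner [v i] is not a side. If [v (gflip i)] is off the path, the side used is the rail at
    [v i]. *)
Lemma quad_used s x i : path e x s -> uniq (x :: s) ->
  v i \in x :: s -> v i != x -> v i != last x s ->
  exists j k, consec (x :: s) (v j) (v (flip k j)) /\
    (v (gflip i) \notin x :: s -> [/\ k = true & (j = i \/ j = rflip i)]).
Proof.
move=> ps us vs vx vl; have [p [q [cp cq [s1 [s2 E]]]]] := consec_interior vs vx vl.
have pq : p != q.
  apply/eqP => pq; apply: (cat_uniqF (l1 := rcons s1 p) (l2 := v i :: q :: s2) (x := p)).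
  - by rewrite -E.
  - by rewrite mem_rcons mem_head.
  - by rewrite pq !inE eqxx orbT.
have [ps' qs'] : p \in x :: s /\ q \in x :: s.
  by rewrite E !mem_cat mem_rcons !inE !eqxx !orbT.
have qC := v_cubic (consec_adj ps cq).
have pC : p \in [:: v (rflip i); v (gflip i); xo i].
  by apply: v_cubic; rewrite e_sym; exact: consec_adj ps cp.
rewrite !inE in pC qC; case/or3P: pC => /eqP pE.
- exists (rflip i), true; split; first by rewrite /= rflipK -pE.
  by move=> _; split=> //; right.
- exists (gflip i), false; split; first by rewrite /= gflipK -pE.
  by rewrite -pE ps'.
case/or3P: qC => /eqP qE.
- by exists i, true; split; [rewrite /= -qE|split=> //; left].
- by exists i, false; split; [rewrite /= -qE|rewrite -qE qs'].
- by move: pq; rewrite pE qE eqxx.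
Qed.

Lemma v_port i x : x \in [:: a; b; c] -> v i != x.
Proof. by move=> xp; apply: contraNneq (v_ports i) => ->. Qed.

Lemma th_hampath (A : {set T}) x y i : x \in [:: a; b; c] -> v i \in A -> v i != y ->
  hampath e A x y -> hampath th_adj (th_set A) (inl x) (inl y).
Proof.
move=> xp viA viy [s [ps ls us sA]]; rewrite -ls in viy *.
rewrite -sA in viA; have [j [k [cs _]]] := quad_used ps us viA (v_port i xp) viy.
exact: th_lift cs.
Qed.

(** Deleting the new vertex [i] is reduced to deleting the old corner [v (gflip i)]. The rail may be
    traversed in either direction; in the second case the path is reversed before it is lifted. *)
Lemma th_hampath_corner x y i : x \in [:: a; b; c] -> y \in [:: a; b; c] ->
  hampath e (H :\ v (gflip i)) x y -> hampath th_adj (th_set H :\ inr i) (inl x) (inl y).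
Proof.
move=> xp yp h; have -> : th_set H = th_set (v (gflip i) |: (H :\ v (gflip i))).
  by rewrite setD1K ?v_H.
have gA : v (gflip i) \notin H :\ v (gflip i) by rewrite !inE eqxx.
have viA : v i \in H :\ v (gflip i).
  by rewrite !inE v_H andbT; apply/eqP => /v_inj; case: (i) => [[] []].
case: (h) => s [ps ls us sA]; have vis : v i \in x :: s by rewrite sA.
have viy : v i != last x s by rewrite ls v_port.
have [j [k [cs]]] := quad_used ps us vis (v_port i xp) viy.
rewrite sA => /(_ gA) [kT ji]; rewrite {}kT /= in cs.
case: ji => ji; rewrite {}ji ?rflipK in cs; first by rewrite -ls; exact: lift_corner cs.
have [s' E] : exists s', y :: s' = rev (x :: s).
  by exists (rev (belast x s)); rewrite [x :: s]lastI rev_rcons ls.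
have ps' : path e y s'.
  suff : sorted e (y :: s') by [].
  by rewrite E rev_sorted; apply: sub_path ps => u w; rewrite e_sym.
have cs' : consec (y :: s') (v i) (v (rflip i)) by rewrite E; exact: consec_rev.
have ls' : last y s' = x.
  have -> : last y s' = last y (y :: s') by [].
  by rewrite E rev_cons last_rcons.
apply: (hampath_rev th_adj_sym); rewrite -ls'; apply: lift_corner cs' => //.
- by rewrite E rev_uniq.
- by move=> z; rewrite E mem_rev sA.
Qed.

Lemma v_other x : exists i, v i != x.
Proof.
have [vx|] := eqVneq (v (true, true)) x; last by exists (true, true).
by exists (true, false); rewrite -vx; apply/eqP => /v_inj.
Qed.

(** Lifting needs a corner that is interior to the given path. Ports are not corners, so it is
    enough to choose one different from the deleted vertex, or from the free end of a spanning path;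
    [v_other] supplies it. *)
Lemma th_cell : cell th_adj (th_set H) (inl a) (inl b) (inl c).
Proof.
have [aH bH cH u nab nac nbc _ [y hb] [z hc]] := H_cell.
split; rewrite ?inE //; try by move=> /th_reduce.
- case=> [x|i]; rewrite inE => xH.
    have lift p q : p \in [:: a; b; c] -> q \in [:: a; b; c] ->
        hampath e (H :\ x) p q -> hampath th_adj (th_set H :\ inl x) (inl p) (inl q).
      move=> pp qp h; have [i vix] := v_other x.
      have -> : th_set H :\ inl x = th_set (H :\ x).
        by apply/setP => -[t|j]; rewrite !inE.
      by apply: (th_hampath (i := i)) h; rewrite ?v_port // !inE vix v_H.
    have [h|h|h] := cell_del H_cell xH; [apply: Or31|apply: Or32|apply: Or33];
      by apply: lift h; rewrite !inE eqxx ?orbT.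
  have [h|h|h] := cell_del H_cell (v_H (gflip i)); [apply: Or31|apply: Or32|apply: Or33];
    by apply: th_hampath_corner h; rewrite !inE eqxx ?orbT.
- have [i viy] := v_other y; exists (inl y); apply: (th_hampath (i := i)) hb => //.
  by rewrite !inE eqxx orbT.
- have [i viz] := v_other z; exists (inl z); apply: (th_hampath (i := i)) hc => //.
  by rewrite !inE eqxx !orbT.
Qed.

End Ladder.

(** * Transport of cells along injections *)

Section Transport.
Variables (C T : finType) (eC : rel C) (e : rel T) (f : C -> T) (A : {set C}).
Hypothesis f_inj : injective f.
Hypothesis eE : {in A &, forall x y, e (f x) (f y) = eC x y}.

Lemma hampath_map (B : {set C}) x y : B \subset A ->
  hampath eC B x y <-> hampath e (f @: B) (f x) (f y).
Proof.
move=> /subsetP BA.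
have pathE z s : {subset z :: s <= B} -> path e (f z) (map f s) = path eC z s.
  elim: s z => //= u s IH z sub; rewrite eE ?IH //; try by apply: BA; apply: sub; rewrite !inE eqxx ?orbT.
  by move=> w ws; apply: sub; rewrite inE ws orbT.
have memE s : {subset s <= f @: B} -> exists s', s = map f s'.
  elim: s => [|z s IH] sub; first by exists [::].
  have /imsetP [u _ ->] := sub z (mem_head _ _).
  have [|s' ->] := IH; first by move=> w ws; apply: sub; rewrite inE ws orbT.
  by exists (u :: s').
have eqE s : s =i B <-> map f s =i f @: B.
  split=> sB z; last by rewrite -(mem_map f_inj) sB mem_imset.
  apply/mapP/imsetP => -[u uB ->]; exists u => //; first by rewrite -sB.
  by rewrite sB.
split=> [[s [ps <- us sB]]|[t [pt lt ut tB]]].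
  exists (map f s); split.
  - by rewrite pathE // => w; rewrite sB.
  - by rewrite last_map.
  - by rewrite -map_cons map_inj_uniq.
  - by rewrite -map_cons; apply/eqE.
have [|s E] := memE t; first by move=> w wt; rewrite -tB inE wt orbT.
rewrite {}E in pt lt ut tB; rewrite -map_cons in ut tB; move/eqE: tB => tB.
exists s; split=> //.
- by rewrite -pathE // => w; rewrite tB.
- by move: lt; rewrite last_map => /f_inj.
- by rewrite -(map_inj_uniq f_inj).
Qed.

Lemma cell_map a b c : cell eC A a b c -> cell e (f @: A) (f a) (f b) (f c).
Proof.
case=> aA bA cA u nab nac nbc del [y hb] [z hc].
have hm x1 y1 := @hampath_map A x1 y1 (subxx _).
split; rewrite ?mem_imset //.
- by rewrite -[[:: _; _; _]]/(map f [:: a; b; c]) map_inj_uniq.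
- by move/hm.
- by move/hm.
- by move/hm.
- move=> _ /imsetP [x xA ->]; have -> : f @: A :\ f x = f @: (A :\ x).
    apply/setP => w; rewrite !inE; apply/andP/imsetP => [[wx /imsetP [u' uA E]]|[u']].
      by exists u'; rewrite // !inE uA andbT; apply: contraNneq wx => <-; rewrite E.
    by rewrite !inE => /andP[ux uA] ->; rewrite mem_imset // uA (inj_eq f_inj).
  have sub : A :\ x \subset A by exact: subD1set.
  by have [/(hampath_map _ _ sub) ?|/(hampath_map _ _ sub) ?|/(hampath_map _ _ sub) ?] := del x xA;
    [apply: Or31|apply: Or32|apply: Or33].
- by exists (f y); apply/hm.
- by exists (f z); apply/hm.
Qed.

End Transport.

(** * Rings with a cubic quadrilateral in the first cell *)

Record quad (T : finType) (e : rel T) (H : {set T}) (a b c : T) (v : bool * bool -> T) : Prop := Quad {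
  quad_inj : injective v;
  quad_r : forall i, e (v i) (v (rflip i));
  quad_g : forall i, e (v i) (v (gflip i));
  quad_H : forall i, v i \in H;
  quad_ports : forall i, v i \notin [:: a; b; c];
  quad_cubic : exists xo : bool * bool -> T,
    forall i y, e (v i) y -> y \in [:: v (rflip i); v (gflip i); xo i] }.

Definition quad_ring (T : finType) (e : rel T) (v : bool * bool -> T) : Prop :=
  exists H1 H2 H3 H4 w w' b1 c1 b2 c2 b3 c3 b4 c4,
    ring e H1 H2 H3 H4 w w' b1 c1 b2 c2 b3 c3 b4 c4 /\ quad e H1 w b1 c1 v.

(** No corner lies in another cell, as the shared vertex [w] is a port; so the other cells and the
    linking edges survive unchanged. The only neighbour of a new corner off the new quadrilateral is
    the old corner below it, which makes the new quadrilateral cubic and the step repeatable. *)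
Lemma th_quad_ring (T : finType) (e : rel T) v : symmetric e ->
  quad_ring e v -> quad_ring (th_adj e v) inr.
Proof.
move=> e_sym [H1 [H2 [H3 [H4 [w [w' [b1 [c1 [b2 [c2 [b3 [c3 [b4 [c4 [R Q]]]]]]]]]]]]]]].
have [v_inj e_r e_g v_H v_ports [xo v_cubic]] := Q.
pose N := @inl T (bool * bool).
have inl_inj : injective N by move=> ? ? [].
have v12 i : v i \notin H2.
  apply/negP => v2; have := ring_mem R (v i); rewrite v_H v2 /= => /andP[/eqP vw _].
  by have := v_ports i; rewrite inE (_ : v i == w).
have v34 i : (v i \notin H3) && (v i \notin H4).
  by have := ring_mem R (v i); rewrite v_H (negbTE (v12 i)) /= -negb_or => /and4P[].
have cellN (H : {set T}) a b c : (forall i, v i \notin H) -> cell e H a b c ->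
    cell (th_adj e v) (N @: H) (N a) (N b) (N c).
  move=> vH; apply: cell_map => // x y xH yH /=; rewrite (_ : rail _ _ _ = false) ?andbT //.
  by apply/railP => -[i [xi _]]; rewrite xi (negbTE (vH i)) in xH.
have outN (H K : {set T}) a b c b' c' : (forall i, v i \notin H) -> ports_out e H K a b c b' c' ->
    ports_out (th_adj e v) (N @: H) (N @: K) (N a) (N b) (N c) (N b') (N c').
  move=> vH out _ y /imsetP [x xH ->]; case: y => [y|i] yH /=; last first.
    by move=> /eqP xv; rewrite xv (negbTE (vH i)) in xH.
  case/andP=> exy _; have yH' : y \notin H by apply: contra yH => yH; exact: imset_f.
  have [[-> ->]|[-> ->]|[-> yK]] := out _ _ xH yH' exy; [exact: Or31|exact: Or32|apply: Or33].
  by split=> //; exact: imset_f.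
have NE (H : {set T}) x : (inl x \in N @: H) = (x \in H) by rewrite (mem_imset _ _ inl_inj).
have NF (H : {set T}) i : (inr i \in N @: H) = false by apply/imsetP => -[].
have facts := ring_mem R.
have v3 i : v i \notin H3 by case/andP: (v34 i).
have v4 i : v i \notin H4 by case/andP: (v34 i).
exists (th_set H1), (N @: H2), (N @: H3), (N @: H4), (N w), (N w'), (N b1), (N c1), (N b2), (N c2),
  (N b3), (N c3), (N b4), (N c4); split; last first.
  split=> //.
  - by move=> ? ? [].
  - by move=> [[] []].
  - by move=> [[] []].
  - by move=> i; rewrite inE.
  - exists (fun i => N (v i)); move=> i [x|j] /=; first by move/eqP->; rewrite !inE eqxx !orbT.
    by move=> /orP[]/eqP->; rewrite !inE eqxx ?orbT.
have edge x y : e x y -> (forall i, v i != x) \/ (forall i, v i != y) -> th_adj e v (N x) (N y).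
  move=> exy nv; rewrite /= exy; apply/railP => -[i [xi yi]].
  by case: nv => [/(_ i)|/(_ (rflip i))]; rewrite ?xi ?yi eqxx.
have vport i x : x \in [:: w; b1; c1] -> v i != x.
  by move=> xp; apply: contraNneq (v_ports i) => ->.
split.
- exact: (th_cell e_sym v_inj e_r e_g (ring1 R) v_H v_ports v_cubic).
- exact: cellN (ring2 R).
- exact: cellN (ring3 R).
- exact: cellN (ring4 R).
- apply/setP => -[x|i]; last by rewrite !inE NF.
  by have := facts x; rewrite !inE NE => /and4P[/eqP <- _ _ _].
- apply/setP => -[x|i]; last by rewrite !inE !NF.
  by have := facts x; rewrite !inE !NE => /and4P[_ /eqP <- _ _].
- apply/pred0P => -[x|i] /=; rewrite !inE ?NF ?NE //.
  by have := facts x; rewrite ?inE => /and4P[_ _ /negbTE <- _].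
- move=> [x|i]; rewrite !inE ?NF ?NE //.
  by have := facts x; rewrite -!orbA => /and4P[_ _ _ ->].
- by apply: edge (ring_b13 R) _; left => i; rewrite vport ?inE ?eqxx ?orbT.
- by apply: edge (ring_c13 R) _; left => i; rewrite vport ?inE ?eqxx ?orbT.
- apply: edge (ring_b24 R) _; left => i; apply: contraNneq (v12 i) => ->; exact: cell_b (ring2 R).
- apply: edge (ring_c24 R) _; left => i; apply: contraNneq (v12 i) => ->; exact: cell_c (ring2 R).
- move=> [x|i] [y|j]; rewrite !inE ?NF //.
    move=> xH yH /andP[exy _].
    have [[-> ->]|[-> ->]|[-> yK]] := ring_out1 R xH yH exy; [exact: Or31|exact: Or32|apply: Or33].
    by rewrite NE.
  by move=> _ yH /eqP yv; rewrite yv v_H in yH.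
- move=> x y xH yH exy; have [?|?|[? yK]] := outN _ _ _ _ _ _ _ v12 (ring_out2 R) x y xH yH exy;
    [exact: Or31|exact: Or32|apply: Or33; split=> //].
  by case/imsetP: yK => z zH ->; rewrite inE.
- exact: outN v3 (ring_out3 R).
- exact: outN v4 (ring_out4 R).
Qed.

(** * Gluing four graphs into a ring *)

Section Wedge.
Variables (C D : finType) (eC : rel C) (eD : rel D) (a : C) (d : D).
Hypotheses (symC : symmetric eC) (symD : symmetric eD).
Hypotheses (irrC : irreflexive eC) (irrD : irreflexive eD).

(** The two graphs share one vertex, kept as [inl a]; the copy [d] is left out of the second
    summand, and [wedge_inr] sends it to [inl a]. *)
Definition wedge : finType := (C + {x : D | x != d})%type.

Definition wedge_adj : rel wedge := fun x y =>
  match x, y with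
  | inl x, inl y => eC x y
  | inr x, inr y => eD (val x) (val y)
  | inl x, inr y | inr y, inl x => (x == a) && eD d (val y)
  end.

Definition wedge_inr (x : D) : wedge := if insub x is Some y then inr y else inl a.

Lemma wedge_adj_sym : symmetric wedge_adj.
Proof. by move=> [x|x] [y|y] //=. Qed.

Lemma wedge_adj_irr : irreflexive wedge_adj.
Proof. by move=> [x|x] /=. Qed.

Lemma wedge_inrd : wedge_inr d = inl a.
Proof. by rewrite /wedge_inr insubN // negbK. Qed.

Lemma wedge_inrE (x : {x : D | x != d}) : wedge_inr (val x) = inr x.
Proof. by rewrite /wedge_inr valK. Qed.

Lemma wedge_inrP x : x = d \/ exists y : {x : D | x != d}, x = val y.
Proof.
have [->|xd] := eqVneq x d; [by left|right].
by exists (Sub x xd); rewrite SubK.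
Qed.

Lemma wedge_inr_inj : injective wedge_inr.
Proof.
move=> x y; have [->|[x' ->]] := wedge_inrP x; have [->|[y' ->]] := wedge_inrP y;
by rewrite ?wedge_inrd ?wedge_inrE // => -[->].
Qed.

Lemma wedge_inr_adj x y : wedge_adj (wedge_inr x) (wedge_inr y) = eD x y.
Proof.
have [->|[x' ->]] := wedge_inrP x; have [->|[y' ->]] := wedge_inrP y;
  rewrite ?wedge_inrd ?wedge_inrE /= ?irrC ?irrD ?eqxx //.
Qed.

Lemma card_wedge : #|wedge| = #|C| + #|D|.-1.
Proof. by rewrite card_sum card_sig -(cardC1 d). Qed.

Lemma wedge_inr_ports (H : {set D}) b c : cell eD H d b c ->
  (exists t, wedge_inr b = inr t) /\ (exists t, wedge_inr c = inr t).
Proof.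
move=> C0; have /= /andP[] := cell_uniq C0; rewrite !inE negb_or ![d == _]eq_sym => /andP[db dc] _.
by split; [exists (Sub b db)|exists (Sub c dc)]; rewrite -wedge_inrE.
Qed.

End Wedge.

Section RingGraph.
Variables (C1 C2 C3 C4 : finType).
Variables (e1 : rel C1) (e2 : rel C2) (e3 : rel C3) (e4 : rel C4).
Variables (a1 b1 c1 : C1) (a2 b2 c2 : C2) (a3 b3 c3 : C3) (a4 b4 c4 : C4).
Hypotheses (sym1 : symmetric e1) (sym2 : symmetric e2) (sym3 : symmetric e3) (sym4 : symmetric e4).
Hypotheses (irr1 : irreflexive e1) (irr2 : irreflexive e2) (irr3 : irreflexive e3) (irr4 : irreflexive e4).

Definition ring_type : finType := (wedge C1 a2 + wedge C3 a4)%type.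
Definition slot1 (x : C1) : ring_type := inl (inl x).
Definition slot2 (x : C2) : ring_type := inl (wedge_inr a1 a2 x).
Definition slot3 (x : C3) : ring_type := inr (inl x).
Definition slot4 (x : C4) : ring_type := inr (wedge_inr a3 a4 x).

Definition ring_link (p : wedge C1 a2) (q : wedge C3 a4) : bool :=
  [|| (p == inl b1) && (q == inl b3), (p == inl c1) && (q == inl c3),
      (p == wedge_inr a1 a2 b2) && (q == wedge_inr a3 a4 b4) |
      (p == wedge_inr a1 a2 c2) && (q == wedge_inr a3 a4 c4)].

Definition ring_adj : rel ring_type := fun x y =>
  match x, y with
  | inl p, inl q => wedge_adj e1 e2 a1 p q
  | inr p, inr q => wedge_adj e3 e4 a3 p q
  | inl p, inr q | inr q, inl p => ring_link p q
  end.

Lemma ring_adj_sym : symmetric ring_adj.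
Proof. by move=> [x|x] [y|y] //=; exact: wedge_adj_sym. Qed.

Lemma ring_adj_irr : irreflexive ring_adj.
Proof. by move=> [x|x] /=; apply: wedge_adj_irr. Qed.

Lemma card_ring_type : #|ring_type| = #|C1| + #|C2|.-1 + (#|C3| + #|C4|.-1).
Proof. by rewrite card_sum !card_wedge. Qed.

Lemma slot1_inj : injective slot1. Proof. by move=> ? ? []. Qed.

Lemma slot3_inj : injective slot3. Proof. by move=> ? ? []. Qed.

Lemma slot2_inj : injective slot2. Proof. by move=> ? ? [] /wedge_inr_inj. Qed.

Lemma slot4_inj : injective slot4. Proof. by move=> ? ? [] /wedge_inr_inj. Qed.

(** A mixed edge of a wedge is an edge at the shared port. Here it is read as an edge of the second
    cell, whose own copy of the port has the same image as that of the first. *)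
Lemma ring_adjP x y : ring_adj x y ->
  [\/ exists x' y', [/\ x = slot1 x', y = slot1 y' & e1 x' y'],
      exists x' y', [/\ x = slot2 x', y = slot2 y' & e2 x' y'],
      exists x' y', [/\ x = slot3 x', y = slot3 y' & e3 x' y'] |
      (exists x' y', [/\ x = slot4 x', y = slot4 y' & e4 x' y']) \/
      exists p q, (x = inl p /\ y = inr q \/ x = inr q /\ y = inl p) /\ ring_link p q].
Proof.
have sE2 (p : {x : C2 | x != a2}) : inl (inr p) = slot2 (val p) by rewrite /slot2 wedge_inrE.
have sE4 (p : {x : C4 | x != a4}) : inr (inr p) = slot4 (val p) by rewrite /slot4 wedge_inrE.
have sa2 : slot1 a1 = slot2 a2 by rewrite /slot2 wedge_inrd.
have sa4 : slot3 a3 = slot4 a4 by rewrite /slot4 wedge_inrd.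
case: x y => [p|q] [p'|q'] /=; last 1 first.
- case: q q' => [x|x] [y|y] h.
  + by apply: Or43; exists x, y.
  + by case/andP: h => /eqP-> h; apply: Or44; left; exists a4, (val y); rewrite -sa4 sE4.
  + by case/andP: h => /eqP-> h; apply: Or44; left; exists (val x), a4; rewrite sym4 -sa4 sE4.
  + by apply: Or44; left; exists (val x), (val y); rewrite !sE4.
- case: p p' => [x|x] [y|y] h.
  + by apply: Or41; exists x, y.
  + by case/andP: h => /eqP-> h; apply: Or42; exists a2, (val y); rewrite -sa2 sE2.
  + by case/andP: h => /eqP-> h; apply: Or42; exists (val x), a2; rewrite sym2 -sa2 sE2.
  + by apply: Or42; exists (val x), (val y); rewrite !sE2.
- by move=> h; apply: Or44; right; exists p, q'; split=> //; left.
- by move=> h; apply: Or44; right; exists p', q; split=> //; right.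
Qed.

Hypotheses (cell1 : cell e1 setT a1 b1 c1) (cell2 : cell e2 setT a2 b2 c2).
Hypotheses (cell3 : cell e3 setT a3 b3 c3) (cell4 : cell e4 setT a4 b4 c4).
Variable v : bool * bool -> C1.
Hypothesis quad1 : quad e1 setT a1 b1 c1 v.

Lemma ring_graph_ring : ring ring_adj (slot1 @: setT) (slot2 @: setT) (slot3 @: setT) (slot4 @: setT)
  (slot1 a1) (slot3 a3) (slot1 b1) (slot1 c1) (slot2 b2) (slot2 c2) (slot3 b3) (slot3 c3) (slot4 b4) (slot4 c4).
Proof.
have sa2 : slot1 a1 = slot2 a2 by rewrite /slot2 wedge_inrd.
have sa4 : slot3 a3 = slot4 a4 by rewrite /slot4 wedge_inrd.
have m1 x : (x \in slot1 @: setT) = if x is inl (inl _) then true else false.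
  by apply/imsetP/idP => [[? _ ->]|] //; case: x => [[x|x]|x] // _; exists x.
have m3 x : (x \in slot3 @: setT) = if x is inr (inl _) then true else false.
  by apply/imsetP/idP => [[? _ ->]|] //; case: x => [x|[x|x]] // _; exists x.
have m2 x : (x \in slot2 @: setT) = match x with inl (inl x) => x == a1 | inl (inr _) => true | _ => false end.
  apply/imsetP/idP => [[y _ ->]|].
    by rewrite /slot2; have [->|[z ->]] := wedge_inrP a2 y; rewrite ?wedge_inrd ?wedge_inrE.
  case: x => [[x|x]|x] //; first by move/eqP->; exists a2; rewrite // -sa2.
  by move=> _; exists (val x); rewrite // /slot2 wedge_inrE.
have m4 x : (x \in slot4 @: setT) = match x with inr (inl x) => x == a3 | inr (inr _) => true | _ => false end.
  apply/imsetP/idP => [[y _ ->]|].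
    by rewrite /slot4; have [->|[z ->]] := wedge_inrP a4 y; rewrite ?wedge_inrd ?wedge_inrE.
  case: x => [x|[x|x]] //; first by move/eqP->; exists a4; rewrite // -sa4.
  by move=> _; exists (val x); rewrite // /slot4 wedge_inrE.
have [[tb2 b2E] [tc2 c2E]] := wedge_inr_ports a1 cell2.
have [[tb4 b4E] [tc4 c4E]] := wedge_inr_ports a3 cell4.
have ab1 : (b1 == a1) = false /\ (c1 == a1) = false.
  have /= /andP[] := cell_uniq cell1; rewrite !inE negb_or ![a1 == _]eq_sym.
  by move=> /andP[/negbTE-> /negbTE->].
have ab3 : (b3 == a3) = false /\ (c3 == a3) = false.
  have /= /andP[] := cell_uniq cell3; rewrite !inE negb_or ![a3 == _]eq_sym.
  by move=> /andP[/negbTE-> /negbTE->].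
split.
- by apply: cell_map cell1 => //; exact: slot1_inj.
- rewrite sa2; apply: cell_map cell2; first exact: slot2_inj.
  by move=> x y _ _; rewrite /= wedge_inr_adj.
- by apply: cell_map cell3 => //; exact: slot3_inj.
- rewrite sa4; apply: cell_map cell4; first exact: slot4_inj.
  by move=> x y _ _; rewrite /= wedge_inr_adj.
- apply/setP => x; rewrite !inE m1 m2; case: x => [[x|x]|x] //=.
- apply/setP => x; rewrite !inE m3 m4; case: x => [x|[x|x]] //=.
- by apply/pred0P => x; rewrite /= !inE m1 m2 m3 m4; case: x => [[x|x]|[x|x]].
- by move=> x; rewrite !inE m1 m2 m3 m4; case: x => [[x|x]|[x|x]].
- by rewrite /= /ring_link !eqxx.
- by rewrite /= /ring_link !eqxx !orbT.
- by rewrite /= /ring_link !eqxx !orbT.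
- by rewrite /= /ring_link !eqxx !orbT.
- move=> x y xH yH /ring_adjP [[x' [y' [_ E _]]]|[x' [y' [xE yE _]]]|[x' [y' [xE _ _]]]|[[x' [y' [xE _ _]]]|]].
  + by rewrite E imset_f in yH.
  + apply: Or33; split; last by rewrite yE imset_f.
    have : x \in slot2 @: setT by rewrite xE imset_f.
    by move: xH; rewrite m1 m2; case: (x) => [[z|z]|z] // _ /eqP->.
  + by rewrite xE m1 in xH.
  + by rewrite xE m1 in xH.
  + case=> p [q [[[xE yE]|[xE yE]]]]; last by rewrite xE m1 in xH.
    case/or4P=> /andP[/eqP pE /eqP qE]; rewrite xE yE pE qE; [exact: Or31|exact: Or32| |].
      by rewrite xE pE b2E m1 in xH.
    by rewrite xE pE c2E m1 in xH.
- move=> x y xH yH /ring_adjP [[x' [y' [xE yE _]]]|[x' [y' [_ E _]]]|[x' [y' [xE _ _]]]|[[x' [y' [xE _ _]]]|]].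
  + apply: Or33; split; last by rewrite yE imset_f.
    have : x \in slot1 @: setT by rewrite xE imset_f.
    by move: xH; rewrite m1 m2; case: (x) => [[z|z]|z] // /eqP->.
  + by rewrite E imset_f in yH.
  + by rewrite xE m2 in xH.
  + by rewrite xE m2 in xH.
  + case=> p [q [[[xE yE]|[xE yE]]]]; last by rewrite xE m2 in xH.
    case/or4P=> /andP[/eqP pE /eqP qE]; rewrite xE yE pE qE; [| |exact: Or31|exact: Or32].
      by rewrite xE pE m2 (proj1 ab1) in xH.
    by rewrite xE pE m2 (proj2 ab1) in xH.
- move=> x y xH yH /ring_adjP [[x' [y' [xE _ _]]]|[x' [y' [xE _ _]]]|[x' [y' [_ E _]]]|[[x' [y' [xE yE _]]]|]].
  + by rewrite xE m3 in xH.
  + by rewrite xE m3 in xH.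
  + by rewrite E imset_f in yH.
  + apply: Or33; split; last by rewrite yE imset_f.
    have : x \in slot4 @: setT by rewrite xE imset_f.
    by move: xH; rewrite m3 m4; case: (x) => [z|[z|z]] // _ /eqP->.
  + case=> p [q [[[xE yE]|[xE yE]]]]; first by rewrite xE m3 in xH.
    case/or4P=> /andP[/eqP pE /eqP qE]; rewrite xE yE pE qE; [exact: Or31|exact: Or32| |].
      by rewrite xE qE b4E m3 in xH.
    by rewrite xE qE c4E m3 in xH.
- move=> x y xH yH /ring_adjP [[x' [y' [xE _ _]]]|[x' [y' [xE _ _]]]|[x' [y' [xE yE _]]]|[[x' [y' [_ E _]]]|]].
  + by rewrite xE m4 in xH.
  + by rewrite xE m4 in xH.
  + apply: Or33; split; last by rewrite yE imset_f.
    have : x \in slot3 @: setT by rewrite xE imset_f.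
    by move: xH; rewrite m3 m4; case: (x) => [z|[z|z]] // /eqP->.
  + by rewrite E imset_f in yH.
  + case=> p [q [[[xE yE]|[xE yE]]]]; first by rewrite xE m4 in xH.
    case/or4P=> /andP[/eqP pE /eqP qE]; rewrite xE yE pE qE; [| |exact: Or31|exact: Or32].
      by rewrite xE qE m4 (proj1 ab3) in xH.
    by rewrite xE qE m4 (proj2 ab3) in xH.
Qed.

Lemma ring_graph_quad : quad_ring ring_adj (slot1 \o v).
Proof.
do 14!eexists; split; first exact: ring_graph_ring.
have [v_inj e_r e_g v_H v_ports [xo v_cubic]] := quad1; split.
- by move=> i j /slot1_inj /v_inj.
- exact: e_r.
- exact: e_g.
- by move=> i; exact: imset_f.
- by move=> i; rewrite -[[:: _; _; _]]/(map slot1 [:: a1; b1; c1]) (mem_map slot1_inj).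
exists (slot1 \o xo) => i y.
have nv x : x \in [:: a1; b1; c1] -> (v i == x) = false.
  by move=> xp; apply: contraNF (v_ports i) => /eqP->.
have [va vb vc] : [/\ (v i == a1) = false, (v i == b1) = false & (v i == c1) = false].
  by rewrite !nv // !inE eqxx ?orbT.
have [[tb2 b2E] [tc2 c2E]] := wedge_inr_ports a1 cell2.
case: y => [[y|y]|q] /=; last 1 first.
- rewrite /ring_link b2E c2E.
  have vE x : (inl (v i) == inl x :> wedge C1 a2) = (v i == x) by [].
  have vF x : (inl (v i) == inr x :> wedge C1 a2) = false by [].
  by rewrite !vE !vF vb vc.
- move/v_cubic; rewrite -(mem_map slot1_inj) //.
- by rewrite va.
Qed.

End RingGraph.

(** * Deciding the cell property *)

Section AdjacencyLists.
Variable g : seq (seq nat).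
Local Notation n := (size g).
Definition nbrs (k : nat) : seq nat := nth [::] g k.
Definition is_nbr (k l : nat) : bool := has (eqn l) (nbrs k).

Lemma is_nbrP k l : is_nbr k l = (l \in nbrs k).
Proof.
apply/hasP/idP => [[l' l'r /eqP->//]|lr]; by exists l; rewrite //; apply/eqP.
Qed.

Definition graph_ok : bool :=
  (0 < n) && all (fun k => all (fun l => [&& l < n, ~~ eqn l k & is_nbr l k]) (nbrs k)) (iota 0 n).

(** The successor form makes the type inhabited for every list, as [inord] demands; for a list
    accepted by [graph_ok] its size is [n]. *)
Definition cell_vertex : finType := 'I_(n.-1.+1).
Definition cell_adj : rel cell_vertex := fun i j => is_nbr i j.

Hypothesis g_ok : graph_ok.

Lemma size_gE : n.-1.+1 = n.
Proof. by case/andP: g_ok; case: n. Qed.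

Lemma ltn_vertex (i : cell_vertex) : i < n.
Proof. by apply: leq_trans (ltn_ord i) _; rewrite size_gE. Qed.

Lemma nbrsP k l : l \in nbrs k -> [/\ k < n, l < n, l != k & k \in nbrs l].
Proof.
have [kn|kn] := ltnP k n; last by rewrite /nbrs nth_default.
case/andP: g_ok => _ /allP /(_ k); rewrite mem_iota /= add0n => /(_ kn) /allP h /h /and3P[ln lk kl].
by split=> //; rewrite -is_nbrP.
Qed.

Lemma cell_adj_sym : symmetric cell_adj.
Proof.
suff h i j : cell_adj i j -> cell_adj j i by move=> i j; apply/idP/idP => /h.
by rewrite /cell_adj !is_nbrP => /nbrsP[].
Qed.

Lemma cell_adj_irr : irreflexive cell_adj.
Proof. by move=> i; apply/negP; rewrite /cell_adj is_nbrP => /nbrsP[]; rewrite eqxx. Qed.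

(* [mask] marks the vertices still to be visited; a candidate with fewer than two
   remaining neighbours must be visited next. *)
Fixpoint dfs (tgt : pred nat) (fuel : nat) (mask : seq bool) (cur : nat) : bool :=
  if fuel is k.+1 then
    let cand := filter (nth false mask) (nbrs cur) in
    let tight := filter (fun w => count (nth false mask) (nbrs w) + tgt w < 2) cand in
    has (fun w => all (eqn w) tight && dfs tgt k (set_nth false mask w false) w) cand
  else tgt cur.

(** The search can follow any given path, because pruning never rejects its next vertex: a candidate
    that is visited later has its predecessor and its successor as two distinct unvisited
    neighbours, and at the end of the path [tgt] stands in for the successor. *)
Lemma dfs_complete (tgt : pred nat) mask x s :
  path (fun k l => l \in nbrs k) x s -> uniq s -> (forall w, nth false mask w = (w \in s)) ->
  tgt (last x s) -> dfs tgt (size s) mask x.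
Proof.
elim: s x mask => //= w s IH x mask /andP[xw ps] /andP[ws us] maskE tl.
apply/hasP; exists w; first by rewrite mem_filter maskE inE eqxx.
apply/andP; split; last first.
  apply: IH => // z; rewrite nth_set_nth /= maskE inE; case: (eqVneq z w) => [->|] //.
  by rewrite (negbTE ws).
apply/allP => z; rewrite !mem_filter => /and3P[few]; rewrite maskE inE => /predU1P[->|zs] _.
  exact/eqP.
suff : 1 < count (nth false mask) (nbrs z) + tgt z by rewrite ltnNge -ltnS few.
case/splitPr: zs few ps us ws maskE tl => s1 s2 _.
rewrite cat_path last_cat /= => /and3P[_ yz ps] us ws maskE tl.
have yr : last w s1 \in nbrs z by case: (nbrsP yz).
have yl : last w s1 \in w :: s1 by exact: mem_last.
have ym : nth false mask (last w s1).
  by rewrite maskE -cat_cons mem_cat yl.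
case: s2 => [|t s2] /= in ps us ws maskE tl *.
  rewrite tl addn1 ltnS -has_count; apply/hasP; by exists (last w s1).
apply: leq_trans (leq_addr _ _); case/andP: ps => zt _.
have tm : nth false mask t by rewrite maskE inE mem_cat !inE eqxx !orbT.
have ne : last w s1 != t.
  apply/eqP => E; move: yl; rewrite E inE => /predU1P[tw|ts].
    by move: ws; rewrite -tw mem_cat !inE eqxx !orbT.
  by move: us; rewrite cat_uniq => /and3P[_ /hasPn /(_ t) + _]; rewrite !inE eqxx orbT /= ts => /(_ isT).
rewrite -size_filter -[2]/(size [:: last w s1; t]); apply: uniq_leq_size; first by rewrite /= inE ne.
by move=> u; rewrite !inE => /orP[]/eqP->; rewrite mem_filter ?ym ?tm.
Qed.

Definition no_ham_check (x : nat) (tgt : pred nat) : bool :=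
  ~~ dfs tgt n.-1 (set_nth false (nseq n true) x false) x.

Lemma no_ham_checkP (x y : cell_vertex) (tgt : pred nat) : no_ham_check x tgt -> tgt y ->
  ~ hampath cell_adj setT x y.
Proof.
move=> /negP nd ty [s [ps ls us sT]]; apply: nd.
have szs : size s = n.-1.
  have := card_uniqP us; rewrite /= => /esym/eqP; rewrite (eq_card sT) cardsT card_ord.
  by move=> /eqP[].
suff : dfs tgt (size (map val s)) (set_nth false (nseq n true) x false) x.
  by rewrite size_map szs.
apply: dfs_complete.
- rewrite path_map; apply: sub_path ps => i j; by rewrite /cell_adj is_nbrP.
- by rewrite map_inj_uniq; [case/andP: us|exact: val_inj].
- move=> w; rewrite nth_set_nth /=; have [->|wx] := eqVneq w x.
    by apply/esym/negbTE; rewrite mem_map; [case/andP: us|exact: val_inj].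
  rewrite nth_nseq; have [wn|wn] := ltnP w n.
    have wn' : w < n.-1.+1 by rewrite size_gE.
    have := sT (Ordinal wn'); rewrite !inE -[_ == x]val_eqE /= (negbTE wx) /= => wxs.
    by apply/esym/mapP; exists (Ordinal wn').
  by apply/esym/negbTE/mapP => -[i _ wi]; rewrite wi leqNgt ltn_vertex in wn.
- by rewrite last_map ls.
Qed.

Definition path_check (A : pred nat) (sz : nat) (l : seq nat) : bool :=
  if l is x :: s then
    [&& path is_nbr x s, uniq l, all (fun k => (k < n) && A k) l & eqn (size l) sz]
  else false.

(** Spanning is obtained by counting: a duplicate-free list inside [A] with [#|A|] entries contains
    all of [A]. *)
Lemma path_checkP (A : {set cell_vertex}) (P : pred nat) (x y : nat) s :
  path_check P #|A| (x :: s) -> last x s = y -> (forall i : cell_vertex, P i -> i \in A) ->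
  hampath cell_adj A (inord x) (inord y).
Proof.
case/and4P=> ps us /allP sA /eqP sz ly PA.
have lt k : k \in x :: s -> k < n.-1.+1 by rewrite size_gE => /sA /andP[].
have inK k : k \in x :: s -> (inord k : cell_vertex) = k :> nat by move=> /lt kn; rewrite inordK.
have uT : uniq (map (@inord n.-1) (x :: s)).
  rewrite map_inj_in_uniq // => k l /inK ki /inK li E.
  by rewrite -ki -li E.
exists (map (@inord n.-1) s); split.
- elim: s x ps inK {us sA sz ly lt uT} => //= t s IH x /andP[xt ps] inK.
  rewrite /cell_adj !inK ?inE ?eqxx ?orbT // xt IH // => k ks.
  by rewrite inK // inE ks orbT.
- by rewrite last_map ly.
- exact: uT.
- have sub : {subset map (@inord n.-1) (x :: s) <= A}.
    move=> i /mapP[k kl ->]; apply: PA; rewrite (inK _ kl).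
    by case/andP: (sA _ kl).
  have sub' : {subset map (@inord n.-1) (x :: s) <= enum A} by move=> i /sub; rewrite mem_enum.
  have le : size (enum A) <= size (map (@inord n.-1) (x :: s)) by rewrite -cardE size_map sz leqnn.
  have [_ E] := uniq_min_size uT sub' le.
  by move=> i; rewrite -map_cons E mem_enum.
Qed.

Variables (a b c : nat).

Definition del_check (v : nat) (l : seq nat) : bool :=
  path_check (fun k => ~~ eqn k v) n.-1 l &&
  has (fun pq => eqn pq.1 (head 0 l) && eqn pq.2 (last 0 l)) [:: (a, b); (a, c); (b, c)].

(** Entry [k] of [wit] is a spanning path after the deletion of vertex [k]. One search from [a] with
    two admissible ends excludes both pairs that contain [a]. *)
Definition cell_check (wit : seq (seq nat)) (sb sc : seq nat) : bool :=
  [&& (a < n) && (b < n) && (c < n), uniq [:: a; b; c],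
    no_ham_check a (fun k => eqn k b || eqn k c), no_ham_check b (eqn^~ c),
    eqn (size wit) n, all2 del_check (iota 0 n) wit,
    path_check xpredT n sb && eqn (head 0 sb) b &
    path_check xpredT n sc && eqn (head 0 sc) c].

Lemma cell_checkP wit sb sc : cell_check wit sb sc ->
  cell cell_adj setT (inord a) (inord b) (inord c).
Proof.
case/and5P=> /andP[/andP[an bn] cn] uabc na nb /and4P[szw dels /andP[pb /eqP hb] /andP[pc /eqP hc]].
have iA v : v < n -> (inord v : cell_vertex) = v :> nat by move=> vn; rewrite inordK // size_gE.
have pre x y s : last x s = y -> path_check xpredT n (x :: s) -> hampath cell_adj setT (inord x) (inord y).
  move=> ly p; apply: (path_checkP (P := xpredT) (s := s)) ly _ => [|i _]; last by rewrite inE.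
  by rewrite cardsT card_ord size_gE.
have nh x y (tgt : pred nat) : x < n -> y < n -> no_ham_check x tgt -> tgt y ->
    ~ hampath cell_adj setT (inord x) (inord y).
  move=> xn yn ch ty; apply: (@no_ham_checkP _ _ tgt); rewrite iA //.
split; rewrite ?inE //.
- by move: uabc; rewrite /= !inE -!val_eqE /= !iA.
- by apply: nh na _ => //; apply/orP; left; apply/eqP.
- by apply: nh na _ => //; apply/orP; right; apply/eqP.
- by apply: nh nb _ => //; apply/eqP.
- move=> v _; have vn := ltn_vertex v.
  have dv : del_check v (nth [::] wit v).
    move: dels; rewrite all2E size_iota => /andP[_ /allP /(_ (val v, nth [::] wit v))]; apply.
    rewrite -[(_, _)]/((nat_of_ord v, nth [::] wit v)).
    have -> : (val v, nth [::] wit v) = nth (0, [::]) (zip (iota 0 n) wit) v.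
      by rewrite nth_zip ?size_iota ?(eqP szw) // nth_iota.
    by apply: mem_nth; rewrite size_zip size_iota (eqP szw) minnn.
  case/andP: dv; case: (nth [::] wit v) => [//|x s] p /hasP[[p1 p2] pp /= /andP[/eqP p1x /eqP p2l]].
  have h : hampath cell_adj (setT :\ v) (inord p1) (inord p2).
    rewrite p1x p2l; apply: (path_checkP (P := fun k => ~~ eqn k v) (s := s)).
    - have -> : #|[set: cell_vertex] :\ v| = n.-1; last by [].
      by have /= := cardsD1 v [set: cell_vertex]; rewrite inE cardsT card_ord => -[].
    - by [].
    - by move=> i iv; rewrite !inE andbT.
  move: pp h; rewrite !inE => /or3P[]/eqP[-> ->] h; [exact: Or31|exact: Or32|exact: Or33].
- case: sb pb hb => [//|x s] pb /= <-; exists (inord (last x s)); exact: pre.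
- case: sc pc hc => [//|x s] pc /= <-; exists (inord (last x s)); exact: pre.
Qed.

End AdjacencyLists.

(* The 36-vertex graph with one quadrilateral, enlarged once, minus a cubic vertex; the
   new quadrilateral consists of the vertices 35 to 38. *)
Definition cell39 : seq (seq nat) := [:: [:: 3; 35]; [:: 8; 5; 2; 36]; [:: 13; 10; 1; 37]; [:: 18;
  15; 0; 38]; [:: 21; 5]; [:: 6; 1; 4]; [:: 22; 7; 5]; [:: 24; 8; 6]; [:: 9; 1; 7]; [:: 25; 10; 8];
  [:: 11; 2; 9]; [:: 26; 12; 10]; [:: 28; 13; 11]; [:: 14; 2; 12]; [:: 29; 15; 13]; [:: 16; 3; 14];
  [:: 30; 17; 15]; [:: 32; 18; 16]; [:: 19; 3; 17]; [:: 20; 18]; [:: 32; 21; 19]; [:: 33; 22; 4;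
  20]; [:: 23; 6; 21]; [:: 34; 24; 22]; [:: 25; 7; 23]; [:: 26; 9; 24]; [:: 34; 27; 11; 25]; [:: 31;
  28; 26]; [:: 29; 12; 27]; [:: 30; 14; 28]; [:: 31; 16; 29]; [:: 27; 33; 32; 30]; [:: 20; 17; 31];
  [:: 34; 21; 31]; [:: 26; 23; 33]; [:: 36; 38; 0]; [:: 37; 35; 1]; [:: 38; 36; 2]; [:: 35; 37; 3]].

Definition cell39_del : seq (seq nat) := [:: [:: 19; 18; 3; 15; 14; 13; 12; 11; 10; 2; 37; 38; 35; 36;
  1; 5; 6; 22; 23; 24; 7; 8; 9; 25; 26; 34; 33; 31; 27; 28; 29; 30; 16; 17; 32; 20; 21; 4]; [:: 19;
  18; 17; 32; 20; 21; 4; 5; 6; 22; 23; 24; 7; 8; 9; 25; 26; 34; 33; 31; 27; 28; 12; 11; 10; 2; 13;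
  14; 29; 30; 16; 15; 3; 38; 37; 36; 35; 0]; [:: 19; 18; 17; 16; 15; 3; 0; 35; 38; 37; 36; 1; 8; 7;
  24; 25; 9; 10; 11; 26; 27; 28; 12; 13; 14; 29; 30; 31; 32; 20; 21; 33; 34; 23; 22; 6; 5; 4]; [::
  19; 18; 17; 32; 20; 21; 4; 5; 6; 22; 23; 24; 7; 8; 9; 25; 26; 34; 33; 31; 27; 28; 29; 30; 16; 15;
  14; 13; 12; 11; 10; 2; 1; 36; 37; 38; 35; 0]; [:: 19; 18; 17; 16; 15; 14; 13; 12; 11; 10; 9; 8; 7;
  24; 25; 26; 27; 28; 29; 30; 31; 32; 20; 21; 33; 34; 23; 22; 6; 5; 1; 2; 37; 36; 35; 38; 3; 0]; [::
  4; 21; 20; 19; 18; 17; 32; 31; 33; 34; 23; 22; 6; 7; 24; 25; 9; 8; 1; 36; 35; 38; 37; 2; 10; 11;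
  26; 27; 28; 12; 13; 14; 29; 30; 16; 15; 3; 0]; [:: 19; 18; 17; 32; 20; 21; 22; 23; 24; 7; 8; 9;
  25; 26; 34; 33; 31; 27; 28; 12; 11; 10; 2; 13; 14; 29; 30; 16; 15; 3; 0; 35; 38; 37; 36; 1; 5; 4];
  [:: 19; 18; 17; 16; 30; 29; 28; 27; 26; 34; 33; 31; 32; 20; 21; 4; 5; 6; 22; 23; 24; 25; 9; 8; 1;
  36; 35; 38; 37; 2; 10; 11; 12; 13; 14; 15; 3; 0]; [:: 19; 18; 17; 16; 15; 14; 13; 12; 11; 26; 27;
  28; 29; 30; 31; 32; 20; 21; 33; 34; 23; 22; 6; 7; 24; 25; 9; 10; 2; 37; 38; 3; 0; 35; 36; 1; 5;
  4]; [:: 19; 18; 17; 16; 15; 3; 0; 35; 38; 37; 36; 1; 8; 7; 24; 25; 26; 27; 28; 12; 11; 10; 2; 13;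
  14; 29; 30; 31; 32; 20; 21; 33; 34; 23; 22; 6; 5; 4]; [:: 19; 18; 17; 32; 20; 21; 22; 6; 7; 8; 9;
  25; 24; 23; 34; 33; 31; 27; 26; 11; 12; 28; 29; 30; 16; 15; 14; 13; 2; 37; 38; 3; 0; 35; 36; 1; 5;
  4]; [:: 19; 18; 17; 16; 15; 3; 0; 35; 38; 37; 36; 1; 2; 10; 9; 8; 7; 24; 25; 26; 27; 28; 12; 13;
  14; 29; 30; 31; 32; 20; 21; 33; 34; 23; 22; 6; 5; 4]; [:: 19; 18; 17; 16; 15; 14; 13; 2; 37; 38;
  3; 0; 35; 36; 1; 8; 7; 24; 25; 9; 10; 11; 26; 27; 28; 29; 30; 31; 32; 20; 21; 33; 34; 23; 22; 6;
  5; 4]; [:: 19; 18; 17; 16; 30; 29; 14; 15; 3; 0; 35; 38; 37; 36; 1; 2; 10; 9; 8; 7; 24; 25; 26;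
  11; 12; 28; 27; 31; 32; 20; 21; 33; 34; 23; 22; 6; 5; 4]; [:: 19; 18; 17; 16; 15; 3; 0; 35; 38;
  37; 36; 1; 2; 13; 12; 11; 10; 9; 8; 7; 24; 25; 26; 27; 28; 29; 30; 31; 32; 20; 21; 33; 34; 23; 22;
  6; 5; 4]; [:: 19; 18; 3; 0; 35; 38; 37; 36; 1; 2; 10; 9; 8; 7; 24; 25; 26; 11; 12; 13; 14; 29; 28;
  27; 31; 30; 16; 17; 32; 20; 21; 33; 34; 23; 22; 6; 5; 4]; [:: 19; 18; 17; 32; 20; 21; 4; 5; 6; 22;
  23; 34; 33; 31; 30; 29; 14; 15; 3; 38; 37; 2; 13; 12; 28; 27; 26; 11; 10; 9; 25; 24; 7; 8; 1; 36;
  35; 0]; [:: 19; 18; 3; 0; 35; 38; 37; 36; 1; 2; 10; 9; 8; 7; 24; 25; 26; 11; 12; 13; 14; 15; 16;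
  30; 29; 28; 27; 31; 32; 20; 21; 33; 34; 23; 22; 6; 5; 4]; [:: 19; 20; 32; 17; 16; 15; 3; 38; 37;
  2; 10; 11; 26; 27; 28; 12; 13; 14; 29; 30; 31; 33; 34; 23; 22; 21; 4; 5; 6; 7; 24; 25; 9; 8; 1;
  36; 35; 0]; [:: 4; 5; 6; 7; 8; 9; 10; 11; 12; 13; 14; 15; 16; 30; 29; 28; 27; 31; 33; 34; 26; 25;
  24; 23; 22; 21; 20; 32; 17; 18; 3; 38; 37; 2; 1; 36; 35; 0]; [:: 19; 18; 17; 32; 31; 27; 28; 12;
  11; 10; 2; 13; 14; 29; 30; 16; 15; 3; 0; 35; 38; 37; 36; 1; 5; 6; 22; 23; 24; 7; 8; 9; 25; 26; 34;
  33; 21; 4]; [:: 19; 20; 32; 17; 18; 3; 0; 35; 38; 37; 36; 1; 2; 10; 9; 8; 7; 24; 25; 26; 11; 12;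
  13; 14; 15; 16; 30; 29; 28; 27; 31; 33; 34; 23; 22; 6; 5; 4]; [:: 19; 18; 17; 16; 15; 3; 0; 35;
  38; 37; 36; 1; 2; 10; 11; 26; 27; 28; 12; 13; 14; 29; 30; 31; 32; 20; 21; 33; 34; 23; 24; 25; 9;
  8; 7; 6; 5; 4]; [:: 4; 5; 6; 22; 21; 20; 19; 18; 17; 32; 31; 33; 34; 26; 27; 28; 12; 11; 10; 9;
  25; 24; 7; 8; 1; 2; 13; 14; 29; 30; 16; 15; 3; 38; 37; 36; 35; 0]; [:: 19; 18; 17; 32; 20; 21; 22;
  23; 34; 33; 31; 27; 26; 25; 9; 10; 11; 12; 28; 29; 30; 16; 15; 14; 13; 2; 37; 38; 3; 0; 35; 36; 1;
  8; 7; 6; 5; 4]; [:: 19; 18; 17; 16; 15; 3; 0; 35; 38; 37; 36; 1; 2; 13; 14; 29; 30; 31; 32; 20;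
  21; 33; 34; 26; 27; 28; 12; 11; 10; 9; 8; 7; 24; 23; 22; 6; 5; 4]; [:: 19; 18; 17; 32; 20; 21; 22;
  6; 7; 8; 9; 25; 24; 23; 34; 33; 31; 27; 28; 12; 11; 10; 2; 13; 14; 29; 30; 16; 15; 3; 0; 35; 38;
  37; 36; 1; 5; 4]; [:: 19; 18; 17; 16; 30; 29; 28; 12; 11; 10; 2; 13; 14; 15; 3; 0; 35; 38; 37; 36;
  1; 5; 6; 22; 23; 24; 7; 8; 9; 25; 26; 34; 33; 31; 32; 20; 21; 4]; [:: 19; 18; 17; 16; 30; 29; 14;
  15; 3; 0; 35; 38; 37; 36; 1; 2; 13; 12; 11; 10; 9; 8; 7; 24; 25; 26; 27; 31; 32; 20; 21; 33; 34;
  23; 22; 6; 5; 4]; [:: 19; 18; 17; 32; 20; 21; 22; 6; 7; 8; 9; 10; 11; 12; 28; 27; 26; 25; 24; 23;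
  34; 33; 31; 30; 16; 15; 14; 13; 2; 37; 38; 3; 0; 35; 36; 1; 5; 4]; [:: 19; 18; 17; 16; 15; 3; 0;
  35; 38; 37; 36; 1; 2; 10; 9; 8; 7; 24; 25; 26; 11; 12; 13; 14; 29; 28; 27; 31; 32; 20; 21; 33; 34;
  23; 22; 6; 5; 4]; [:: 19; 20; 32; 17; 18; 3; 0; 35; 38; 37; 36; 1; 2; 10; 11; 12; 13; 14; 15; 16;
  30; 29; 28; 27; 26; 25; 9; 8; 7; 24; 23; 34; 33; 21; 22; 6; 5; 4]; [:: 19; 20; 21; 4; 5; 6; 22;
  23; 24; 7; 8; 9; 25; 26; 34; 33; 31; 27; 28; 29; 30; 16; 17; 18; 3; 15; 14; 13; 12; 11; 10; 2; 1;
  36; 37; 38; 35; 0]; [:: 19; 18; 17; 16; 15; 3; 38; 37; 2; 13; 14; 29; 30; 31; 32; 20; 21; 4; 5; 6;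
  22; 23; 34; 26; 27; 28; 12; 11; 10; 9; 25; 24; 7; 8; 1; 36; 35; 0]; [:: 19; 18; 17; 32; 20; 21;
  33; 31; 27; 26; 25; 9; 10; 11; 12; 28; 29; 30; 16; 15; 14; 13; 2; 37; 38; 3; 0; 35; 36; 1; 8; 7;
  24; 23; 22; 6; 5; 4]; [:: 19; 18; 17; 32; 20; 21; 4; 5; 6; 22; 23; 24; 7; 8; 9; 25; 26; 34; 33;
  31; 27; 28; 29; 30; 16; 15; 14; 13; 12; 11; 10; 2; 1; 36; 37; 38; 3; 0]; [:: 19; 18; 17; 16; 15;
  3; 0; 35; 38; 37; 2; 1; 8; 7; 24; 25; 9; 10; 11; 26; 27; 28; 12; 13; 14; 29; 30; 31; 32; 20; 21;
  33; 34; 23; 22; 6; 5; 4]; [:: 19; 18; 17; 32; 20; 21; 4; 5; 6; 22; 23; 24; 7; 8; 9; 25; 26; 34;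
  33; 31; 27; 28; 29; 30; 16; 15; 14; 13; 12; 11; 10; 2; 1; 36; 35; 38; 3; 0]; [:: 19; 18; 3; 0; 35;
  36; 37; 2; 1; 5; 6; 22; 23; 34; 33; 31; 30; 29; 28; 27; 26; 25; 24; 7; 8; 9; 10; 11; 12; 13; 14;
  15; 16; 17; 32; 20; 21; 4]].

Definition cell39_span_b : seq nat := [:: 4; 5; 6; 7; 8; 1; 36; 35; 0; 3; 38; 37; 2; 10; 9; 25; 24; 23;
  22; 21; 20; 19; 18; 17; 32; 31; 33; 34; 26; 11; 12; 13; 14; 15; 16; 30; 29; 28; 27].

Definition cell39_span_c : seq nat := [:: 0; 35; 36; 37; 38; 3; 15; 14; 13; 2; 1; 5; 4; 21; 22; 6; 7;
  8; 9; 10; 11; 12; 28; 29; 30; 16; 17; 18; 19; 20; 32; 31; 27; 26; 25; 24; 23; 34; 33].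

Definition cell38 : seq (seq nat) := [:: [:: 3; 1]; [:: 8; 5; 2; 0]; [:: 13; 10; 3; 1]; [:: 18;
  15; 0; 2]; [:: 21; 5]; [:: 6; 1; 4]; [:: 22; 7; 5]; [:: 24; 8; 6]; [:: 9; 1; 7]; [:: 25; 10; 8];
  [:: 11; 2; 9]; [:: 26; 12; 10]; [:: 28; 13; 11]; [:: 14; 2; 12]; [:: 29; 15; 13]; [:: 16; 3; 14];
  [:: 30; 17; 15]; [:: 32; 18; 16]; [:: 19; 3; 17]; [:: 20; 18]; [:: 32; 21; 19]; [:: 22; 4; 20];
  [:: 23; 6; 21]; [:: 34; 24; 22]; [:: 25; 7; 23]; [:: 35; 26; 9; 24]; [:: 27; 11; 25]; [:: 36; 28;
  26]; [:: 29; 12; 27]; [:: 37; 30; 14; 28]; [:: 31; 16; 29]; [:: 33; 32; 30]; [:: 20; 17; 31]; [::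
  37; 34; 31]; [:: 35; 23; 33]; [:: 36; 25; 34]; [:: 37; 27; 35]; [:: 33; 29; 36]].

Definition cell38_del : seq (seq nat) := [:: [:: 19; 18; 3; 15; 14; 13; 2; 1; 5; 6; 22; 23; 24; 7; 8;
  9; 10; 11; 12; 28; 29; 37; 36; 27; 26; 25; 35; 34; 33; 31; 30; 16; 17; 32; 20; 21; 4]; [:: 19; 18;
  17; 16; 15; 14; 13; 12; 11; 26; 27; 28; 29; 30; 31; 32; 20; 21; 4; 5; 6; 22; 23; 34; 33; 37; 36;
  35; 25; 24; 7; 8; 9; 10; 2; 3; 0]; [:: 19; 18; 3; 0; 1; 5; 6; 22; 23; 24; 7; 8; 9; 10; 11; 26; 25;
  35; 34; 33; 31; 30; 29; 37; 36; 27; 28; 12; 13; 14; 15; 16; 17; 32; 20; 21; 4]; [:: 19; 18; 17;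
  16; 15; 14; 13; 2; 10; 9; 8; 7; 6; 22; 23; 24; 25; 26; 11; 12; 28; 27; 36; 35; 34; 33; 37; 29; 30;
  31; 32; 20; 21; 4; 5; 1; 0]; [:: 19; 18; 17; 16; 15; 14; 13; 12; 11; 10; 9; 8; 7; 24; 23; 34; 33;
  37; 36; 35; 25; 26; 27; 28; 29; 30; 31; 32; 20; 21; 22; 6; 5; 1; 2; 3; 0]; [:: 4; 21; 20; 19; 18;
  17; 32; 31; 30; 16; 15; 14; 13; 12; 28; 29; 37; 33; 34; 23; 22; 6; 7; 24; 25; 35; 36; 27; 26; 11;
  10; 9; 8; 1; 2; 3; 0]; [:: 19; 18; 17; 16; 15; 14; 13; 12; 11; 26; 27; 28; 29; 30; 31; 32; 20; 21;
  22; 23; 34; 33; 37; 36; 35; 25; 24; 7; 8; 9; 10; 2; 3; 0; 1; 5; 4]; [:: 19; 18; 17; 16; 15; 14;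
  13; 12; 28; 27; 36; 35; 34; 33; 37; 29; 30; 31; 32; 20; 21; 4; 5; 6; 22; 23; 24; 25; 26; 11; 10;
  9; 8; 1; 2; 3; 0]; [:: 19; 18; 17; 16; 15; 14; 13; 12; 11; 26; 27; 28; 29; 30; 31; 32; 20; 21; 22;
  6; 7; 24; 23; 34; 33; 37; 36; 35; 25; 9; 10; 2; 3; 0; 1; 5; 4]; [:: 19; 18; 17; 16; 15; 3; 0; 1;
  8; 7; 24; 23; 34; 33; 37; 36; 35; 25; 26; 27; 28; 12; 11; 10; 2; 13; 14; 29; 30; 31; 32; 20; 21;
  22; 6; 5; 4]; [:: 19; 18; 17; 16; 15; 14; 13; 2; 3; 0; 1; 5; 6; 22; 23; 24; 7; 8; 9; 25; 26; 11;
  12; 28; 27; 36; 35; 34; 33; 37; 29; 30; 31; 32; 20; 21; 4]; [:: 19; 18; 17; 16; 15; 3; 0; 1; 2;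
  10; 9; 8; 7; 24; 23; 34; 33; 37; 36; 35; 25; 26; 27; 28; 12; 13; 14; 29; 30; 31; 32; 20; 21; 22;
  6; 5; 4]; [:: 19; 18; 17; 16; 15; 14; 13; 2; 3; 0; 1; 5; 6; 22; 23; 24; 7; 8; 9; 10; 11; 26; 25;
  35; 34; 33; 37; 36; 27; 28; 29; 30; 31; 32; 20; 21; 4]; [:: 19; 18; 17; 16; 30; 31; 32; 20; 21;
  22; 23; 24; 25; 26; 11; 12; 28; 27; 36; 35; 34; 33; 37; 29; 14; 15; 3; 0; 1; 2; 10; 9; 8; 7; 6; 5;
  4]; [:: 19; 18; 17; 16; 15; 3; 0; 1; 2; 13; 12; 11; 10; 9; 8; 7; 24; 23; 34; 33; 37; 36; 35; 25;
  26; 27; 28; 29; 30; 31; 32; 20; 21; 22; 6; 5; 4]; [:: 19; 18; 3; 0; 1; 2; 10; 9; 8; 7; 24; 23; 34;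
  35; 25; 26; 11; 12; 13; 14; 29; 28; 27; 36; 37; 33; 31; 30; 16; 17; 32; 20; 21; 22; 6; 5; 4]; [::
  19; 18; 17; 32; 20; 21; 4; 5; 6; 22; 23; 24; 7; 8; 9; 10; 11; 26; 25; 35; 34; 33; 31; 30; 29; 37;
  36; 27; 28; 12; 13; 14; 15; 3; 2; 1; 0]; [:: 19; 18; 3; 0; 1; 2; 10; 9; 8; 7; 24; 23; 34; 33; 37;
  29; 28; 27; 36; 35; 25; 26; 11; 12; 13; 14; 15; 16; 30; 31; 32; 20; 21; 22; 6; 5; 4]; [:: 19; 20;
  21; 4; 5; 6; 22; 23; 24; 7; 8; 9; 10; 11; 26; 25; 35; 34; 33; 31; 32; 17; 16; 30; 29; 37; 36; 27;
  28; 12; 13; 14; 15; 3; 2; 1; 0]; [:: 4; 5; 6; 7; 8; 9; 10; 11; 12; 13; 14; 15; 16; 30; 31; 33; 34;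
  35; 36; 37; 29; 28; 27; 26; 25; 24; 23; 22; 21; 20; 32; 17; 18; 3; 2; 1; 0]; [:: 19; 18; 17; 32;
  31; 30; 16; 15; 3; 0; 1; 5; 6; 7; 8; 9; 10; 2; 13; 14; 29; 28; 12; 11; 26; 27; 36; 37; 33; 34; 35;
  25; 24; 23; 22; 21; 4]; [:: 19; 20; 32; 17; 18; 3; 0; 1; 2; 10; 9; 8; 7; 24; 25; 26; 11; 12; 13;
  14; 15; 16; 30; 31; 33; 37; 29; 28; 27; 36; 35; 34; 23; 22; 6; 5; 4]; [:: 19; 18; 17; 16; 15; 3;
  2; 10; 11; 26; 27; 28; 12; 13; 14; 29; 30; 31; 32; 20; 21; 4; 5; 6; 7; 24; 23; 34; 33; 37; 36; 35;
  25; 9; 8; 1; 0]; [:: 19; 20; 32; 31; 30; 29; 28; 12; 11; 26; 27; 36; 37; 33; 34; 35; 25; 24; 7; 8;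
  9; 10; 2; 13; 14; 15; 16; 17; 18; 3; 0; 1; 5; 6; 22; 21; 4]; [:: 19; 18; 17; 16; 15; 3; 0; 1; 2;
  10; 11; 26; 27; 28; 12; 13; 14; 29; 30; 31; 32; 20; 21; 22; 23; 34; 33; 37; 36; 35; 25; 9; 8; 7;
  6; 5; 4]; [:: 19; 18; 17; 16; 30; 29; 14; 15; 3; 0; 1; 2; 13; 12; 28; 27; 26; 11; 10; 9; 8; 7; 24;
  23; 34; 35; 36; 37; 33; 31; 32; 20; 21; 22; 6; 5; 4]; [:: 19; 18; 17; 16; 15; 3; 0; 1; 2; 13; 14;
  29; 30; 31; 32; 20; 21; 22; 23; 24; 25; 35; 34; 33; 37; 36; 27; 28; 12; 11; 10; 9; 8; 7; 6; 5; 4];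
  [:: 19; 18; 17; 16; 30; 29; 28; 12; 11; 26; 25; 9; 10; 2; 13; 14; 15; 3; 0; 1; 8; 7; 24; 23; 34;
  35; 36; 37; 33; 31; 32; 20; 21; 22; 6; 5; 4]; [:: 19; 18; 17; 16; 15; 14; 13; 12; 11; 10; 2; 3; 0;
  1; 5; 6; 22; 23; 24; 7; 8; 9; 25; 26; 27; 36; 35; 34; 33; 37; 29; 30; 31; 32; 20; 21; 4]; [:: 19;
  18; 17; 32; 20; 21; 22; 6; 7; 8; 9; 10; 11; 12; 28; 27; 26; 25; 24; 23; 34; 35; 36; 37; 33; 31;
  30; 16; 15; 14; 13; 2; 3; 0; 1; 5; 4]; [:: 19; 18; 17; 16; 15; 3; 0; 1; 2; 10; 9; 8; 7; 24; 23;
  34; 35; 25; 26; 11; 12; 13; 14; 29; 28; 27; 36; 37; 33; 31; 32; 20; 21; 22; 6; 5; 4]; [:: 19; 20;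
  32; 17; 18; 3; 0; 1; 5; 6; 7; 8; 9; 10; 2; 13; 14; 15; 16; 30; 29; 28; 12; 11; 26; 27; 36; 37; 33;
  34; 35; 25; 24; 23; 22; 21; 4]; [:: 19; 20; 21; 4; 5; 6; 22; 23; 24; 7; 8; 9; 10; 11; 12; 28; 29;
  37; 36; 27; 26; 25; 35; 34; 33; 31; 30; 16; 17; 18; 3; 15; 14; 13; 2; 1; 0]; [:: 19; 20; 32; 31;
  30; 29; 37; 36; 27; 28; 12; 11; 26; 25; 35; 34; 23; 24; 7; 8; 9; 10; 2; 13; 14; 15; 16; 17; 18; 3;
  0; 1; 5; 6; 22; 21; 4]; [:: 19; 20; 32; 17; 18; 3; 0; 1; 5; 6; 7; 8; 9; 10; 2; 13; 12; 11; 26; 27;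
  28; 29; 14; 15; 16; 30; 31; 33; 37; 36; 35; 25; 24; 23; 22; 21; 4]; [:: 19; 18; 17; 16; 15; 3; 0;
  1; 2; 10; 11; 26; 25; 9; 8; 7; 24; 23; 34; 33; 37; 36; 27; 28; 12; 13; 14; 29; 30; 31; 32; 20; 21;
  22; 6; 5; 4]; [:: 19; 18; 17; 16; 15; 14; 13; 12; 28; 27; 26; 11; 10; 2; 3; 0; 1; 5; 6; 22; 23;
  24; 7; 8; 9; 25; 35; 34; 33; 37; 29; 30; 31; 32; 20; 21; 4]; [:: 19; 18; 17; 16; 30; 29; 14; 15;
  3; 0; 1; 2; 13; 12; 28; 27; 36; 35; 34; 33; 31; 32; 20; 21; 22; 23; 24; 25; 26; 11; 10; 9; 8; 7;
  6; 5; 4]].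

Definition cell38_span_b : seq nat := [:: 4; 5; 6; 7; 8; 1; 0; 3; 2; 10; 9; 25; 24; 23; 22; 21; 20; 19;
  18; 17; 32; 31; 30; 16; 15; 14; 13; 12; 11; 26; 27; 28; 29; 37; 33; 34; 35; 36].

Definition cell38_span_c : seq nat := [:: 0; 1; 5; 4; 21; 20; 19; 18; 3; 2; 10; 9; 8; 7; 6; 22; 23; 24;
  25; 26; 11; 12; 13; 14; 15; 16; 17; 32; 31; 30; 29; 28; 27; 36; 35; 34; 33; 37].

(* The vertex positions of the four cells, from rounded Tutte embeddings. *)
Definition ring154_pos : seq (seq (Z * Z)) := [:: [:: (-5848, -2876); (5539, -2418); (5558, 2728);
  (-5248, 2566); (-117, -1063); (2586, -1440); (2335, -839); (2944, -665); (4011, -961); (3551,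
  199); (3953, 1355); (2751, 1137); (2268, 1447); (2738, 1976); (389, 1753); (-2068, 1902); (-1344,
  1387); (-1748, 1094); (-3076, 1239); (-2231, 57); (-928, 146); (273, -275); (1477, -412); (1822,
  -123); (2485, -195); (2690, 204); (2032, 608); (1183, 854); (1316, 1228); (496, 1382); (-216,
  1165); (200, 726); (-826, 655); (659, 230); (1504, 238); (-10000, -10000); (10000, -10000);
  (10000, 10000); (-10000, 10000)]; [:: (-4018, -1885); (-2566, -1169); (-2687, -1151); (-3177,
  -1233); (-1608, -1115); (-2138, -1110); (-2240, -1045); (-2365, -1056); (-2477, -1099); (-2500,
  -1073); (-2577, -1088); (-2544, -1041); (-2594, -1037); (-2665, -1077); (-2716, -1043); (-2857,
  -1064); (-2679, -916); (-2594, -759); (-2667, -645); (-2231, 57); (-2254, -511); (-2096, -874);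
  (-2219, -968); (-2319, -985); (-2377, -1024); (-2446, -1031); (-2462, -997); (-2496, -955);
  (-2572, -993); (-2625, -987); (-2586, -926); (-2455, -875); (-2434, -715); (-2305, -904); (-2362,
  -962); (-3382, -1514); (-2962, -1317); (-2938, -1269); (-3166, -1339)]; [:: (-4127, -2185);
  (-2775, -1746); (-2918, -1789); (-3437, -1950); (-1719, -1423); (-2318, -1604); (-2458, -1645);
  (-2593, -1686); (-2702, -1721); (-2739, -1731); (-2819, -1756); (-2801, -1749); (-2858, -1766);
  (-2923, -1787); (-2993, -1807); (-3144, -1854); (-3002, -1805); (-2967, -1788); (-3095, -1822);
  (-2880, -1729); (-2683, -1692); (-2363, -1609); (-2464, -1643); (-2570, -1676); (-2619, -1693);
  (-2695, -1716); (-2726, -1724); (-2781, -1739); (-2851, -1762); (-2912, -1780); (-2893, -1772);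
  (-2766, -1732); (-2805, -1737); (-2585, -1678); (-2627, -1693); (-3558, -1997); (-3162, -1869);
  (-3155, -1865); (-3383, -1937)]; [:: (-3665, -1918); (-2782, -1648); (-2877, -1681); (-3221,
  -1794); (-2080, -1414); (-2478, -1548); (-2574, -1583); (-2663, -1613); (-2735, -1635); (-2760,
  -1645); (-2813, -1662); (-2802, -1660); (-2840, -1673); (-2882, -1686); (-2930, -1703); (-3030,
  -1736); (-2938, -1711); (-2919, -1711); (-3007, -1745); (-2880, -1729); (-2735, -1658); (-2514,
  -1570); (-2579, -1588); (-2649, -1611); (-2681, -1620); (-2731, -1637); (-2753, -1645); (-2791,
  -1660); (-2836, -1673); (-2877, -1688); (-2866, -1686); (-2783, -1660); (-2812, -1676); (-2662,
  -1618); (-2688, -1625); (-3295, -1808); (-3036, -1728); (-3032, -1729); (-3183, -1777)]]%Z.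

Definition ring153_pos : seq (seq (Z * Z)) := [:: [:: (-5837, -2873); (5531, -2421); (5553, 2727);
  (-5247, 2567); (-144, -1071); (2570, -1445); (2322, -843); (2933, -668); (4002, -964); (3543,
  197); (3947, 1352); (2744, 1134); (2262, 1445); (2733, 1974); (384, 1752); (-2071, 1901); (-1349,
  1386); (-1754, 1092); (-3080, 1238); (-2238, 55); (-938, 143); (257, -280); (1463, -416); (1811,
  -126); (2475, -198); (2680, 201); (2023, 606); (1174, 852); (1309, 1225); (490, 1380); (-222,
  1163); (191, 723); (-834, 653); (647, 226); (1494, 235); (-10000, -10000); (10000, -10000);
  (10000, 10000); (-10000, 10000)]; [:: (-3994, -1878); (-2575, -1172); (-2692, -1152); (-3170,
  -1231); (-1643, -1126); (-2158, -1116); (-2257, -1050); (-2378, -1060); (-2488, -1103); (-2510,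
  -1076); (-2585, -1091); (-2553, -1043); (-2601, -1039); (-2671, -1078); (-2719, -1044); (-2857,
  -1064); (-2683, -917); (-2598, -760); (-2669, -645); (-2238, 55); (-2265, -514); (-2115, -880);
  (-2235, -973); (-2333, -989); (-2390, -1028); (-2457, -1035); (-2473, -1000); (-2505, -958);
  (-2579, -995); (-2630, -989); (-2593, -928); (-2465, -878); (-2443, -717); (-2318, -908); (-2375,
  -966); (-3372, -1511); (-2962, -1317); (-2938, -1269); (-3160, -1337)]; [:: (-4108, -2179);
  (-2793, -1751); (-2933, -1793); (-3441, -1951); (-1759, -1435); (-2345, -1613); (-2484, -1653);
  (-2616, -1693); (-2723, -1727); (-2759, -1737); (-2838, -1762); (-2820, -1755); (-2876, -1772);
  (-2939, -1792); (-3009, -1812); (-3156, -1858); (-3019, -1810); (-2987, -1795); (-3114, -1829);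
  (-2914, -1740); (-2712, -1701); (-2393, -1618); (-2491, -1652); (-2595, -1684); (-2642, -1700);
  (-2716, -1723); (-2747, -1731); (-2802, -1746); (-2869, -1768); (-2930, -1786); (-2912, -1778);
  (-2789, -1739); (-2829, -1745); (-2611, -1686); (-2651, -1700); (-3555, -1997); (-3170, -1872);
  (-3163, -1868); (-3386, -1939)]; [:: (-3597, -1897); (-3083, -1741); (-3093, -1751); (-3205,
  -1790); (-2154, -1437); (-2661, -1605); (-2747, -1637); (-2869, -1677); (-2979, -1711); (-2985,
  -1716); (-3030, -1731); (-3011, -1726); (-3023, -1731); (-3056, -1741); (-3051, -1742); (-3094,
  -1757); (-3026, -1740); (-2991, -1734); (-3037, -1755); (-2914, -1740); (-2792, -1676); (-2552,
  -1581); (-2710, -1629); (-2832, -1669); (-2882, -1684); (-2946, -1705); (-2979, -1716); (-2981,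
  -1718); (-3003, -1726); (-3004, -1728); (-2992, -1727); (-2947, -1715); (-2910, -1709); (-2939,
  -1708); (-2903, -1693); (-2937, -1704); (-2962, -1713); (-2968, -1716)]]%Z.

Definition ring152_pos : seq (seq (Z * Z)) := [:: [:: (-5812, -2864); (5515, -2426); (5542, 2723);
  (-5245, 2567); (-201, -1090); (2536, -1456); (2293, -853); (2909, -676); (3983, -971); (3524,
  191); (3931, 1347); (2727, 1129); (2247, 1440); (2721, 1970); (373, 1748); (-2077, 1899); (-1361,
  1382); (-1767, 1088); (-3089, 1235); (-2255, 50); (-961, 135); (223, -291); (1434, -426); (1785,
  -135); (2451, -205); (2660, 195); (2003, 599); (1156, 846); (1293, 1220); (476, 1376); (-238,
  1158); (172, 717); (-852, 647); (622, 218); (1470, 227); (-10000, -10000); (10000, -10000);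
  (10000, 10000); (-10000, 10000)]; [:: (-3987, -1875); (-2597, -1179); (-2711, -1158); (-3177,
  -1233); (-1688, -1141); (-2190, -1126); (-2286, -1059); (-2404, -1068); (-2511, -1110); (-2533,
  -1083); (-2606, -1097); (-2574, -1050); (-2621, -1045); (-2689, -1084); (-2736, -1049); (-2871,
  -1068); (-2699, -923); (-2615, -765); (-2682, -649); (-2255, 50); (-2288, -521); (-2146, -890);
  (-2264, -982); (-2359, -997); (-2415, -1036); (-2481, -1042); (-2495, -1008); (-2527, -965);
  (-2599, -1002); (-2649, -995); (-2611, -934); (-2486, -885); (-2463, -724); (-2344, -916); (-2399,
  -974); (-3377, -1512); (-2975, -1321); (-2951, -1273); (-3168, -1339)]; [:: (-4017, -2150);
  (-3249, -1899); (-3261, -1897); (-3426, -1945); (-1874, -1472); (-2624, -1703); (-2749, -1738);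
  (-2930, -1794); (-3093, -1846); (-3100, -1846); (-3166, -1866); (-3138, -1856); (-3155, -1860);
  (-3204, -1876); (-3196, -1871); (-3259, -1890); (-3155, -1853); (-3100, -1829); (-3165, -1844);
  (-2970, -1758); (-2802, -1730); (-2456, -1639); (-2692, -1717); (-2872, -1772); (-2948, -1797);
  (-3042, -1826); (-3091, -1841); (-3093, -1840); (-3125, -1849); (-3125, -1848); (-3106, -1839);
  (-3039, -1816); (-2980, -1792); (-3029, -1817); (-2976, -1803); (-3028, -1820); (-3065, -1831);
  (-3073, -1832)]; [:: (-3581, -1892); (-3099, -1746); (-3113, -1757); (-3221, -1795); (-2216,
  -1457); (-2699, -1617); (-2783, -1649); (-2900, -1687); (-3003, -1719); (-3010, -1724); (-3053,
  -1738); (-3036, -1734); (-3048, -1739); (-3079, -1749); (-3076, -1750); (-3117, -1764); (-3055,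
  -1749); (-3025, -1745); (-3072, -1766); (-2970, -1758); (-2840, -1692); (-2602, -1597); (-2751,
  -1642); (-2866, -1679); (-2913, -1693); (-2974, -1714); (-3006, -1725); (-3009, -1727); (-3029,
  -1734); (-3031, -1737); (-3022, -1737); (-2981, -1725); (-2949, -1721); (-2971, -1718); (-2935,
  -1704); (-2966, -1713); (-2991, -1722); (-2998, -1725)]]%Z.

Definition ring151_pos : seq (seq (Z * Z)) := [:: [:: (-5782, -2852); (5498, -2434); (5529, 2718);
  (-5245, 2568); (-255, -1118); (2502, -1473); (2262, -867); (2883, -688); (3961, -980); (3504,
  182); (3913, 1340); (2707, 1121); (2228, 1433); (2705, 1964); (358, 1743); (-2089, 1896); (-1379,
  1376); (-1790, 1081); (-3111, 1230); (-2297, 41); (-997, 124); (185, -307); (1401, -441); (1756,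
  -147); (2425, -217); (2636, 185); (1980, 589); (1133, 837); (1273, 1213); (457, 1369); (-258,
  1151); (146, 708); (-880, 638); (591, 205); (1442, 216); (-10000, -10000); (10000, -10000);
  (10000, 10000); (-10000, 10000)]; [:: (-3882, -1832); (-3060, -1398); (-3013, -1238); (-3140,
  -1198); (-1798, -1199); (-2468, -1256); (-2545, -1172); (-2710, -1194); (-2877, -1265); (-2861,
  -1204); (-2917, -1200); (-2877, -1158); (-2885, -1138); (-2934, -1157); (-2905, -1095); (-2952,
  -1077); (-2812, -939); (-2705, -775); (-2714, -644); (-2297, 41); (-2364, -546); (-2207, -937);
  (-2459, -1067); (-2623, -1092); (-2707, -1144); (-2789, -1146); (-2829, -1137); (-2820, -1106);
  (-2844, -1099); (-2827, -1051); (-2779, -965); (-2699, -904); (-2590, -741); (-2728, -1005);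
  (-2704, -1065); (-2760, -1098); (-2787, -1084); (-2780, -1047)]; [:: (-4000, -2145); (-3250,
  -1903); (-3262, -1900); (-3422, -1947); (-1908, -1492); (-2640, -1714); (-2762, -1747); (-2938,
  -1801); (-3098, -1852); (-3105, -1852); (-3169, -1871); (-3141, -1861); (-3158, -1865); (-3206,
  -1880); (-3198, -1876); (-3259, -1893); (-3158, -1857); (-3104, -1835); (-3167, -1849); (-2975,
  -1764); (-2813, -1738); (-2476, -1652); (-2706, -1727); (-2882, -1780); (-2956, -1805); (-3047,
  -1832); (-3095, -1846); (-3098, -1846); (-3128, -1855); (-3128, -1853); (-3110, -1844); (-3044,
  -1822); (-2987, -1798); (-3035, -1823); (-2984, -1810); (-3034, -1826); (-3070, -1837); (-3078,
  -1838)]; [:: (-3546, -1880); (-3093, -1748); (-3107, -1759); (-3208, -1793); (-2263, -1483);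
  (-2718, -1630); (-2797, -1659); (-2906, -1695); (-3003, -1724); (-3010, -1728); (-3050, -1741);
  (-3034, -1738); (-3046, -1742); (-3075, -1751); (-3072, -1753); (-3111, -1766); (-3053, -1752);
  (-3025, -1750); (-3070, -1769); (-2975, -1764); (-2852, -1702); (-2627, -1613); (-2766, -1653);
  (-2875, -1688); (-2919, -1701); (-2976, -1719); (-3007, -1730); (-3009, -1732); (-3029, -1738);
  (-3030, -1741); (-3022, -1741); (-2983, -1731); (-2953, -1727); (-2974, -1724); (-2939, -1710);
  (-2969, -1719); (-2993, -1727); (-2999, -1731)]]%Z.
Definition half_side : Z := 10000%Z.

(** * Straight-line drawings *)

From mathcomp Require Import all_order all_algebra.
From mathcomp Require Import all_classical all_reals all_analysis.
From mathcomp Require Import ring lra ssrZ.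
Import Order.TTheory GRing.Theory Num.Theory.
Import numFieldNormedType.Exports.

Import numFieldNormedType.Exports.

Section Segments.
Local Open Scope ring_scope.
Local Open Scope classical_set_scope.
Variable R : realType.
Implicit Types p q r s : R * R.

Definition seg p q (t : R) : R * R := (p.1 + t * (q.1 - p.1), p.2 + t * (q.2 - p.2)).

(* A line [l = 0] separates [pq] from [rs] and contains at most an end of [pq], or is
   disjoint from [rs]; so the interior of [pq] avoids [rs]. *)
Definition sep p q r s : Prop := exists x y z : R,
  let l m := x * m.1 + y * m.2 + z in
  [/\ 0 <= l p, 0 <= l q, l r <= 0, l s <= 0 & 0 < l p + l q \/ (l r < 0 /\ l s < 0)].

Lemma seg0 p q : seg p q 0 = p.
Proof. by case: p => x y; rewrite /seg /= !mul0r !addr0. Qed.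

Lemma seg1 p q : seg p q 1 = q.
Proof. by case: p q => x y [z t]; rewrite /seg /= !mul1r ![_ + (_ - _)]addrC !subrK. Qed.

Lemma segC p q t : seg q p t = seg p q (1 - t).
Proof. by case: p q => x y [z u]; rewrite /seg /=; congr pair; ring. Qed.

Lemma affine_continuous (a b : R) : continuous (fun t : R => a + t * b).
Proof.
move=> t; rewrite /continuous_at; apply: cvgD; first exact: cvg_cst.
by apply: cvgMr_tmp; exact: cvg_id.
Qed.

Lemma seg_continuous p q : continuous (seg p q).
Proof.
move=> t.
exact: (cvg_pair (@affine_continuous p.1 (q.1 - p.1) t) (@affine_continuous p.2 (q.2 - p.2) t)).
Qed.

Lemma seg_inj p q : p != q -> injective (seg p q).
Proof.
case: p q => x y [z t] pq u u' []; rewrite /= => /addrI h1 /addrI h2.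
apply/eqP/negPn/negP => uu; case/negP: pq; rewrite xpair_eqE.
have : (u - u') * (z - x) = 0 by rewrite mulrBl h1 subrr.
have : (u - u') * (t - y) = 0 by rewrite mulrBl h2 subrr.
move/eqP; rewrite mulf_eq0 subr_eq0 (negbTE uu) /= subr_eq0 => /eqP->.
move/eqP; rewrite mulf_eq0 subr_eq0 (negbTE uu) /= subr_eq0 => /eqP->.
by rewrite !eqxx.
Qed.

(** At a common point the affine form would be both nonnegative and nonpositive. For interior [t] it
    is positive if one of its values at [p], [q] is; in the other alternative it is negative on all
    of [rs]. *)
Lemma sep_disjoint p q r s t u : sep p q r s -> 0 < t < 1 -> 0 <= u <= 1 ->
  seg p q t <> seg r s u.
Proof.
case: p q r s => p1 p2 [q1 q2] [r1 r2] [s1 s2] [x [y [z]]] /=.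
set lp := x * p1 + _ + _; set lq := x * q1 + _ + _.
set lr := x * r1 + _ + _; set ls := x * s1 + _ + _.
move=> [p0 q0 r0 s0 h] /andP[t0 t1] /andP[u0 u1] [] e1 e2.
have e : (1 - t) * lp + t * lq = (1 - u) * lr + u * ls.
  transitivity (x * (p1 + t * (q1 - p1)) + y * (p2 + t * (q2 - p2)) + z).
    by rewrite /lp /lq; ring.
  by rewrite e1 e2 /lr /ls; ring.
have tp : 0 <= (1 - t) * lp by apply: mulr_ge0 => //; lra.
have tq : 0 <= t * lq by apply: mulr_ge0 => //; lra.
have ur : (1 - u) * lr <= 0 by apply: mulr_ge0_le0 => //; lra.
have us : u * ls <= 0 by apply: mulr_ge0_le0 => //; lra.
case: h => [h|[hr hs]].
  have [lp0|lp0] := ltP 0 lp.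
    have : 0 < (1 - t) * lp by apply: mulr_gt0 => //; lra.
    lra.
  have : 0 < t * lq by apply: mulr_gt0 => //; lra.
  lra.
have [u_0|un] := eqVneq u 0; first by rewrite u_0 in e; lra.
have : u * ls < 0 by rewrite pmulr_rlt0 // lt_neqAle eq_sym un.
lra.
Qed.

(** Requiring a neighbour for every vertex removes the need for separate vertex conditions: a vertex
    met by an edge is an end of another edge, and edges are already separated. *)
Definition straight (T : finType) (e : rel T) (pos : T -> R * R) : Prop :=
  [/\ injective pos, forall x, exists y, e x y &
    forall x y z t, e x y -> e z t -> [set x; y]%SET != [set z; t]%SET ->
      sep (pos x) (pos y) (pos z) (pos t)].

Lemma set2_eq (T : finType) (x y z t : T) : [set x; y]%SET = [set z; t]%SET ->
  (z = x /\ t = y) \/ (z = y /\ t = x).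
Proof.
move/setP => E; have := E x; have := E y; have := E z; have := E t.
rewrite !finset.inE !eqxx ?orbT /= => /orP[]/eqP tE /orP[]/eqP zE /esym/orP hy /esym/orP hx; subst.
- by case: hy => /eqP ->; left.
- by right.
- by left.
- by case: hx => /eqP ->; left.
Qed.

Lemma straight_planar (G : sgraph) (pos : G -> R * R) : straight (@adj G) pos -> planar R G.
Proof.
case=> pos_inj deg psep.
pose arc (e : {set G}) : set (R * R) := [set m | exists x y t,
  [/\ adj x y, e = [set x; y]%SET, 0 <= t <= 1 & m = seg (pos x) (pos y) t]].
have interior_seg e m : (arc e `\` pos @` [set` e]) m -> exists x y t,
    [/\ adj x y, e = [set x; y]%SET, 0 < t < 1 & m = seg (pos x) (pos y) t].
  case=> -[x [y [t [xy E /andP[t0 t1] mE]]]] nm; exists x, y, t; split=> //.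
  apply/andP; split; rewrite lt_neqAle ?t0 ?t1 andbT; apply/eqP => tE; apply: nm.
    by exists x; rewrite /= ?E ?finset.inE ?eqxx // mE -tE seg0.
  by exists y; rewrite /= ?E ?finset.inE ?eqxx ?orbT // mE tE seg1.
exists pos, arc; split=> //.
- move=> x y xy; exists (seg (pos x) (pos y)).
  have pxy : pos x != pos y.
    by apply: contraTneq xy => /pos_inj->; rewrite adj_irrefl.
  split; rewrite ?seg0 ?seg1 //.
  + by apply: continuous_subspaceT; exact: seg_continuous.
  + by move=> t u _ _; exact: seg_inj.
  + apply/seteqP; split=> m; last first.
      by case=> t /=; rewrite in_itv /= => t01 <-; exists x, y, t.
    case=> x' [y' [t [xy' E /andP[t0 t1] ->]]].
    case: (set2_eq E) => -[-> ->]; first by exists t; rewrite //= in_itv /= t0 t1.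
    by exists (1 - t); rewrite -?segC //= in_itv /=; apply/andP; split; lra.
- move=> e _; apply/seteqP; split=> // m [im [v _ vm]].
  have [x [y [t [xy E t01 mE]]]] := interior_seg e m im.
  (* The vertex [v] is treated as the point with parameter 0 of an edge [vz]. This edge is not [e],
     since the ends of [e] were taken out of its interior. *)
  have [z vz] := deg v; have ne : [set x; y]%SET != [set v; z]%SET.
    apply/eqP => E'; case: im => _; apply; exists v => //=.
    by rewrite E E' !finset.inE eqxx.
  case: (sep_disjoint (u := 0) (psep _ _ _ _ xy vz ne) t01); first by rewrite lexx ler01.
  by rewrite seg0 -mE.
- move=> e e' _ _ ee'; apply/seteqP; split=> // m [/interior_seg].
  move=> [x [y [t [xy E t01 mE]]]] [z [z' [u [zz E' u01 mE']]]].
  apply: (sep_disjoint (psep _ _ _ _ xy zz _) t01 u01); first by rewrite -E -E'.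
  by rewrite -mE -mE'.
Qed.

Lemma sepCl p q r s : sep p q r s -> sep q p r s.
Proof.
case=> x [y [z /= [h1 h2 h3 h4 h5]]]; exists x, y, z; split=> //.
by case: h5; [rewrite addrC; left|right].
Qed.

Lemma sepCr p q r s : sep p q r s -> sep p q s r.
Proof.
case=> x [y [z /= [h1 h2 h3 h4 h5]]]; exists x, y, z; split=> //.
by case: h5 => [|[]]; [left|right].
Qed.

Definition sg (b : bool) : R := if b then 1 else -1.
Definition corner (a : R) (i : bool * bool) : R * R := (sg i.1 * a, sg i.2 * a).

Definition in_square (T : Type) (pos : T -> R * R) (v : bool * bool -> T) (a : R) : Prop :=
  [/\ 0 < a, forall x, (- a <= (pos x).1 <= a) && (- a <= (pos x).2 <= a)
    & forall i, pos (v i) = corner a i].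

Lemma corner_inj a : 0 < a -> injective (corner a).
Proof.
move=> a0; have h b c : sg b * a = sg c * a -> b = c.
  by case: b; case: c; rewrite // /sg; lra.
by move=> [i1 i2] [j1 j2] [] /h -> /h ->.
Qed.

(** * Drawing an enlargement as a concentric square *)

Section LadderDrawing.
Variables (T : finType) (e : rel T) (v : bool * bool -> T) (pos : T -> R * R) (a : R).
Hypotheses (irr : irreflexive e) (drawn : straight e pos) (sq : in_square pos v a).

Definition th_pos (x : T + bool * bool) : R * R :=
  match x with inl x => pos x | inr i => corner (a + a) i end.

Lemma th_in_square : in_square th_pos inr (a + a).
Proof.
case: sq => a0 box _; split=> //; first by lra.
case=> [x|[i j]] /=; first by have /andP[/andP[? ?] /andP[? ?]] := box x; apply/andP; split; lra.
by case: i; case: j; rewrite /sg; apply/andP; split; lra.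
Qed.

Variant th_edge : T + bool * bool -> T + bool * bool -> Prop :=
| OldEdge x y of e x y : th_edge (inl x) (inl y)
| Spoke1 i : th_edge (inl (v i)) (inr i)
| Spoke2 i : th_edge (inr i) (inl (v i))
| Side i b : th_edge (inr i) (inr (flip b i)).

Lemma th_edgeP x y : th_adj e v x y -> th_edge x y.
Proof.
case: x y => [x|i] [y|j] /=.
- by case/andP=> exy _; exact: OldEdge.
- by move/eqP->; exact: Spoke1.
- by move/eqP->; exact: Spoke2.
- by case/orP=> /eqP->; [exact: (Side i true)|exact: (Side i false)].
Qed.

(** The separating line supports the old square at the corner [v i], perpendicular to the spoke; an
    old edge meets it at most in one end. *)
Lemma sep_old_spoke x y i : e x y ->
  sep (pos x) (pos y) (pos (v i)) (corner (a + a) i).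
Proof.
case: sq drawn => a0 box vE [pos_inj _ _] exy; rewrite vE.
have xy : pos x != pos y by apply: contraTneq exy => /pos_inj->; rewrite irr.
have := box x; have := box y; case: (pos x) (pos y) xy => x1 x2 [y1 y2] xy /=.
move=> /andP[/andP[? ?] /andP[? ?]] /andP[/andP[? ?] /andP[? ?]].
exists (- sg i.1), (- sg i.2), (a + a) => /=; case: i => [[] []]; rewrite /sg /=; split; try lra; left;
  rewrite ltNge; apply: contra xy => h; apply/eqP; congr pair; lra.
Qed.

Lemma sep_spoke_old x y i : sep (pos (v i)) (corner (a + a) i) (pos x) (pos y).
Proof.
case: sq => a0 box vE; rewrite vE.
have := box x; have := box y; case: (pos x) (pos y) => x1 x2 [y1 y2] /=.
move=> /andP[/andP[? ?] /andP[? ?]] /andP[/andP[? ?] /andP[? ?]].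
by exists (sg i.1), (sg i.2), (- (a + a)) => /=; case: i => [[] []]; rewrite /sg /=; split; try lra; left; lra.
Qed.

(** The line carries the new side itself, from which the old square has distance [a]. *)
Lemma sep_old_side x y i b :
  sep (pos x) (pos y) (corner (a + a) i) (corner (a + a) (flip b i)).
Proof.
case: sq => a0 box vE.
have := box x; have := box y; case: (pos x) (pos y) => x1 x2 [y1 y2] /=.
move=> /andP[/andP[? ?] /andP[? ?]] /andP[/andP[? ?] /andP[? ?]].
exists (if b then 0 else - sg i.1), (if b then - sg i.2 else 0), (a + a) => /=.
by case: i => [[] []]; case: b; rewrite /sg /=; split; try lra; left; lra.
Qed.

(** The line carries the parallel side of the old square. *)
Lemma sep_side_old x y i b :
  sep (corner (a + a) i) (corner (a + a) (flip b i)) (pos x) (pos y).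
Proof.
case: sq => a0 box vE.
have := box x; have := box y; case: (pos x) (pos y) => x1 x2 [y1 y2] /=.
move=> /andP[/andP[? ?] /andP[? ?]] /andP[/andP[? ?] /andP[? ?]].
exists (if b then 0 else sg i.1), (if b then sg i.2 else 0), (- a) => /=.
by case: i => [[] []]; case: b; rewrite /sg /=; split; try lra; left; lra.
Qed.

(** The line is the perpendicular bisector of the two corners, which passes through the centre. *)
Lemma sep_spokes i j : i != j ->
  sep (pos (v i)) (corner (a + a) i) (pos (v j)) (corner (a + a) j).
Proof.
case: sq => a0 _ vE ij; rewrite !vE.
exists (sg i.1 - sg j.1), (sg i.2 - sg j.2), 0 => /=.
by case: i ij => [[] []]; case: j => [[] []] //= _; rewrite /sg; split; try lra; left; lra.
Qed.

(** If the spoke ends on this side, the diagonal containing the spoke separates; otherwise the axis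
    parallel to the side does. *)
Lemma sep_side_spoke i b j :
  sep (corner (a + a) i) (corner (a + a) (flip b i)) (pos (v j)) (corner (a + a) j).
Proof.
case: sq => a0 _ vE; rewrite vE.
exists (if b then (if i.2 == j.2 then - sg j.1 else 0) else sg i.1),
  (if b then sg i.2 else (if i.1 == j.1 then - sg j.2 else 0)), 0 => /=.
by case: i => [[] []]; case: j => [[] []]; case: b; rewrite /sg /=; split; try lra; left; lra.
Qed.

Lemma sep_spoke_side i b j :
  sep (pos (v j)) (corner (a + a) j) (corner (a + a) i) (corner (a + a) (flip b i)).
Proof.
case: sq => a0 _ vE; rewrite vE.
exists (if b then 0 else - sg i.1), (if b then - sg i.2 else 0), (a + a) => /=.
by case: i => [[] []]; case: j => [[] []]; case: b; rewrite /sg /=; split; try lra; left; lra.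
Qed.

(** Opposite sides are separated by an axis; for adjacent ones the line carries the second side and
    meets the first only in the common corner. *)
Lemma sep_sides i b j b' : [set i; flip b i]%SET != [set j; flip b' j]%SET ->
  sep (corner (a + a) i) (corner (a + a) (flip b i)) (corner (a + a) j) (corner (a + a) (flip b' j)).
Proof.
case: sq => a0 _ _ ne.
have ij : (b == b') ==> (if b then i.2 != j.2 else i.1 != j.1).
  apply/implyP => /eqP bb; apply: contraNT ne; rewrite -bb; clear.
  case: b; case: i => [[] []]; case: j => [[] []] //= _; rewrite /rflip /gflip /= ?eqxx //;
    by rewrite finset.setUC.
exists (if b == b' then (if b then 0 else sg i.1) else if b then - sg j.1 else 0),
  (if b == b' then (if b then sg i.2 else 0) else if b then 0 else - sg j.2),
  (if b == b' then 0 else a + a) => /=.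
by move: ij; clear ne; case: i => [[] []]; case: j => [[] []]; case: b; case: b'; rewrite /sg //= => _;
  split; try lra; left; lra.
Qed.

Lemma th_straight : straight (th_adj e v) th_pos.
Proof.
case: (drawn) (sq) => pos_inj deg psep [a0 box vE]; split.
- case=> [x|i] [y|j] /=.
  + by move/pos_inj->.
  + have /andP[/andP[h1 h2] /andP[h3 h4]] := box x; move=> E; exfalso; move: h1 h2; rewrite E /=.
    by case: j {E} => [[] []]; rewrite /sg /=; lra.
  + have /andP[/andP[h1 h2] /andP[h3 h4]] := box y; move=> E; exfalso; move: h1 h2; rewrite -E /=.
    by case: i {E} => [[] []]; rewrite /sg /=; lra.
  + by move=> /corner_inj-> //; lra.
- case=> [x|i]; last by exists (inl (v i)); rewrite /= eqxx.
  (* If the known neighbour is lost with a rail, then [x] is a corner and its spoke provides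
     another. *)
  have [y exy] := deg x; have [/railP [i [-> _]]|nr] := boolP (rail v x y).
    by exists (inr i); rewrite /= eqxx.
  by exists (inl y); rewrite /= exy.
- move=> _ _ _ _ /th_edgeP[x y exy|i|i|i b] /th_edgeP[z t ezt|j|j|j b'] ne /=.
  + apply: psep => //; apply: contraNneq ne => E.
    by case: (set2_eq E) => -[-> ->] //; rewrite finset.setUC.
  + exact: sep_old_spoke.
  + apply: sepCr; exact: sep_old_spoke.
  + exact: sep_old_side.
  + exact: sep_spoke_old.
  + by apply: sep_spokes; apply: contraNneq ne => ->.
  + by apply: sepCr; apply: sep_spokes; apply: contraNneq ne => ->; rewrite finset.setUC.
  + exact: sep_spoke_side.
  + apply: sepCl; exact: sep_spoke_old.
  + by apply: sepCl; apply: sep_spokes; apply: contraNneq ne => ->; rewrite finset.setUC.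
  + by apply: sepCl; apply: sepCr; apply: sep_spokes; apply: contraNneq ne => ->.
  + apply: sepCl; exact: sep_spoke_side.
  + exact: sep_side_old.
  + exact: sep_side_spoke.
  + apply: sepCr; exact: sep_side_spoke.
  + apply: sep_sides; apply: contraNneq ne => E.
    by case: (set2_eq E) => -[-> ->] //; rewrite finset.setUC.
Qed.

End LadderDrawing.
End Segments.

(** * Deciding separation by integer arithmetic *)

Section IntegerDrawings.
Local Open Scope ring_scope.
Variable R : realType.

Definition zr (z : Z) : R := (int_of_Z z)%:~R.
Definition zpt (p : Z * Z) : R * R := (zr p.1, zr p.2).

Lemma zrD x y : zr (Z.add x y) = zr x + zr y.
Proof. by rewrite /zr -rmorphD -(rmorphD int_of_Z). Qed.

Lemma zrM x y : zr (Z.mul x y) = zr x * zr y.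
Proof. by rewrite /zr -rmorphM -(rmorphM int_of_Z). Qed.

Lemma zrN x : zr (Z.opp x) = - zr x.
Proof. by rewrite /zr -rmorphN -(rmorphN int_of_Z). Qed.

Lemma zr_le x y : Z.leb x y -> zr x <= zr y.
Proof.
move=> /Z.leb_spec0 xy; rewrite -subr_ge0 -zrN -zrD.
have : Z.le 0 (Z.add y (Z.opp x)) by lia.
by case: (Z.add _ _) => // p _; rewrite /zr ler0z.
Qed.

Lemma zr_inj : injective zr.
Proof. by move=> x y /intr_inj /(can_inj int_of_ZK). Qed.

Lemma zr_lt x y : Z.ltb x y -> zr x < zr y.
Proof.
move=> /Z.ltb_spec0 xy; rewrite lt_neqAle zr_le ?andbT; last by apply/Z.leb_spec0; lia.
by apply/eqP => /zr_inj E; lia.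
Qed.

Lemma zpt_inj : injective zpt.
Proof. by move=> [x y] [z t] [] /zr_inj-> /zr_inj->. Qed.

Definition zlin (x y : Z) (p : Z * Z) : Z := Z.add (Z.mul x p.1) (Z.mul y p.2).

Lemma zr_zlin x y p : zr (zlin x y p) = zr x * zr p.1 + zr y * zr p.2.
Proof. by rewrite zrD !zrM. Qed.

(** Looks for a separating line with normal [(x, y)], placed at the larger value on [rs]. Different
    values at [p] and [q] exclude that both lie on the line, which permits a common end. *)
Definition dir_check (x y : Z) (p q r s : Z * Z) : bool :=
  let p' := zlin x y p in let q' := zlin x y q in
  let r' := zlin x y r in let s' := zlin x y s in
  let m := Z.max r' s' in let m' := Z.min p' q' in
  Z.leb m m' && (~~ Z.eqb p' q' || Z.ltb m m').

Lemma dir_checkP x y p q r s : dir_check x y p q r s -> sep (zpt p) (zpt q) (zpt r) (zpt s).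
Proof.
rewrite /dir_check; set m := Z.max _ _; set m' := Z.min _ _ => /andP[mm h].
exists (zr x), (zr y), (- zr m); rewrite /= -!zr_zlin.
have [pm qm] : zr m' <= zr (zlin x y p) /\ zr m' <= zr (zlin x y q).
  by split; apply: zr_le; apply/Z.leb_spec0; rewrite /m'; lia.
have [rm sm] : zr (zlin x y r) <= zr m /\ zr (zlin x y s) <= zr m.
  by split; apply: zr_le; apply/Z.leb_spec0; rewrite /m; lia.
have mm' := zr_le mm; split; try lra; left.
case/orP: h => [pq|/zr_lt]; last by lra.
have : zr (zlin x y p) != zr (zlin x y q).
  by apply: contraNneq pq => /zr_inj->; rewrite Z.eqb_refl.
by rewrite neq_lt => /orP[]; lra.
Qed.

(** The candidates for the line are the parallels to one of the two segments, with both orientations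
    of the normal. *)
Definition normal_check (p q r s : Z * Z) : bool :=
  let check u v := let x := Z.sub v.2 u.2 in let y := Z.sub u.1 v.1 in
    dir_check x y p q r s || dir_check (Z.opp x) (Z.opp y) p q r s in
  check p q || check r s.

(* most pairs are separated by a horizontal or a vertical line *)
Definition pair_check (e e' : (Z * Z) * (Z * Z)) : bool :=
  let p := e.1 in let q := e.2 in let r := e'.1 in let s := e'.2 in
  [|| Z.ltb (Z.max p.1 q.1) (Z.min r.1 s.1), Z.ltb (Z.max r.1 s.1) (Z.min p.1 q.1),
      Z.ltb (Z.max p.2 q.2) (Z.min r.2 s.2), Z.ltb (Z.max r.2 s.2) (Z.min p.2 q.2) |
      normal_check p q r s && normal_check r s p q].

Lemma normal_checkP p q r s : normal_check p q r s -> sep (zpt p) (zpt q) (zpt r) (zpt s).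
Proof. by case/orP=> /orP[]; exact: dir_checkP. Qed.

Lemma pair_checkP p q r s : pair_check (p, q) (r, s) ->
  sep (zpt p) (zpt q) (zpt r) (zpt s) /\ sep (zpt r) (zpt s) (zpt p) (zpt q).
Proof.
have axis x y p1 q1 r1 s1 : Z.lt (Z.max (zlin x y r1) (zlin x y s1)) (Z.min (zlin x y p1) (zlin x y q1)) ->
    sep (zpt p1) (zpt q1) (zpt r1) (zpt s1).
  move=> h; apply: (@dir_checkP x y); apply/andP; split; first by apply/Z.leb_spec0; lia.
  by apply/orP; right; apply/Z.ltb_spec0.
rewrite /pair_check /= => /or4P[/Z.ltb_spec0 h|/Z.ltb_spec0 h|/Z.ltb_spec0 h|/orP[/Z.ltb_spec0 h|/andP[]]].
- by split; [apply: (axis (Zneg xH) Z0)|apply: (axis (Zpos xH) Z0)]; rewrite /zlin; lia.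
- by split; [apply: (axis (Zpos xH) Z0)|apply: (axis (Zneg xH) Z0)]; rewrite /zlin; lia.
- by split; [apply: (axis Z0 (Zneg xH))|apply: (axis Z0 (Zpos xH))]; rewrite /zlin; lia.
- by split; [apply: (axis Z0 (Zpos xH))|apply: (axis Z0 (Zneg xH))]; rewrite /zlin; lia.
- by move=> /normal_checkP h1 /normal_checkP h2.
Qed.

Lemma pairwise_neq (T : eqType) (r : rel T) l x y :
  pairwise r l -> x \in l -> y \in l -> x != y -> r x y || r y x.
Proof.
elim: l => //= z l IH /andP[/allP zl /IH {}IH]; rewrite !inE.
move=> /predU1P[->|xl] /predU1P[->|yl] xy; first by rewrite eqxx in xy.
- by rewrite zl.
- by rewrite zl ?orbT.
- exact: IH.
Qed.

End IntegerDrawings.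

Definition edge_list (g : seq (seq nat)) : seq (nat * nat) :=
  flatten [seq [seq (k, l) | l <- nbrs g k & k < l] | k <- iota 0 (size g)].

Lemma edge_listP g (i j : cell_vertex g) : graph_ok g -> cell_adj i j ->
  ((i : nat, j : nat) \in edge_list g) \/ ((j : nat, i : nat) \in edge_list g).
Proof.
move=> ok; rewrite /cell_adj is_nbrP => ij; have [iln jn ne ji] := nbrsP ok ij.
have mem (k l : nat) : l \in nbrs g k -> k < size g -> k < l -> (k, l) \in edge_list g.
  move=> lk ks kl; apply/flattenP; exists [seq (k, l) | l <- nbrs g k & k < l].
    by apply/mapP; exists k; rewrite // mem_iota.
  by apply/mapP; exists l; rewrite // mem_filter kl.
by move: ne; rewrite neq_ltn => /orP[lt|lt]; [right|left]; exact: mem.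
Qed.

Lemma edge_list_lt g k l : graph_ok g -> (k, l) \in edge_list g -> (k < size g) && (l < size g).
Proof.
move=> ok /flattenP[_ /mapP[k' _ ->] /mapP[l']]; rewrite mem_filter => /andP[_ /(nbrsP ok)[? ? _ _]] [-> ->].
by apply/andP.
Qed.

Definition pt_neq (p q : Z * Z) : bool := ~~ (Z.eqb p.1 q.1 && Z.eqb p.2 q.2).

Lemma straight_of_check (R : realType) (T : finType) (e : rel T) (zp : T -> Z * Z)
    (VL : seq T) (EL : seq (T * T)) :
  (forall x, x \in VL) -> pairwise (fun x y => pt_neq (zp x) (zp y)) VL ->
  (forall x y, e x y -> (x, y) \in EL \/ (y, x) \in EL) -> (forall x, exists y, e x y) ->
  pairwise (fun p q => pair_check (zp p.1, zp p.2) (zp q.1, zp q.2)) EL ->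
  straight e (fun x => zpt R (zp x)).
Proof.
move=> allV pV allE deg pE; split=> //.
  move=> x y /zpt_inj xy; apply/eqP; apply/negPn/negP => ne.
  have := pairwise_neq pV (allV x) (allV y) ne.
  by rewrite xy /pt_neq !Z.eqb_refl.
have main p q : p \in EL -> q \in EL -> p != q ->
    sep (zpt R (zp p.1)) (zpt R (zp p.2)) (zpt R (zp q.1)) (zpt R (zp q.2)).
  by move=> pE' qE' pq; case/orP: (pairwise_neq pE pE' qE' pq) => /(pair_checkP R)[].
move=> x y z t /allE[xy|xy] /allE[zt|zt] ne.
- by apply: main xy zt _; apply: contraNneq ne => -[-> ->].
- by apply: sepCr; apply: main xy zt _; apply: contraNneq ne => -[-> ->]; rewrite finset.setUC.
- by apply: sepCl; apply: main xy zt _; apply: contraNneq ne => -[-> ->]; rewrite finset.setUC.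
- by apply: sepCl; apply: sepCr; apply: main xy zt _; apply: contraNneq ne => -[-> ->].
Qed.

(** * Drawing a ring from four tables of points *)

Section RingDrawing.
Variable R : realType.
Variables g1 g2 g3 g4 : seq (seq nat).
Variables (a1 b1 c1 a2 b2 c2 a3 b3 c3 a4 b4 c4 : nat).
Variables t1 t2 t3 t4 : seq (Z * Z).

Definition pnt (t : seq (Z * Z)) (k : nat) : Z * Z := nth (Z0, Z0) t k.

(** The copies [a2] and [a4] of the shared ports are left out, since their points must coincide with
    those of [a1] and [a3]; the drawing check tests this first. *)
Definition ring_points : seq (Z * Z) :=
  [seq pnt t1 k | k <- iota 0 (size g1)] ++ [seq pnt t2 k | k <- iota 0 (size g2) & ~~ eqn k a2] ++
  [seq pnt t3 k | k <- iota 0 (size g3)] ++ [seq pnt t4 k | k <- iota 0 (size g4) & ~~ eqn k a4].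

Definition ring_segments : seq ((Z * Z) * (Z * Z)) :=
  let segs t g := [seq (pnt t p.1, pnt t p.2) | p <- edge_list g] in
  segs t1 g1 ++ segs t2 g2 ++ segs t3 g3 ++ segs t4 g4 ++
  [:: (pnt t1 b1, pnt t3 b3); (pnt t1 c1, pnt t3 c3); (pnt t2 b2, pnt t4 b4); (pnt t2 c2, pnt t4 c4)].

Definition ring_drawing_check : bool :=
  [&& ~~ pt_neq (pnt t1 a1) (pnt t2 a2), ~~ pt_neq (pnt t3 a3) (pnt t4 a4),
    pairwise pt_neq ring_points & pairwise pair_check ring_segments].

Local Notation C1 := (cell_vertex g1).
Local Notation C2 := (cell_vertex g2).
Local Notation C3 := (cell_vertex g3).
Local Notation C4 := (cell_vertex g4).
Let A1 : C1 := inord a1. Let B1 : C1 := inord b1. Let K1 : C1 := inord c1.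
Let A2 : C2 := inord a2. Let B2 : C2 := inord b2. Let K2 : C2 := inord c2.
Let A3 : C3 := inord a3. Let B3 : C3 := inord b3. Let K3 : C3 := inord c3.
Let A4 : C4 := inord a4. Let B4 : C4 := inord b4. Let K4 : C4 := inord c4.
Local Notation V := (ring_type C1 C3 A2 A4).
Local Notation E := (ring_adj (@cell_adj g1) (@cell_adj g2) (@cell_adj g3) (@cell_adj g4)
  A1 B1 K1 B2 K2 A3 B3 K3 B4 K4 : rel V).

Hypotheses (ok1 : graph_ok g1) (ok2 : graph_ok g2) (ok3 : graph_ok g3) (ok4 : graph_ok g4).
Hypotheses (lt1 : [&& a1 < size g1, b1 < size g1 & c1 < size g1])
  (lt2 : [&& a2 < size g2, b2 < size g2 & c2 < size g2])
  (lt3 : [&& a3 < size g3, b3 < size g3 & c3 < size g3])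
  (lt4 : [&& a4 < size g4, b4 < size g4 & c4 < size g4]).
Hypothesis row1 : all (fun r => 0 < size r) g1.
Hypothesis row2 : all (fun r => 0 < size r) g2.
Hypothesis row3 : all (fun r => 0 < size r) g3.
Hypothesis row4 : all (fun r => 0 < size r) g4.
Hypothesis drawing : ring_drawing_check.

Definition ring_pos (x : V) : Z * Z :=
  match x with
  | inl (inl k) => pnt t1 (nat_of_ord k)
  | inl (inr k) => pnt t2 (nat_of_ord (val k))
  | inr (inl k) => pnt t3 (nat_of_ord k)
  | inr (inr k) => pnt t4 (nat_of_ord (val k))
  end.

Let s1 (k : nat) : V := slot1 C3 A2 A4 (inord k).
Let s2 (k : nat) : V := slot2 C3 A1 A2 A4 (inord k).
Let s3 (k : nat) : V := slot3 C1 A2 A4 (inord k).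
Let s4 (k : nat) : V := slot4 C1 A2 A3 A4 (inord k).

Lemma pt_neqF p q : ~~ pt_neq p q -> p = q.
Proof.
by rewrite negbK; case: p q => x y [z t] /= /andP[/Z.eqb_spec-> /Z.eqb_spec->].
Qed.

Lemma ring_pos_slots : [/\ {in gtn (size g1), forall k, ring_pos (s1 k) = pnt t1 k},
  {in gtn (size g2), forall k, ring_pos (s2 k) = pnt t2 k},
  {in gtn (size g3), forall k, ring_pos (s3 k) = pnt t3 k} &
  {in gtn (size g4), forall k, ring_pos (s4 k) = pnt t4 k}].
Proof.
have [/pt_neqF e12 /pt_neqF e34 _ _] := and4P drawing.
have iK g k : graph_ok g -> k < size g -> nat_of_ord (inord k : cell_vertex g) = k.
  by move=> ok kg; rewrite inordK // size_gE.
split=> k; rewrite inE => kg.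
- by rewrite /s1 /= iK.
- rewrite /s2 /slot2; have [E2|[y E2]] := wedge_inrP A2 (inord k).
    (* The shared port of the second cell takes its position from the first table; the tested
       coincidence [e12] makes both tables agree. *)
    have -> : k = a2 by rewrite -(iK _ _ ok2 kg) E2 iK //; case/and3P: lt2.
    by rewrite wedge_inrd /= iK //; case/and3P: lt1.
  by rewrite E2 wedge_inrE /= -E2 iK.
- by rewrite /s3 /= iK.
- rewrite /s4 /slot4; have [E2|[y E2]] := wedge_inrP A4 (inord k).
    have -> : k = a4 by rewrite -(iK _ _ ok4 kg) E2 iK //; case/and3P: lt4.
    by rewrite wedge_inrd /= iK //; case/and3P: lt3.
  by rewrite E2 wedge_inrE /= -E2 iK.
Qed.

Let VL : seq V := [seq s1 k | k <- iota 0 (size g1)] ++ [seq s2 k | k <- iota 0 (size g2) & ~~ eqn k a2] ++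
  [seq s3 k | k <- iota 0 (size g3)] ++ [seq s4 k | k <- iota 0 (size g4) & ~~ eqn k a4].
Let EL : seq (V * V) :=
  [seq (s1 p.1, s1 p.2) | p <- edge_list g1] ++ [seq (s2 p.1, s2 p.2) | p <- edge_list g2] ++
  [seq (s3 p.1, s3 p.2) | p <- edge_list g3] ++ [seq (s4 p.1, s4 p.2) | p <- edge_list g4] ++
  [:: (s1 b1, s3 b3); (s1 c1, s3 c3); (s2 b2, s4 b4); (s2 c2, s4 c4)].

Lemma ring_straight : straight E (fun x => zpt R (ring_pos x)).
Proof.
have [p1 p2 p3 p4] := ring_pos_slots; have [_ _ chkV chkE] := and4P drawing.
apply: (@straight_of_check _ _ _ _ VL EL).
- have mem g (f : nat -> V) (k : cell_vertex g) : graph_ok g -> f k \in [seq f k | k <- iota 0 (size g)].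
    by move=> ok; apply: map_f; rewrite mem_iota ltn_vertex.
  have s2v (k : {x : C2 | x != A2}) : inl (inr k) = s2 (nat_of_ord (val k)).
    by rewrite /s2 /slot2 inord_val wedge_inrE.
  have s4v (k : {x : C4 | x != A4}) : inr (inr k) = s4 (nat_of_ord (val k)).
    by rewrite /s4 /slot4 inord_val wedge_inrE.
  move=> [[k|k]|[k|k]]; rewrite /VL !mem_cat.
  + by have -> : inl (inl k) = s1 k :> V by [rewrite /s1 /slot1 inord_val]; rewrite mem.
  + rewrite s2v (map_f s2) ?orbT // mem_filter mem_iota add0n /= ltn_vertex // andbT.
    by move: (valP k); apply: contra => /eqP ka; rewrite -[val k]inord_val ka.
  + by have -> : inr (inl k) = s3 k :> V by [rewrite /s3 /slot3 inord_val]; rewrite mem ?orbT.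
  + rewrite s4v (map_f s4) ?orbT // mem_filter mem_iota add0n /= ltn_vertex // andbT.
    by move: (valP k); apply: contra => /eqP ka; rewrite -[val k]inord_val ka.
- rewrite -(pairwise_map ring_pos pt_neq); move: chkV; congr (pairwise _ _).
  rewrite /ring_points /VL !map_cat -!map_comp; congr cat; [|congr cat; [|congr cat]];
    apply/eq_in_map => k; rewrite ?mem_filter mem_iota; move=> h /=; apply/esym.
  + exact: p1.
  + by apply: p2; case/andP: h.
  + exact: p3.
  + by apply: p4; case/andP: h.
- have mem g (k l : cell_vertex g) (f : nat -> V) : graph_ok g -> cell_adj k l ->
      (f k, f l) \in [seq (f p.1, f p.2) | p <- edge_list g] \/
      (f l, f k) \in [seq (f p.1, f p.2) | p <- edge_list g].
    move=> ok /(edge_listP ok)[h|h]; [left|right];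
    by apply/mapP; eexists; first exact: h.
  have s1v (k : C1) : slot1 C3 A2 A4 k = s1 k by rewrite /s1 inord_val.
  have s2v (k : C2) : slot2 C3 A1 A2 A4 k = s2 k by rewrite /s2 inord_val.
  have s3v (k : C3) : slot3 C1 A2 A4 k = s3 k by rewrite /s3 inord_val.
  have s4v (k : C4) : slot4 C1 A2 A3 A4 k = s4 k by rewrite /s4 inord_val.
  move=> x y /(ring_adjP (cell_adj_sym ok2) (cell_adj_sym ok4)) [].
  + case=> k [l [-> -> kl]]; rewrite !s1v /EL !mem_cat.
    by case: (mem _ _ _ s1 ok1 kl) => ->; rewrite ?orbT; [left|right].
  + case=> k [l [-> -> kl]]; rewrite !s2v /EL !mem_cat.
    by case: (mem _ _ _ s2 ok2 kl) => ->; rewrite ?orbT; [left|right].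
  + case=> k [l [-> -> kl]]; rewrite !s3v /EL !mem_cat.
    by case: (mem _ _ _ s3 ok3 kl) => ->; rewrite ?orbT; [left|right].
  case=> [[k [l [-> -> kl]]]|[p [q [xy]]]].
    rewrite !s4v /EL !mem_cat.
    by case: (mem _ _ _ s4 ok4 kl) => ->; rewrite ?orbT; [left|right].
  have lk u v : u \in EL -> u = (inl p, inr q) -> v = u ->
      (x = inl p /\ y = inr q \/ x = inr q /\ y = inl p) -> (x, y) \in EL \/ (y, x) \in EL.
    by move=> uE uv _ [[-> ->]|[-> ->]]; [left|right]; rewrite -uv.
  have inEL u : u \in [:: (s1 b1, s3 b3); (s1 c1, s3 c3); (s2 b2, s4 b4); (s2 c2, s4 c4)] -> u \in EL.
    by move=> uE; rewrite /EL !mem_cat uE !orbT.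
  case/or4P=> /andP[/eqP pE /eqP qE].
  + by apply: (lk (s1 b1, s3 b3)) xy; rewrite ?pE ?qE // inEL // inE eqxx.
  + by apply: (lk (s1 c1, s3 c3)) xy; rewrite ?pE ?qE // inEL // !inE eqxx ?orbT.
  + by apply: (lk (s2 b2, s4 b4)) xy; rewrite ?pE ?qE // inEL // !inE eqxx ?orbT.
  + by apply: (lk (s2 c2, s4 c4)) xy; rewrite ?pE ?qE // inEL // !inE eqxx ?orbT.
- have nbr g (k : cell_vertex g) : graph_ok g -> all (fun r => 0 < size r) g -> exists l, cell_adj k l.
    move=> ok /all_nthP => /(_ [::] k (ltn_vertex ok k)); case E0: (nth _ _ _) => [//|l r] _.
    have lk : l \in nbrs g k by rewrite /nbrs E0 mem_head.
    have [_ ln _ _] := nbrsP ok lk; exists (inord l).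
    by rewrite /cell_adj inordK ?size_gE // is_nbrP.
  move=> [[k|k]|[k|k]].
  + by have [l kl] := nbr _ k ok1 row1; exists (inl (inl l)).
  + have [l kl] := nbr _ (val k) ok2 row2; exists (slot2 C3 A1 A2 A4 l).
    rewrite -(wedge_inrE A1) -[inl _]/(slot2 C3 A1 A2 A4 (val k)) /= wedge_inr_adj //;
      by [exact: cell_adj_irr|exact: cell_adj_sym].
  + by have [l kl] := nbr _ k ok3 row3; exists (inr (inl l)).
  + have [l kl] := nbr _ (val k) ok4 row4; exists (slot4 C1 A2 A3 A4 l).
    rewrite -(wedge_inrE A3) -[inr _]/(slot4 C1 A2 A3 A4 (val k)) /= wedge_inr_adj //;
      by [exact: cell_adj_irr|exact: cell_adj_sym].
- have -> : pairwise (fun p q => pair_check (ring_pos p.1, ring_pos p.2) (ring_pos q.1, ring_pos q.2)) EL =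
      pairwise pair_check [seq (ring_pos p.1, ring_pos p.2) | p <- EL] by rewrite pairwise_map.
  move: chkE; congr (pairwise _ _); rewrite /ring_segments /EL !map_cat -!map_comp.
  have [[/and3P[l1 l1' l1''] /and3P[l2 l2' l2'']] [/and3P[l3 l3' l3''] /and3P[l4 l4' l4'']]] :=
    conj (conj lt1 lt2) (conj lt3 lt4).
  rewrite -(p1 _ l1') -(p1 _ l1'') -(p2 _ l2') -(p2 _ l2'') -(p3 _ l3') -(p3 _ l3'') -(p4 _ l4') -(p4 _ l4'').
  have segE g t (s : nat -> V) : graph_ok g -> {in gtn (size g), forall k, ring_pos (s k) = pnt t k} ->
      [seq (pnt t p.1, pnt t p.2) | p <- edge_list g] =
      [seq ((fun p : V * V => (ring_pos p.1, ring_pos p.2)) \o (fun p => (s p.1, s p.2))) i | i <- edge_list g].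
    move=> ok ps; apply/eq_in_map => -[k l] kl /=.
    by have /andP[? ?] := edge_list_lt ok kl; rewrite !ps.
  by rewrite (segE _ _ _ ok1 p1) (segE _ _ _ ok2 p2) (segE _ _ _ ok3 p3) (segE _ _ _ ok4 p4).
Qed.

End RingDrawing.

(** Lists the corners counterclockwise from the upper right, so that consecutive entries of [q] are
    adjacent. *)
Definition quad_nth (q : seq nat) (i : bool * bool) : nat :=
  match i with
  | (true, true) => nth 0 q 0 | (false, true) => nth 0 q 1
  | (false, false) => nth 0 q 2 | (true, false) => nth 0 q 3
  end.

Definition all_corners (P : pred (bool * bool)) : bool :=
  [&& P (true, true), P (false, true), P (false, false) & P (true, false)].

Lemma all_cornersP P : all_corners P -> forall i, P i.
Proof. by move=> /and4P[? ? ? ?] [[] []]. Qed.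

Section QuadCheck.
Variables (g : seq (seq nat)) (a b c : nat) (q : seq nat).

(** The default 0 is harmless: [corner_check] compares every neighbour of the corner with the two
    sides and this value, and so certifies degree at most three. *)
Definition third_neighbour (i : bool * bool) : nat :=
  head 0 [seq l <- nbrs g (quad_nth q i) |
    ~~ (eqn l (quad_nth q (rflip i)) || eqn l (quad_nth q (gflip i)))].

Definition corner_check (i : bool * bool) : bool :=
  let k := quad_nth q i in
  [&& k < size g, is_nbr g k (quad_nth q (rflip i)), is_nbr g k (quad_nth q (gflip i)),
    ~~ [|| eqn k a, eqn k b | eqn k c] &
    all (fun l => [|| eqn l (quad_nth q (rflip i)), eqn l (quad_nth q (gflip i)) |
                    eqn l (third_neighbour i)]) (nbrs g k)].

Definition quad_check : bool :=
  [&& uniq q, eqn (size q) 4, [&& a < size g, b < size g & c < size g] & all_corners corner_check].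

Lemma quad_checkP : graph_ok g -> quad_check ->
  quad (@cell_adj g) [set: cell_vertex g]%SET (inord a) (inord b) (inord c)
    (fun i => inord (quad_nth q i) : cell_vertex g).
Proof.
move=> ok /and4P[uq /eqP sq /and3P[an bn cn] /all_cornersP ch].
have iK k : k < size g -> (inord k : cell_vertex g) = k :> nat by move=> kg; rewrite inordK // size_gE.
have kn i : quad_nth q i < size g by case/and5P: (ch i).
have nbrsv i (y : cell_vertex g) : cell_adj (inord (quad_nth q i)) y = (nat_of_ord y \in nbrs g (quad_nth q i)).
  by rewrite /cell_adj is_nbrP iK.
split.
- move=> i j /(congr1 (@nat_of_ord _)); rewrite !iK //.
  have inj k l : k < 4 -> l < 4 -> nth 0 q k = nth 0 q l -> k = l.
    by move=> k4 l4 E; apply/eqP; rewrite -(nth_uniq 0 _ _ uq) ?sq //; apply/eqP.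
  by case: i j => [[] []] [[] []] //= /inj; move=> /(_ isT isT).
- by move=> i; rewrite nbrsv iK // -is_nbrP; case/and5P: (ch i).
- by move=> i; rewrite nbrsv iK // -is_nbrP; case/and5P: (ch i).
- by move=> i; rewrite finset.inE.
- move=> i; have /and5P[_ _ _ + _] := ch i.
  by rewrite !inE -!val_eqE /= !iK.
- exists (fun i => inord (third_neighbour i) : cell_vertex g); move=> i y; rewrite nbrsv.
  have /and5P[_ _ _ _ /allP h] := ch i; move/h; rewrite !inE -!val_eqE /= (iK _ (kn (rflip i))) (iK _ (kn (gflip i))).
  case/or3P=> /eqP E; first by rewrite E eqxx.
    by rewrite E eqxx orbT.
  by rewrite -E inord_val eqxx !orbT.
Qed.

End QuadCheck.

(** * Families closed under enlargement *)

Section Family.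
Variable R : realType.

(* a hypotraceable ring with a drawing whose outer face is bounded by the
   square on the four cubic vertices [v i] *)
Definition drawn_ring (n : nat) : Prop :=
  exists (T : finType) (e : rel T) (v : bool * bool -> T) (pos : T -> R * R) (a : R),
    [/\ #|T| = n, symmetric e /\ irreflexive e, quad_ring e v, straight e pos & in_square pos v a].

Lemma drawn_ringS n : drawn_ring n -> drawn_ring (n + 4).
Proof.
case=> T [e [v [pos [a [nT [sym irr] qr st sq]]]]].
exists (T + bool * bool)%type, (th_adj e v), inr, (th_pos pos a), (a + a)%R; split.
- by rewrite card_sum nT card_prod card_bool.
- by split; [exact: th_adj_sym|exact: th_adj_irrefl].
- exact: th_quad_ring.
- exact: th_straight.
- exact: th_in_square sq.
Qed.

(** A deleted graph lives on a subtype, whereas the ring lemmas speak of paths on the complement of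
    a vertex; [hampath_map] along [val] translates between the two. *)
Lemma drawn_ring_graph n : drawn_ring n ->
  exists G : sgraph, [/\ #|G| = n, planar R G & hypotraceable G].
Proof.
case=> T [e [v [pos [a [nT [sym irr] [H1 [H2 [H3 [H4 [w [w' [b1 [c1 [b2 [c2 [b3 [c3 [b4 [c4 [rg _]]]]]]]]]]]]]]] st sq]]]]].
exists (SGraph sym irr); split=> //; first exact: (@straight_planar R (SGraph sym irr) pos st).
split.
  case=> -[|x s] [/= ss us all_s]; first by have := all_s w.
  apply: (ring_no_ham sym rg (p := x) (q := last x s)); exists s; split=> //.
  by move=> y; rewrite finset.in_setT; exact: all_s.
move=> x; have [p [q h]] := ring_del sym x rg.
pose C : finType := {y : T | y != x}.
have imC : [set~ x]%SET = (val : C -> T) @: [set: C]%SET.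
  apply/setP => y; rewrite !finset.inE; apply/idP/imsetP => [yx|[y' _ ->]]; last exact: (valP y').
  by exists (Sub y yx : C); rewrite ?SubK.
have [px qx] := hampath_ends h; rewrite imC in h px qx.
have [p' _ pE] := imsetP px; have [q' _ qE] := imsetP qx; rewrite pE qE in h.
have [_ back] := @hampath_map C T (fun y z => e (val y) (val z)) e val [set: C]%SET val_inj
   (fun _ _ _ _ => erefl) [set: C]%SET p' q' (subxx _).
have [s [ps _ us all_s]] := back h.
by exists (p' :: s); split=> // y; rewrite all_s finset.in_setT.
Qed.

End Family.

(** * The four base rings *)

Definition cell_data (g : seq (seq nat)) (a b c : nat) : Prop :=
  [/\ graph_ok g, all (fun r => 0 < size r) g, [&& a < size g, b < size g & c < size g]
    & cell (@cell_adj g) [set: cell_vertex g]%SET (inord a) (inord b) (inord c)].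

Definition in_box (m : Z) (p : Z * Z) : bool :=
  [&& Z.leb (Z.opp m) p.1, Z.leb p.1 m, Z.leb (Z.opp m) p.2 & Z.leb p.2 m].

(** The origin is the default value of [pnt], so the bound holds for every index without a
    comparison of table lengths. *)
Lemma in_box0 m : Z.ltb Z0 m -> in_box m (Z0, Z0).
Proof. by move=> /Z.ltb_spec0 m0; apply/and4P; split; apply/Z.leb_spec0 => /=; lia. Qed.

Definition square_check (m : Z) (q : seq nat) (t1 t2 t3 t4 : seq (Z * Z)) : bool :=
  [&& Z.ltb Z0 m, all (in_box m) (t1 ++ t2 ++ t3 ++ t4) &
    all_corners (fun i => ~~ pt_neq (pnt t1 (quad_nth q i))
      (if i.1 then m else Z.opp m, if i.2 then m else Z.opp m))].

Lemma drawn_ring_base (R : realType) g1 g2 g3 g4 a1 b1 c1 a2 b2 c2 a3 b3 c3 a4 b4 c4 q m t1 t2 t3 t4 :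
  cell_data g1 a1 b1 c1 -> cell_data g2 a2 b2 c2 -> cell_data g3 a3 b3 c3 -> cell_data g4 a4 b4 c4 ->
  quad_check g1 a1 b1 c1 q -> square_check m q t1 t2 t3 t4 ->
  ring_drawing_check g1 g2 g3 g4 a1 b1 c1 a2 b2 c2 a3 b3 c3 a4 b4 c4 t1 t2 t3 t4 ->
  drawn_ring R (size g1 + (size g2).-1 + (size g3 + (size g4).-1)).
Proof.
move=> [ok1 row1 lt1 cell1] [ok2 row2 lt2 cell2] [ok3 row3 lt3 cell3] [ok4 row4 lt4 cell4].
move=> qc; have qd := quad_checkP ok1 qc; move=> /and3P[m0 /allP box /all_cornersP cor] drawing.
exists (ring_type (cell_vertex g1) (cell_vertex g3) (inord a2 : cell_vertex g2) (inord a4 : cell_vertex g4)).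
have qr := ring_graph_quad (cell_adj_sym ok2) (cell_adj_sym ok4) (cell_adj_irr ok1) (cell_adj_irr ok2)
  (cell_adj_irr ok3) (cell_adj_irr ok4) cell1 cell2 cell3 cell4 qd.
do 2!eexists; exists (fun x => zpt R (ring_pos t1 t2 t3 t4 x)), (zr R m); split; [| |exact: qr| |].
- by rewrite card_ring_type !card_ord !size_gE.
- split; last exact: (ring_adj_irr _ _ _ _ _ _ _ _ _ _ (cell_adj_irr ok1) (cell_adj_irr ok2) (cell_adj_irr ok3) (cell_adj_irr ok4)).
  exact: (ring_adj_sym _ _ _ _ _ _ _ _ _ _ (cell_adj_sym ok1) (cell_adj_sym ok2) (cell_adj_sym ok3) (cell_adj_sym ok4)).
- exact: ring_straight.
split.
- exact: zr_lt m0.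
- have pbox t k : {subset t <= t1 ++ t2 ++ t3 ++ t4} -> in_box m (pnt t k).
    move=> sub; have [kt|kt] := ltnP k (size t); first by apply: box; apply: sub; exact: mem_nth.
    by rewrite /pnt nth_default //; exact: in_box0.
  move=> x; have : in_box m (ring_pos t1 t2 t3 t4 x).
    by case: x => [[x|x]|[x|x]]; apply: pbox => p; rewrite !mem_cat => ->; rewrite ?orbT.
  by case/and4P=> /(zr_le R) h1 /(zr_le R) h2 /(zr_le R) h3 /(zr_le R) h4; rewrite -zrN; apply/andP; split; apply/andP.
- have /and4P[_ _ _ /all_cornersP inside] := qc.
  move=> i; have /and5P[iq _ _ _ _] := inside i.
  rewrite /= inordK ?size_gE // (pt_neqF (cor i)) /zpt /corner /sg.
  by case: i {iq} => [[] []] /=; rewrite ?zrN ?mul1r ?mulN1r.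
Qed.

Lemma cell_data_check g a b c wit sb sc :
  [&& graph_ok g, all (fun r => 0 < size r) g & cell_check g a b c wit sb sc] -> cell_data g a b c.
Proof.
case/and3P=> ok pos check; split=> //; last exact: (cell_checkP ok check).
by case/and5P: check => /andP[/andP[-> ->] ->].
Qed.

(** Checked directly and not through [th_cell]: the old quadrilateral 0, 1, 2, 3 contains the port
    0, and its other corners have degree four. *)
Lemma cell39_cell : cell_data cell39 19 4 0.
Proof. by apply: (@cell_data_check _ _ _ _ cell39_del cell39_span_b cell39_span_c); lazy. Qed.

Lemma cell38_cell : cell_data cell38 19 4 0.
Proof. by apply: (@cell_data_check _ _ _ _ cell38_del cell38_span_b cell38_span_c); lazy. Qed.

Lemma cell39_quad : quad_check cell39 19 4 0 [:: 37; 38; 35; 36].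
Proof. by lazy. Qed.

(** The first cell is always [cell39], as only its quadrilateral is cubic and free of ports. Two
    ports are identified with others, so four such cells give 39 + 38 + 39 + 38 = 154 vertices, and
    each replacement by [cell38] lowers the order by one. *)
Lemma drawn_ring_table (R : realType) g2 g3 g4 (ts : seq (seq (Z * Z))) :
  cell_data g2 19 4 0 -> cell_data g3 19 4 0 -> cell_data g4 19 4 0 ->
  let t := nth [::] ts in
  square_check half_side [:: 37; 38; 35; 36] (t 0) (t 1) (t 2) (t 3) &&
  ring_drawing_check cell39 g2 g3 g4 19 4 0 19 4 0 19 4 0 19 4 0 (t 0) (t 1) (t 2) (t 3) ->
  drawn_ring R (39 + (size g2).-1 + (size g3 + (size g4).-1)).
Proof.
by move=> cell2 cell3 cell4 t /andP[]; exact: drawn_ring_base cell39_cell cell2 cell3 cell4 cell39_quad.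
Qed.

Lemma drawn_ring154 (R : realType) : drawn_ring R 154.
Proof.
by apply: (drawn_ring_table R (ts := ring154_pos) cell39_cell cell39_cell cell39_cell); lazy.
Qed.

Lemma drawn_ring153 (R : realType) : drawn_ring R 153.
Proof.
by apply: (drawn_ring_table R (ts := ring153_pos) cell39_cell cell39_cell cell38_cell); lazy.
Qed.

Lemma drawn_ring152 (R : realType) : drawn_ring R 152.
Proof.
by apply: (drawn_ring_table R (ts := ring152_pos) cell39_cell cell38_cell cell38_cell); lazy.
Qed.

Lemma drawn_ring151 (R : realType) : drawn_ring R 151.
Proof.
by apply: (drawn_ring_table R (ts := ring151_pos) cell38_cell cell38_cell cell38_cell); lazy.
Qed.

Theorem theorem4p5 (R : realType) :
  (exists G : sgraph, [/\ #|G| = 154%N, planar R G & hypotraceable G]) /\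
  (forall n : nat, (156 <= n)%N ->
     exists G : sgraph, [/\ #|G| = n, planar R G & hypotraceable G]).
Proof.
have ladder n k : drawn_ring R n -> drawn_ring R (n + k * 4).
  by move=> dn; elim: k => [|k IH]; rewrite ?addn0 // mulSnr addnA; exact: drawn_ringS.
split; first exact: drawn_ring_graph (drawn_ring154 R).
move=> n n156; apply: drawn_ring_graph.
have n151 : 151 <= n by exact: leq_trans n156.
(* The remainder of [n - 151] modulo 4 selects the base ring, the quotient the number of
   enlargements. *)
rewrite -(subnKC n151) (divn_eq (n - 151) 4) (addnC (_ * 4)) addnA; apply: ladder.
have : (n - 151) %% 4 < 4 by rewrite ltn_mod.
case: ((n - 151) %% 4) => [|[|[|[|//]]]] _.
- exact: drawn_ring151.
- exact: drawn_ring152.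
- exact: drawn_ring153.
- exact: drawn_ring154.
Qed.
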